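(* Let $R>0$, $\lambda>1$, $\beta\in(0,1)$ and $F\in H^{k+1}(\Omega)$, and let $J_{\lambda,\beta}(v,F)$ be the functional $$J_{\lambda,\beta}(v,F)=e^{-2\lambda(\alpha+\varepsilon)}\int_\Omega [A(v+F)]^2\varphi_\lambda^2\,dx+\beta\|v\|_{H^k(\Omega)}^2 ,\qquad v\in H_0^k(\Omega).$$ Then $J_{\lambda,\beta}(v,F)$ has a Fréchet derivative (with respect to $v$) $J'_{\lambda,\beta}(v,F)\in H_0^k(\Omega)$ at every $v\in B(2R)$. Moreover, this derivative satisfies the Lipschitz continuity condition $$\|J'_{\lambda,\beta}(v_1,F)-J'_{\lambda,\beta}(v_2,F)\|_{H^k(\Omega)}\le L\|v_1-v_2\|_{H^k(\Omega)},\qquad \forall v_1,v_2\in\overline B(R),$$ where the constant $L=L(R,A,F,\Omega,\lambda,\alpha,\varepsilon,\beta)>0$ depends only on the listed parameters.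
   Context: Let $\Omega\subset\mathbb R^n$ be a bounded domain. $A$ is a quasilinear second-order partial differential operator $$A(u)=\sum_{|s|=2}a_s(x)D^su+A_1(x,\nabla u,u),\qquad A_0u=\sum_{|s|=2}a_s(x)D^su,$$ ($s$ a multi-index, $A_0$ the linear principal part), with real-valued $a_s\in C^1(\overline\Omega)$ and $A_1=A_1(x,y)\in C^3\{(x,y):x\in\overline\Omega,\ y\in\mathbb R^{n+1}\}$. Set $k=[n/2]+2$, where $[n/2]$ is the largest integer not exceeding $n/2$. The embedding $H^k(\Omega)\subset C^1(\overline\Omega)$ with $\|f\|_{C^1(\overline\Omega)}\le C(\Omega)\|f\|_{H^k(\Omega)}$ is used throughout. Let $\Gamma\subseteq\partial\Omega$, $\Gamma\in C^\infty$, be a part of the boundary which is not part of a characteristic hypersurface of $A_0$. Spaces consist of real-valued functions, and $$H_0^k(\Omega)=\{f\in H^k(\Omega): f|_\Gamma=0,\ \partial_nf|_\Gamma=0\},$$ a Hilbert space with the scalar product $[\cdot,\cdot]$ of $H^k(\Omega)$. Let $\psi\in C^\infty(\overline\Omega)$ with $|\nabla\psi|\ne0$ in $\overline\Omega$. For $\alpha>0$ put $\psi_\alpha=\{x\in\overline\Omega:\psi(x)=\alpha\}$, $\Omega_\alpha=\{x\in\Omega:\psi(x)>\alpha\}$. The numbers $\alpha>0$ and $\varepsilon>0$ are such that $\Omega_\alpha\neq\varnothing$ and $\Omega_{\alpha+2\varepsilon}\ne\varnothing$; $\Gamma_\alpha=\Gamma\cap\overline\Omega_\alpha\neq\varnothing$,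 and $\partial\Omega_\alpha=\psi_\alpha\cup\Gamma_\alpha$. For $\lambda>1$ the Carleman Weight Function is $\varphi_\lambda^2$, where $\varphi_\lambda(x)=\exp[\lambda\psi(x)]$. The data $\Omega,\Gamma,\psi,\alpha,\varepsilon$ are fixed. For $R>0$, $B(R)=\{u\in H_0^k(\Omega):\|u\|_{H^k(\Omega)}<R\}$ and $\overline B(R)$ is the closed ball. The Fréchet derivative, a bounded linear functional on $H_0^k(\Omega)$, is identified with an element of $H_0^k(\Omega)$ via the Riesz theorem: $J'_{\lambda,\beta}(v,F)(h)=[J'_{\lambda,\beta}(v,F),h]$ for $h\in H_0^k(\Omega)$. *)

(* Defs.v *)
From HB Require Import structures.
From mathcomp Require Import all_boot all_order all_algebra.
From mathcomp Require Import all_classical all_reals all_analysis.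

Set Implicit Arguments.
Unset Strict Implicit.
Unset Printing Implicit Defensive.

Import Order.TTheory GRing.Theory Num.Theory.
Import numFieldNormedType.Exports.

Local Open Scope classical_set_scope.
Local Open Scope ring_scope.

Definition measure_row_display : measure_display -> measure_display.
Proof. exact. Qed.

(* The product sigma-algebra on row vectors, as for n.-tuple in the library;
   on R^n it coincides with the Borel sigma-algebra. *)
Section measurable_row.
Context {R : realType} (n : nat).

Let coors : 'I_n -> 'rV[R]_n -> R := fun i x => x ord0 i.

Let row_set0 : g_sigma_preimage coors set0.
Proof. exact: sigma_algebra0. Qed.

Let row_setC A : g_sigma_preimage coors A -> g_sigma_preimage coors (~` A).
Proof. exact: sigma_algebraC. Qed.

Let row_bigcup (F : _^nat) : (forall i, g_sigma_preimage coors (F i)) ->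
  g_sigma_preimage coors (\bigcup_i (F i)).
Proof. exact: sigma_algebra_bigcup. Qed.

HB.instance Definition _ := @isMeasurable.Build
  (measure_row_display default_measure_display) 'rV[R]_n
  (g_sigma_preimage coors) row_set0 row_setC row_bigcup.

End measurable_row.

Section lebesgue_measure_row.
Context {R : realType}.

Lemma measurable_coord n (i : 'I_n) :
  measurable_fun [set: 'rV[R]_n] (fun x : 'rV[R]_n => x ord0 i).
Proof.
move=> _ Y mY; rewrite setTI; apply: sub_sigma_algebra => /=.
rewrite -bigcup_seq/=; exists i => /=; first by rewrite mem_index_enum.
by exists Y => //; rewrite setTI.
Qed.

Lemma measurable_fun_rowP d (T : measurableType d) n (f : T -> 'rV[R]_n) :
  (forall i, measurable_fun [set: T] (fun t => f t ord0 i)) ->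
  measurable_fun [set: T] f.
Proof.
move=> mf _ A; apply: (smallest_sub (C := sigma_algebra setT)
  (X := [set A | measurable (setT `&` f @^-1` A)])).
- split => /=.
  + by rewrite preimage_set0 setI0.
  + move=> B; rewrite /= !setTI => mB; rewrite setTD preimage_setC.
    exact: measurableC.
  + move=> F mF /=; rewrite setTI preimage_bigcup.
    by apply: bigcup_measurable => k _; have := mF k; rewrite /= setTI.
- move=> B /=; rewrite -bigcup_seq => -[i _ [C mC <-]].
  by rewrite !setTI; have := mf i measurableT C mC; rewrite setTI.
Qed.

Definition cons_row n (p : measurableTypeR R * 'rV[R]_n) : 'rV[R]_n.+1 :=
  row_mx (const_mx p.1 : 'rV[R]_1) p.2.

Definition uncons_row n (x : 'rV[R]_n.+1) : measurableTypeR R * 'rV[R]_n :=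
  (x ord0 ord0, rsubmx (x : 'rV[R]_(1 + n))).

Lemma cons_rowK n : cancel (@cons_row n) (@uncons_row n).
Proof.
move=> [a y]; rewrite /uncons_row /cons_row row_mxKr; congr pair.
rewrite [LHS](_ : _ = row_mx (const_mx a : 'rV_1) y ord0 (lshift n ord0)).
  by rewrite row_mxEl mxE.
by congr (fun_of_matrix _ _ _); exact: val_inj.
Qed.

Lemma cons_rowEl n p (j : 'I_1) :
  @cons_row n p ord0 (lshift n j : 'I_(1 + n)) = p.1.
Proof. by rewrite [LHS](@row_mxEl _ 1 1 n) mxE. Qed.

Lemma cons_rowEr n p (j : 'I_n) :
  @cons_row n p ord0 (rshift 1 j : 'I_(1 + n)) = p.2 ord0 j.
Proof. by rewrite [LHS](@row_mxEr _ 1 1 n). Qed.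

Lemma measurable_cons_row n : measurable_fun setT (@cons_row n).
Proof.
apply: measurable_fun_rowP => i.
case: (@split_ordP 1 n i) => j ->.
  by under eq_fun do rewrite cons_rowEl; exact: measurable_fst.
under eq_fun do rewrite cons_rowEr.
by apply: (measurableT_comp (measurable_coord j)); exact: measurable_snd.
Qed.

Lemma measurable_uncons_row n : measurable_fun setT (@uncons_row n).
Proof.
apply/measurable_fun_pairP; split; first exact: measurable_coord.
apply: measurable_fun_rowP => i; rewrite /uncons_row /=.
by under eq_fun do rewrite mxE; exact: measurable_coord.
Qed.

Section lebS.
Variables (n : nat) (m : {sigma_finite_measure set 'rV[R]_n -> \bar R}).

Definition lebS : set 'rV[R]_n.+1 -> \bar R :=
  pushforward (@lebesgue_measure R \x m)%E (@cons_row n).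

Let lebS_preimage (A : set 'rV[R]_n.+1) :
  measurable A -> measurable (@cons_row n @^-1` A).
Proof.
by move=> mA; rewrite -[X in measurable X]setTI; exact: measurable_cons_row.
Qed.

Let lebS0 : lebS set0 = 0%E.
Proof. by rewrite /lebS /pushforward preimage_set0 measure0. Qed.

Let lebS_ge0 A : (0 <= lebS A)%E.
Proof. by rewrite /lebS /pushforward measure_ge0. Qed.

Let lebS_sigma_additive : semi_sigma_additive lebS.
Proof.
move=> F mF tF mUF; rewrite /lebS /pushforward preimage_bigcup.
apply: measure_semi_sigma_additive.
- by move=> k; exact: lebS_preimage.
- apply/trivIsetP => /= i j _ _ ij; rewrite -preimage_setI.
  by move/trivIsetP : tF => /(_ _ _ _ _ ij) ->//; rewrite preimage_set0.
- by rewrite -preimage_bigcup; exact: lebS_preimage.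
Qed.

HB.instance Definition _ := isMeasure.Build _ _ _
  lebS lebS0 lebS_ge0 lebS_sigma_additive.

Let lebS_sigma_finite : sigma_finite setT lebS.
Proof.
have /sigma_finiteP[F [TF ndF Foo]] := sigma_finiteT (@lebesgue_measure R).
have /sigma_finiteP[G [TG ndG Goo]] := sigma_finiteT m.
exists (fun k => @uncons_row n @^-1` (F k `*` G k)).
  rewrite -preimage_bigcup [X in _ @^-1` X](_ : _ = setT) ?preimage_setT//.
  rewrite -subTset => -[x y] _.
  have [i _ Fx] : (\bigcup_i F i) x by rewrite -TF.
  have [j _ Gy] : (\bigcup_i G i) y by rewrite -TG.
  exists (maxn i j) => //; split => /=.
    by move: x Fx; exact/subsetPset/ndF/leq_maxl.
  by move: y Gy; exact/subsetPset/ndG/leq_maxr.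
move=> k; have [mF Fk] := Foo k; have [mG Gk] := Goo k; split.
  rewrite -[X in measurable X]setTI.
  by apply: measurable_uncons_row => //; exact: measurableX.
rewrite /lebS /pushforward -comp_preimage [X in X @^-1` _](_ : _ = id); last first.
  by rewrite funeqE => p; exact: cons_rowK.
by rewrite preimage_id product_measure1E// lte_mul_pinfty// ge0_fin_numE.
Qed.

HB.instance Definition _ := Measure_isSigmaFinite.Build _ _ _
  lebS lebS_sigma_finite.

End lebS.

Fixpoint leb (n : nat) : {sigma_finite_measure set 'rV[R]_n -> \bar R} :=
  match n return {sigma_finite_measure set 'rV[R]_n -> \bar R} with
  | 0 => dirac (0 : 'rV[R]_0)
  | m.+1 => lebS (leb m)
  end.

End lebesgue_measure_row.

Section classical_derivatives.
Context {R : realType} {n : nat}.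
Implicit Types (f g : 'rV[R]_n -> R) (U : set 'rV[R]_n) (l : seq 'I_n).

Definition frontier U : set 'rV[R]_n := closure U `\` interior U.

Definition dot (u v : 'rV[R]_n) : R := \sum_i u ord0 i * v ord0 i.

Definition basis_vec (i : 'I_n) : 'rV[R]_n := delta_mx ord0 i.

Definition partials l f : 'rV[R]_n -> R :=
  foldr (fun i g x => 'D_(basis_vec i) g x) f l.

(* C^m on an open set U: all iterated partial derivatives, in any order of
   differentiation, exist and are continuous on U. *)
Definition Cm (m : nat) U f : Prop :=
  forall l, (size l <= m)%N ->
    (forall x, U x -> {for x, continuous (partials l f)}) /\
    ((size l < m)%N ->
      forall i x, U x -> derivable (partials l f) x (basis_vec i)).

(* C^m up to the closure: f itself is continuous on the closure of U, and its
   partial derivatives of order <= m in U extend continuously to the closure,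
   i.e. have limits along U at every point of the closure. *)
Definition Cm_closure (m : nat) U f : Prop :=
  [/\ {within closure U, continuous f},
      Cm m U f &
      forall l, (size l <= m)%N -> forall x, closure U x ->
        cvg (partials l f @ within U (nbhs x))].

(* Value on the closure of U of the continuous extension of a derivative. *)
Definition partials_closure U l f (x : 'rV[R]_n) : R :=
  lim (partials l f @ within U (nbhs x)).

Definition grad f (x : 'rV[R]_n) : 'rV[R]_n := \row_i partials [:: i] f x.

Definition grad_closure U f (x : 'rV[R]_n) : 'rV[R]_n :=
  \row_i partials_closure U [:: i] f x.

Definition C1_norm U f : R :=
  sup [set `|f x| | x in closure U] +
  \sum_(i < n) sup [set `|partials_closure U [:: i] f x| | x in closure U].

(* g is a C^oo defining function of the hypersurface S near x. *)
Definition local_defining (S : set 'rV[R]_n) (x : 'rV[R]_n) g : Prop :=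
  exists U : set 'rV[R]_n,
    [/\ open U, U x, forall m, Cm m U g, forall y, U y -> grad g y != 0 &
        forall y, U y -> (S y <-> g y = 0)].

Definition smooth_hypersurface (S : set 'rV[R]_n) : Prop :=
  forall x, S x -> exists g, local_defining S x g.

(* Either of the two unit normals to S at x. *)
Definition unit_normal (S : set 'rV[R]_n) (x nu : 'rV[R]_n) : Prop :=
  dot nu nu = 1 /\
  exists g, local_defining S x g /\ exists c : R, nu = c *: grad g x.

End classical_derivatives.

Section multi_indices.
Context {n : nat}.

Definition mdeg (s : 'I_n -> nat) : nat := (\sum_i s i)%N.

Definition mseq (s : 'I_n -> nat) : seq 'I_n :=
  flatten [seq nseq (s i) i | i <- enum 'I_n].

Definition munit (i : 'I_n) : 'I_n -> nat := fun j => (j == i).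

End multi_indices.

(* Contains every multi-index of order at most m; order restrictions are put on
   the sums that range over it. *)
Definition midx (n m : nat) := {ffun 'I_n -> 'I_m.+1}.

Definition mval (n m : nat) (s : midx n m) : 'I_n -> nat := fun i => s i.

Section sobolev.
Context {R : realType} {n : nat}.
Variable Omega : set 'rV[R]_n.
Implicit Types (f g u v w : 'rV[R]_n -> R) (s : 'I_n -> nat).

Definition ae_eq_on f g : Prop :=
  {ae leb n, forall x, Omega x -> f x = g x}.

Definition test_function (phi : 'rV[R]_n -> R) : Prop :=
  (forall m, Cm m setT phi) /\
  exists K : set 'rV[R]_n,
    [/\ compact K, K `<=` Omega & forall x, ~ K x -> phi x = 0].

Definition loc_integrable f : Prop :=
  measurable_fun Omega f /\
  forall K : set 'rV[R]_n, compact K -> K `<=` Omega ->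
    (leb n).-integrable K (EFin \o f).

Definition weak_derivative s u w : Prop :=
  [/\ loc_integrable u, loc_integrable w &
      forall phi, test_function phi ->
        \int[leb n]_(x in Omega) (u x * partials (mseq s) phi x) =
        (-1) ^+ mdeg s * \int[leb n]_(x in Omega) (w x * phi x)].

(* D^s u: a representative of the weak derivative (unique a.e. on Omega). *)
Definition wD s u : 'rV[R]_n -> R :=
  xget (cst 0) [set w | weak_derivative s u w].

Definition wgrad u (x : 'rV[R]_n) : 'rV[R]_n := \row_i wD (munit i) u x.

Definition L2 f : Prop :=
  measurable_fun Omega f /\
  (leb n).-integrable Omega (EFin \o (fun x => f x ^+ 2)).

(* H^m(Omega), as a set of representatives; only values on Omega matter. *)
Definition sobolev (m : nat) u : Prop :=
  forall s, (mdeg s <= m)%N -> exists2 w, weak_derivative s u w & L2 w.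

Definition Hprod (m : nat) u v : R :=
  \sum_(s : midx n m | (mdeg (mval s) <= m)%N)
    \int[leb n]_(x in Omega) (wD (mval s) u x * wD (mval s) v x).

Definition Hnorm (m : nat) u : R := Num.sqrt (Hprod m u u).

Definition C1_embedding (m : nat) : Prop :=
  exists2 C : R, 0 < C &
    forall u, sobolev m u -> exists g,
      [/\ Cm_closure 1 Omega g, ae_eq_on u g & C1_norm Omega g <= C * Hnorm m u].

(* The subspace of H^m(Omega) of functions whose value and normal derivative
   vanish on Gamma; the traces are those of the C^1 representative. *)
Definition sobolev0 (Gamma : set 'rV[R]_n) (m : nat) u : Prop :=
  sobolev m u /\
  exists g, [/\ Cm_closure 1 Omega g, ae_eq_on u g &
    forall x, Gamma x -> g x = 0 /\
      forall nu, unit_normal Gamma x nu -> dot (grad_closure Omega g x) nu = 0].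

(* DJ, an element of the space H = sobolev0 Gamma m, is the Riesz
   representative of the Frechet derivative of J : H -> R at v. *)
Definition frechet_derivative (Gamma : set 'rV[R]_n) (m : nat)
    (J : ('rV[R]_n -> R) -> R) v (DJ : 'rV[R]_n -> R) : Prop :=
  sobolev0 Gamma m DJ /\
  forall e : R, 0 < e -> exists2 d : R, 0 < d &
    forall h, sobolev0 Gamma m h -> Hnorm m h <= d ->
      `|J (v \+ h) - J v - Hprod m DJ h| <= e * Hnorm m h.

End sobolev.

Section quasilinear.
Context {R : realType} {n : nat}.
Variables (Omega : set 'rV[R]_n) (a : midx n 2 -> 'rV[R]_n -> R)
  (A1 : 'rV[R]_n -> 'rV[R]_(n + 1) -> R).

Definition principal_part (u : 'rV[R]_n -> R) (x : 'rV[R]_n) : R :=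
  \sum_(s : midx n 2 | mdeg (mval s) == 2%N) a s x * wD Omega (mval s) u x.

Definition quasilinear_op (u : 'rV[R]_n -> R) (x : 'rV[R]_n) : R :=
  principal_part u x + A1 x (row_mx (wgrad Omega u x) (const_mx (u x))).

(* A1 is of class C^m on {(x, y) : x in the closure of Omega, y in R^{n+1}}. *)
Definition lower_order_Cm (m : nat) : Prop :=
  Cm_closure m [set z : 'rV[R]_(n + (n + 1)) | Omega (lsubmx z)]
    (fun z : 'rV[R]_(n + (n + 1)) => A1 (lsubmx z) (rsubmx z)).

Definition principal_symbol (x xi : 'rV[R]_n) : R :=
  \sum_(s : midx n 2 | mdeg (mval s) == 2%N)
    a s x * \prod_i xi ord0 i ^+ mval s i.

Definition characteristic_hypersurface (S : set 'rV[R]_n) : Prop :=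
  [/\ S `<=` closure Omega, smooth_hypersurface S &
      forall x nu, S x -> unit_normal S x nu -> principal_symbol x nu = 0].

Definition superlevel (psi : 'rV[R]_n -> R) (t : R) : set 'rV[R]_n :=
  [set x | Omega x /\ t < psi x].

Definition level (psi : 'rV[R]_n -> R) (t : R) : set 'rV[R]_n :=
  [set x | closure Omega x /\ psi x = t].

Definition carleman_weight (psi : 'rV[R]_n -> R) (lam : R) (x : 'rV[R]_n) : R :=
  expR (lam * psi x).

Definition J_functional (m : nat) (psi : 'rV[R]_n -> R)
    (alpha eps lam beta : R) (F v : 'rV[R]_n -> R) : R :=
  expR (- 2 * lam * (alpha + eps)) *
    (\int[leb n]_(x in Omega)
       (quasilinear_op (v \+ F) x ^+ 2 * carleman_weight psi lam x ^+ 2)) +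
  beta * Hnorm Omega m v ^+ 2.

End quasilinear.

(* Main.v *)
(* Write phi for the Carleman weight and [P u = phi * A(u)]. Since H^k embeds
   into C^1 up to the boundary, the values and first weak derivatives of the
   functions of a ball of H^k are almost everywhere bounded by a common constant,
   so Taylor's formula for [A_1] in its second argument, on a compact set of
   jets, shows that [P] maps H^k to L^2 with a differential that is Lipschitz on
   bounded sets. Up to a constant factor, J is thus the sum of a squared L^2
   norm of [P (v + F)] and a squared Hilbert norm of [v]: its differential
   [h |-> 2 c <P (v + F), P' (v + F) h> + 2 beta [v, h]] is bounded and depends
   on [v] in a Lipschitz way. Riesz' theorem represents it in the space of
   functions with vanishing traces on Gamma, which is complete because L^2 is,
   because weak derivatives pass to L^2 limits, and because the embedding makes
   the traces continuous. *)
Require Import Defs.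
From HB Require Import structures.
From mathcomp Require Import all_boot all_order all_algebra.
From mathcomp Require Import all_classical all_reals all_analysis.
From mathcomp Require Import measurable_realfun ring lra.
Set Implicit Arguments.
Unset Strict Implicit.
Unset Printing Implicit Defensive.
Import Order.TTheory GRing.Theory Num.Theory.
Import numFieldNormedType.Exports.
Local Open Scope classical_set_scope.
Local Open Scope ring_scope.

(** Functions are never quotiented by almost everywhere equality: elements of H^k are
    representatives, and [wD] picks a weak derivative by choice. Norms are thus seminorms, and even
    the additivity of [wD] holds only almost everywhere, through uniqueness of weak derivatives;
    this is what the fundamental lemma of the calculus of variations, with its smooth bumps, is for.
    A second bridge is needed because the embedding yields a classical C^1 representative while the
    operator sees weak derivatives: integration by parts shows that the two agree. On an arbitrary
    open set it is done by extending a product by zero and integrating a partial derivative over all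
    of R^n. Completeness is only ever used for sequences with increments at most 2^-j, where limits
    come with explicit geometric rates. Since a Riesz representative is determined only up to a null
    vector of the norm, the Lipschitz estimate is proved for every choice of derivatives at the two
    points. *)

Lemma le0_half_expn (R : realType) (x K : R) : (forall j, x <= 2^-1 ^+ j * K) -> x <= 0.
Proof.
move=> xK; have cv : 2^-1 ^+ j * K @[j --> \oo] --> (0 : R).
  rewrite -[X in _ --> X](mul0r K); apply: cvgM; last exact: cvg_cst.
  by apply: cvg_expr; rewrite ger0_norm// invf_lt1// ltr1n.
by apply: (ler_cvg_to (cvg_cst x) cv); exact: nearW.
Qed.

(** * Cauchy-Schwarz inequality and Riesz representation for a semi-inner product *)

(* The form is only semi-definite and its axioms are only required on a
   subspace [H]: this covers functions identified almost everywhere. *)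
Section semi_inner_product.
Context (R : realType) (V : lmodType R) (H : set V) (B : V -> V -> R).
Hypothesis HD : forall u v, H u -> H v -> H (u + v).
Hypothesis HZ : forall c u, H u -> H (c *: u).
Hypothesis BC : forall u v, B u v = B v u.
Hypothesis BDl : forall u v w, H u -> H v -> H w -> B (u + v) w = B u w + B v w.
Hypothesis BZl : forall c u v, H u -> H v -> B (c *: u) v = c * B u v.
Hypothesis B_ge0 : forall u, H u -> 0 <= B u u.

Let N u : R := Num.sqrt (B u u).

Lemma semi_ip_sqr u : H u -> N u ^+ 2 = B u u.
Proof. by move=> Hu; rewrite sqr_sqrtr// B_ge0. Qed.

Lemma semi_ipDr u v w : H u -> H v -> H w -> B w (u + v) = B w u + B w v.
Proof. by move=> Hu Hv Hw; rewrite BC BDl// ![B _ w]BC. Qed.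

Lemma semi_ipZr c u v : H u -> H v -> B v (c *: u) = c * B v u.
Proof. by move=> Hu Hv; rewrite BC BZl// BC. Qed.

Lemma semi_ip_quad u v (t : R) : H u -> H v ->
  B (u + t *: v) (u + t *: v) = B u u + t * 2 * B u v + t ^+ 2 * B v v.
Proof.
move=> Hu Hv; have Htv := HZ t Hv; have Huv := HD Hu Htv.
rewrite BDl// !semi_ipDr// !BZl// !semi_ipZr// (BC v u); ring.
Qed.

Lemma semi_ip_CauchySchwarz u v : H u -> H v -> `|B u v| <= N u * N v.
Proof.
move=> Hu Hv; rewrite -(@ler_pXn2r _ 2)// ?nnegrE ?mulr_ge0 ?sqrtr_ge0//.
rewrite real_normK ?num_real// exprMn !semi_ip_sqr//.
set a := B u u; set b := B u v; set c := B v v.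
have quad t : 0 <= a + t * 2 * b + t ^+ 2 * c.
  by rewrite -semi_ip_quad// B_ge0//; apply: HD => //; exact: HZ.
have a0 : 0 <= a by exact: B_ge0.
have [c0|c0] := eqVneq c 0.
  (* When [v] is a null vector, [a + 2 t b] is affine in [t]; the chosen [t] would give it the value
     [- a - 2 < 0] unless [b = 0]. *)
  have := quad (- (a + 1) / b); rewrite c0 mulr0 addr0 => q.
  have [->|b0] := eqVneq b 0; first by rewrite expr0n/= mulr0.
  exfalso; move: q; have -> : a + - (a + 1) / b * 2 * b = - a - 2 by field.
  lra.
have cp : 0 < c by rewrite lt_neqAle eq_sym c0 B_ge0.
have := quad (- b / c).
rewrite (_ : a + _ + _ = a - b ^+ 2 / c); last by field.
by rewrite subr_ge0 ler_pdivrMr.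
Qed.

Lemma semi_ip_normD u v : H u -> H v -> N (u + v) <= N u + N v.
Proof.
move=> Hu Hv; have Huv := HD Hu Hv.
rewrite -(@ler_pXn2r _ 2)// ?nnegrE ?addr_ge0 ?sqrtr_ge0// semi_ip_sqr//.
rewrite BDl// !semi_ipDr// sqrrD !semi_ip_sqr// (BC v u).
have := ler_norm (B u v); have := semi_ip_CauchySchwarz Hu Hv; lra.
Qed.

Lemma semi_ip_normZ c u : H u -> N (c *: u) = `|c| * N u.
Proof.
move=> Hu; have Hcu := HZ c Hu.
by rewrite /N BZl// semi_ipZr// mulrA -expr2 sqrtrM ?sqr_ge0// sqrtr_sqr.
Qed.

(* A minimizing sequence of [u |-> B u u - 2 l u] is Cauchy by the
   parallelogram identity. *)
Lemma semi_ip_Riesz (l : V -> R) (C : R) (u0 : V) : H u0 ->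
  (forall u : nat -> V, (forall j, H (u j)) ->
    (forall j, N (u j.+1 - u j) <= 2^-1 ^+ j) ->
    exists2 w, H w & exists C', forall j, N (u j - w) <= C' * 2^-1 ^+ j) ->
  (forall u v, H u -> H v -> l (u + v) = l u + l v) ->
  (forall c u, H u -> l (c *: u) = c * l u) ->
  (forall u, H u -> `|l u| <= C * N u) ->
  exists2 w, H w & forall h, H h -> B w h = l h.
Proof.
move=> Hu0 Hcomplete lD lZ lC.
have HN u : H u -> H (- u) by move=> Hu; rewrite -scaleN1r; exact: HZ.
pose Q u := B u u - 2 * l u.
pose S := [set Q u | u in H].
have Qge u : H u -> - C ^+ 2 <= Q u.
  move=> Hu; rewrite /Q -semi_ip_sqr//.
  have := le_trans (ler_norm _) (lC u Hu); have := sqr_ge0 (N u - C); lra.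
have hS : has_inf S.
  split; first by exists (Q u0), u0.
  by exists (- C ^+ 2) => _ [u Hu <-]; exact: Qge.
(* By the parallelogram identity [B (x - y) (x - y)] is twice [Q x + Q y] minus four times [Q] at
   the midpoint. The increments below thus satisfy [N (u j.+1 - u j) ^+ 2 <= 2 * d j.+1 + 2 * d j <=
   4 * d j], which is [(2^-1 ^+ j) ^+ 2]. *)
pose d j : R := 4^-1 * (2^-1 ^+ j) ^+ 2.
have d0 j : 0 < d j by rewrite mulr_gt0// ?invr_gt0// !exprn_gt0// invr_gt0.
have ex j : exists u, H u /\ Q u < inf S + d j.
  by have [_ [u Hu <-] Quj] := inf_adherent (d0 j) hS; exists u.
have [u uP] := choice ex.
have Hu j : H (u j) by have [] := uP j.
have Qu j : Q (u j) < inf S + d j by have [] := uP j.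
have infQ v : H v -> inf S <= Q v.
  by move=> Hv; apply: ge_inf; [case: hS|exists v].
have QD v h t : H v -> H h -> Q (v + t *: h) =
    Q v + 2 * t * (B v h - l h) + t ^+ 2 * B h h.
  move=> Hv Hh; rewrite /Q semi_ip_quad// lD// ?lZ//; last exact: HZ.
  by ring.
have [w Hw [C' uw]] : exists2 w, H w & exists C', forall j, N (u j - w) <= C' * 2^-1 ^+ j.
  apply: Hcomplete => // j; set x := u j.+1; set y := u j.
  have Hx : H x by exact: Hu.
  have Hy : H y by exact: Hu.
  have Hxy : H (x - y) by apply: HD => //; exact: HN.
  rewrite -(@ler_pXn2r _ 2)// ?nnegrE ?sqrtr_ge0 ?exprn_ge0// semi_ip_sqr//.
  have E1 := QD y (x - y) (2^-1) Hy Hxy.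
  have E2 := QD y (x - y) 1 Hy Hxy.
  rewrite scale1r addrC subrK in E2.
  have := infQ _ (HD Hy (HZ (2^-1) Hxy)); rewrite E1.
  have := infQ _ Hy; have := Qu j; have := Qu j.+1; rewrite -/x -/y.
  have dS : d j.+1 = 4^-1 * d j by rewrite /d (exprS _ j); field.
  have <- : 4 * d j = (2^-1 ^+ j) ^+ 2 by rewrite /d; field.
  rewrite dS; have := d0 j; move: E2; lra.
exists w => // h Hh; apply/eqP; rewrite -subr_eq0 -normr_le0.
apply: (@le0_half_expn _ _ (B h h + 1 + C' * N h)) => j.
have s0 : 0 <= B h h by exact: B_ge0.
have Hwu : H (u j - w) by apply: HD => //; exact: HN.
set b := B (u j) h - l h.
have bj : `|b| <= 2^-1 ^+ j * (B h h + 1).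
  rewrite -(@ler_pXn2r _ 2)// ?nnegrE ?mulr_ge0 ?exprn_ge0 ?addr_ge0//.
  rewrite real_normK ?num_real//.
  (* Near-minimality of [u j] is tested in the direction [h]. The step is [- b / (s + 1)] with
     [s = B h h], rather than the optimal [- b / s], because [s] may vanish. *)
  have := infQ _ (HD (Hu j) (HZ (- b / (B h h + 1)) Hh)).
  rewrite QD// -/b; have := Qu j; set s := B h h => Q1 Q2.
  have s1 : 0 < s + 1 by rewrite ltr_wpDl.
  have : b ^+ 2 * (s + 2) / (s + 1) ^+ 2 <= d j.
    have -> : b ^+ 2 * (s + 2) / (s + 1) ^+ 2 =
      - (2 * (- b / (s + 1)) * b + (- b / (s + 1)) ^+ 2 * s).
      by field; rewrite gt_eqF.
    lra.
  rewrite ler_pdivrMr ?exprn_gt0// => bs.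
  have dj : d j <= (2^-1 ^+ j) ^+ 2.
    by rewrite /d ler_piMl ?sqr_ge0// invf_le1// ler1n.
  rewrite exprMn; apply: le_trans (ler_wpM2r (sqr_ge0 _) dj).
  apply: le_trans bs; rewrite ler_peMr ?sqr_ge0//; lra.
have wj : `|B (u j - w) h| <= C' * 2^-1 ^+ j * N h.
  apply: le_trans (semi_ip_CauchySchwarz Hwu Hh) _.
  by rewrite ler_wpM2r ?sqrtr_ge0.
have -> : B w h - l h = b - B (u j - w) h.
  rewrite /b BDl//; last exact: HN.
  by rewrite -[- w]scaleN1r BZl//; ring.
apply: le_trans (ler_normB _ _) _; rewrite mulrDr.
by apply: lerD => //; rewrite mulrCA mulrA.
Qed.

End semi_inner_product.

(** * Derivative of a regularized least-squares functional, in abstract form *)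

Section tikhonov_functional.
Context (R : realType) (V W : lmodType R).
Variables (K H : set V) (B : V -> V -> R) (G : set W) (I : W -> W -> R).
Hypothesis KD : forall u v, K u -> K v -> K (u + v).
Hypothesis KZ : forall c u, K u -> K (c *: u).
Hypothesis BC : forall u v, B u v = B v u.
Hypothesis BDl : forall u v w, K u -> K v -> K w -> B (u + v) w = B u w + B v w.
Hypothesis BZl : forall c u v, K u -> K v -> B (c *: u) v = c * B u v.
Hypothesis B_ge0 : forall u, K u -> 0 <= B u u.
Hypothesis GD : forall u v, G u -> G v -> G (u + v).
Hypothesis GZ : forall c u, G u -> G (c *: u).
Hypothesis IC : forall u v, I u v = I v u.
Hypothesis IDl : forall u v w, G u -> G v -> G w -> I (u + v) w = I u w + I v w.
Hypothesis IZl : forall c u v, G u -> G v -> I (c *: u) v = c * I u v.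
Hypothesis I_ge0 : forall u, G u -> 0 <= I u u.
Hypothesis HK : H `<=` K.
Hypothesis HD : forall u v, H u -> H v -> H (u + v).
Hypothesis HZ : forall c u, H u -> H (c *: u).

Local Notation N u := (Num.sqrt (B u u)).
Local Notation nW w := (Num.sqrt (I w w)).

Hypothesis H_complete : forall u : nat -> V, (forall j, H (u j)) ->
  (forall j, N (u j.+1 - u j) <= 2^-1 ^+ j) ->
  exists2 w, H w & exists C, forall j, N (u j - w) <= C * 2^-1 ^+ j.

Variables (P : V -> W) (L : V -> V -> W).
(** [L u h] plays the part of the derivative of [P] at [u] along [h]. The constant [k] depends only
    on the radius [M], which is what makes the final Lipschitz constant uniform on balls. *)
Hypothesis P_C11 : forall M, 0 <= M -> exists2 k, 0 <= k &
  forall u h, K u -> K h -> N u <= M -> N h <= M ->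
  [/\ G (P u) /\ nW (P u) <= k,
      nW (P (u + h) - P u) <= k * N h,
      nW (P (u + h) - P u - L u h) <= k * N h ^+ 2 &
      forall g, K g -> [/\ G (L u g), nW (L u g) <= k * N g &
        nW (L (u + h) g - L u g) <= k * N h * N g]].
(** Linearity of [L u] is asked only inside the form [I], since for the differential operator it
    holds almost everywhere and not pointwise. *)
Hypothesis LD : forall u h h' w, K u -> K h -> K h' -> G w ->
  I w (L u (h + h')) = I w (L u h) + I w (L u h').
Hypothesis LZ : forall u c h w, K u -> K h -> G w -> I w (L u (c *: h)) = c * I w (L u h).

Variables (F : V) (c b : R).
Hypothesis KF : K F.
Hypothesis c_ge0 : 0 <= c.
Hypothesis b_gt0 : 0 < b.

Definition tikhonov v : R := c * I (P (v + F)) (P (v + F)) + b * N v ^+ 2.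

Definition tikhonov_diff v h : R :=
  2 * c * I (P (v + F)) (L (v + F) h) + 2 * b * B v h.

(** The clauses mirror [frechet_derivative], so that the two notions are convertible once [B] is
    [Hprod] and [H] is [sobolev0]. *)
Definition tikhonov_frechet v d : Prop := H d /\ forall e, 0 < e -> exists2 t, 0 < t &
  forall h, H h -> N h <= t -> `|tikhonov (v + h) - tikhonov v - B d h| <= e * N h.

Let b_ge0 : 0 <= b := ltW b_gt0.

Let KB u v : K u -> K v -> K (u - v).
Proof. by move=> Ku Kv; rewrite -scaleN1r; apply: KD => //; exact: KZ. Qed.

Let GB u v : G u -> G v -> G (u - v).
Proof. by move=> Gu Gv; rewrite -scaleN1r; apply: GD => //; exact: GZ. Qed.

Let N0 u : 0 <= N u. Proof. exact: sqrtr_ge0. Qed.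
Let nW0 w : 0 <= nW w. Proof. exact: sqrtr_ge0. Qed.

Let Nsqr u : K u -> N u ^+ 2 = B u u. Proof. by move=> Ku; rewrite sqr_sqrtr// B_ge0. Qed.
Let nWsqr u : G u -> nW u ^+ 2 = I u u. Proof. by move=> Gu; rewrite sqr_sqrtr// I_ge0. Qed.

Let ND u v : K u -> K v -> N (u + v) <= N u + N v.
Proof. exact: (semi_ip_normD KD KZ BC BDl BZl B_ge0). Qed.

Let NZ t u : K u -> N (t *: u) = `|t| * N u.
Proof. exact: (semi_ip_normZ KZ BC BZl). Qed.

Let B_le u v : K u -> K v -> `|B u v| <= N u * N v.
Proof. exact: (semi_ip_CauchySchwarz KD KZ BC BDl BZl B_ge0). Qed.

Let I_le u v : G u -> G v -> `|I u v| <= nW u * nW v.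
Proof. exact: (semi_ip_CauchySchwarz GD GZ IC IDl IZl I_ge0). Qed.

Let IDr u v w : G u -> G v -> G w -> I w (u + v) = I w u + I w v.
Proof. exact: (semi_ipDr IC IDl). Qed.

Let BBl u v w : K u -> K v -> K w -> B (u - v) w = B u w - B v w.
Proof.
move=> Ku Kv Kw; rewrite -[- v]scaleN1r BDl//; last exact: KZ.
by rewrite BZl// mulN1r.
Qed.

Let IBl u v w : G u -> G v -> G w -> I (u - v) w = I u w - I v w.
Proof.
move=> Gu Gv Gw; rewrite -[- v]scaleN1r IDl//; last exact: GZ.
by rewrite IZl// mulN1r.
Qed.

Lemma P_in u : K u -> G (P u).
Proof.
move=> Ku; have [k _ kP] := P_C11 (N0 u).
by have [[]] := kP _ _ Ku Ku (lexx _) (lexx _).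
Qed.

(** Polarization leaves, besides [b * N h ^+ 2], the first-order remainder of [P] paired with
    [P (v + F)] and the squared increment of [P]; both are of order [N h ^+ 2]. The radius
    [N (v + F) + 1] covers every [h] with [N h <= 1]. *)
Lemma tikhonov_taylor v : K v -> exists2 Q, 0 <= Q &
  forall h, K h -> N h <= 1 ->
    `|tikhonov (v + h) - tikhonov v - tikhonov_diff v h| <= Q * N h ^+ 2.
Proof.
move=> Kv; have Ku := KD Kv KF.
have M0 : 0 <= N (v + F) + 1 by rewrite addr_ge0.
have [k k0 kP] := P_C11 M0.
(* In [3 * k ^+ 2], two parts come from the remainder paired with [p] and one from the squared
   increment. *)
exists (c * (3 * k ^+ 2) + b) => [|h Kh h1].
  by rewrite addr_ge0// mulr_ge0// mulr_ge0// sqr_ge0.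
have uM : N (v + F) <= N (v + F) + 1 by rewrite lerDl.
have hM : N h <= N (v + F) + 1 by apply: le_trans h1 _; rewrite lerDr.
have [[Gp pk] dk rk /(_ _ Kh)[Gl lk _]] := kP _ _ Ku Kh uM hM.
have Gp' := P_in (KD Ku Kh).
rewrite /tikhonov /tikhonov_diff (addrAC v h F).
set p := P (v + F) in Gp pk dk rk *; set p' := P (v + F + h) in dk rk Gp' *.
set l := L (v + F) h in Gl lk rk *.
have Gd := GB Gp' Gp; have Gr := GB Gd Gl.
have pE : I p' p' = I p p + 2 * I p (p' - p) + I (p' - p) (p' - p).
  rewrite -[in LHS](subrK p p') (addrC _ p) -[in LHS](scale1r (p' - p)).
  by rewrite (semi_ip_quad GD GZ IC IDl IZl)//; ring.
have dE : I p (p' - p) = I p (p' - p - l) + I p l by rewrite -IDr// subrK.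
have vE : N (v + h) ^+ 2 = N v ^+ 2 + 2 * B v h + N h ^+ 2.
  rewrite !Nsqr//; last exact: KD.
  rewrite -[in LHS](scale1r h).
  by rewrite (semi_ip_quad KD KZ BC BDl BZl)//; ring.
rewrite pE dE vE -(nWsqr Gd).
rewrite (_ : _ - _ - _ = c * (2 * I p (p' - p - l) + nW (p' - p) ^+ 2) + b * N h ^+ 2); last by ring.
have e1 : `|I p (p' - p - l)| <= k * (k * N h ^+ 2).
  by apply: le_trans (I_le Gp Gr) _; apply: ler_pM.
have e2 : nW (p' - p) ^+ 2 <= (k * N h) ^+ 2.
  by rewrite lerXn2r// nnegrE// mulr_ge0.
apply: le_trans (ler_normD _ _) _; rewrite [leRHS]mulrDl; apply: lerD; last first.
  by rewrite ger0_norm// mulr_ge0// sqr_ge0.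
rewrite normrM (ger0_norm c_ge0) -mulrA; apply: ler_wpM2l => //.
apply: le_trans (ler_normD _ _) _.
rewrite normrM (ger0_norm (sqr_ge0 _)) ger0_norm//.
by move: e1 e2; move: `|_| (_ ^+ 2 : R) (N h) => x y q; lra.
Qed.

Lemma tikhonov_diff_le v : K v -> exists C, forall h, K h -> `|tikhonov_diff v h| <= C * N h.
Proof.
move=> Kv; have Ku := KD Kv KF; have [k k0 kP] := P_C11 (N0 (v + F)).
have [[Gp pk] _ _ lP] := kP _ _ Ku Ku (lexx _) (lexx _).
exists (2 * c * k ^+ 2 + 2 * b * N v) => h Kh; have [Gl lk _] := lP _ Kh.
rewrite /tikhonov_diff; apply: le_trans (ler_normD _ _) _.
have c2 : 0 <= 2 * c by rewrite mulr_ge0.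
have b2 : 0 <= 2 * b by rewrite mulr_ge0.
rewrite [leRHS]mulrDl; apply: lerD.
  rewrite normrM (ger0_norm c2) -(mulrA (2 * c)); apply: ler_wpM2l => //.
  by apply: le_trans (I_le Gp Gl) _; rewrite expr2 -mulrA; apply: ler_pM.
by rewrite normrM (ger0_norm b2) -(mulrA (2 * b)); apply: ler_wpM2l => //; exact: B_le.
Qed.

Lemma tikhonov_diffD v h h' : K v -> K h -> K h' ->
  tikhonov_diff v (h + h') = tikhonov_diff v h + tikhonov_diff v h'.
Proof.
move=> Kv Kh Kh'; have Ku := KD Kv KF; have Gp := P_in Ku.
by rewrite /tikhonov_diff LD// (semi_ipDr BC BDl)//; ring.
Qed.

Lemma tikhonov_diffZ v t h : K v -> K h -> tikhonov_diff v (t *: h) = t * tikhonov_diff v h.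
Proof.
move=> Kv Kh; have Ku := KD Kv KF; have Gp := P_in Ku.
by rewrite /tikhonov_diff LZ// (semi_ipZr BC BZl)//; ring.
Qed.

Lemma tikhonov_frechet_exists v : H v -> exists d, tikhonov_frechet v d.
Proof.
move=> Hv; have Kv := HK Hv; have [C DC] := tikhonov_diff_le Kv.
have [d Hd dE] : exists2 d, H d & forall h, H h -> B d h = tikhonov_diff v h.
  apply: (@semi_ip_Riesz R V H B HD HZ BC _ _ _ _ C v) => //.
  - by move=> x y z /HK Kx /HK Ky /HK; exact: BDl.
  - by move=> t x y /HK Kx /HK; exact: BZl.
  - by move=> x /HK; exact: B_ge0.
  - by move=> x y /HK Kx /HK; exact: tikhonov_diffD.
  - by move=> t x /HK; exact: tikhonov_diffZ.
  - by move=> x /HK; exact: DC.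
exists d; split=> // e e0; have [Q Q0 QP] := tikhonov_taylor Kv.
have Q1 : 0 < Q + 1 by rewrite ltr_wpDl.
(* The bound 1 is the range of validity of the expansion; [Q + 1] replaces [Q], which may be
   zero. *)
exists (Num.min 1 (e / (Q + 1))); first by rewrite lt_min ltr01 divr_gt0.
move=> h Hh; rewrite le_min => /andP[h1 he]; rewrite dE//.
apply: le_trans (QP _ (HK Hh) h1) _; rewrite expr2 mulrA; apply: ler_wpM2r => //.
move: he; rewrite ler_pdivlMr//; have := N0 h; move: (N h) => q; nra.
Qed.

(* Comparing the two expansions of the functional along [t *: h], [t --> 0]. *)
Lemma tikhonov_frechetE v d h : H v -> tikhonov_frechet v d -> H h ->
  B d h = tikhonov_diff v h.
Proof.
move=> Hv [Hd dP] Hh; have Kv := HK Hv; have Kh := HK Hh.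
have [Q Q0 QP] := tikhonov_taylor Kv.
pose A := N h + Q * N h ^+ 2.
have A0 : 0 <= A by rewrite addr_ge0// mulr_ge0// sqr_ge0.
suff xA e : 0 < e -> `|B d h - tikhonov_diff v h| <= e * A.
  apply/eqP; rewrite -subr_eq0 -normr_le0; apply/ler_addgt0Pr => e e0; rewrite add0r.
  have A1 : 0 < A + 1 by rewrite ltr_wpDl.
  apply: le_trans (xA (e / (A + 1)) (divr_gt0 e0 A1)) _.
  by rewrite mulrAC ler_pdivrMr// ler_wpM2l ?ltW// ltrDl.
move=> e0; have [s s0 sP] := dP e e0.
have h1 : 0 < N h + 1 by rewrite ltr_wpDl.
(* [t <= e] absorbs the quadratic remainder, and the other two bounds bring [t *: h] within the
   reach of [sP] and [QP]. The denominator [N h + 1] is positive even for a null vector. *)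
pose t := Num.min e (Num.min (s / (N h + 1)) (1 / (N h + 1))).
have t0 : 0 < t by rewrite !lt_min e0 !divr_gt0.
have te : t <= e by rewrite /t ge_min lexx.
have le_t z : 0 < z -> t <= z / (N h + 1) -> t * N h <= z.
  move=> z0; rewrite ler_pdivlMr//; have := N0 h; move: (N h) => q; nra.
have ts : t * N h <= s by apply: le_t => //; rewrite /t !ge_min lexx !orbT.
have t1 : t * N h <= 1 by apply: le_t => //; rewrite /t !ge_min lexx !orbT.
have Nt : N (t *: h) = t * N h by rewrite NZ// gtr0_norm.
have := sP _ (HZ t Hh); have := QP _ (KZ t Kh).
rewrite Nt => /(_ t1) + /(_ ts).
rewrite (semi_ipZr BC BZl)//; last exact: HK.
rewrite tikhonov_diffZ//.
set z := tikhonov _ - _ => q1 q2.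
have {q1 q2} : t * `|B d h - tikhonov_diff v h| <= t * (e * A).
  rewrite -{1}(gtr0_norm t0) -normrM mulrBr.
  rewrite (_ : _ - _ = z - t * tikhonov_diff v h - (z - t * B d h)); last by ring.
  apply: le_trans (ler_normB _ _) _; apply: le_trans (lerD q1 q2) _.
  have : Q * (t * N h) ^+ 2 <= t * (e * (Q * N h ^+ 2)).
    rewrite (_ : Q * _ = t * (t * (Q * N h ^+ 2))); last by ring.
    apply: ler_wpM2l; first exact: ltW.
    by apply: ler_wpM2r => //; rewrite mulr_ge0// sqr_ge0.
  by rewrite /A; lra.
by rewrite ler_pM2l.
Qed.

(** The difference [w] of the derivatives is tested against itself: [N w ^+ 2] is the difference of
    the two differentials at [w], hence at most a constant times [N (v1 - v2) * N w]. *)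
Lemma tikhonov_frechet_lipschitz r : 0 <= r -> exists2 C, 0 < C &
  forall v1 v2 d1 d2, H v1 -> N v1 <= r -> H v2 -> N v2 <= r ->
    tikhonov_frechet v1 d1 -> tikhonov_frechet v2 d2 ->
    N (d1 - d2) <= C * N (v1 - v2).
Proof.
(* This radius bounds [v1 + F] and [v2 + F], of norm at most [N F + r], as well as their difference,
   of norm at most [2 * r]. *)
move=> r0; pose M := N F + 2 * r.
have M0 : 0 <= M by rewrite addr_ge0// mulr_ge0.
have [k k0 kP] := P_C11 M0.
exists (4 * c * k ^+ 2 + 2 * b).
  by rewrite ltr_wpDl ?mulr_gt0// !mulr_ge0// sqr_ge0.
move=> v1 v2 d1 d2 Hv1 v1r Hv2 v2r D1 D2.
have Kv1 := HK Hv1; have Kv2 := HK Hv2; have [Hd1 _] := D1; have [Hd2 _] := D2.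
pose w := d1 - d2.
have Hw : H w by rewrite /w -scaleN1r; apply: HD => //; exact: HZ.
have Kw := HK Hw; pose h := v2 - v1; have Kh : K h := KB Kv2 Kv1.
have Nh : N (v1 - v2) = N h.
  by rewrite -opprB -scaleN1r NZ// normrN normr1 mul1r.
have hM : N h <= M.
  have : N h <= N v1 + N v2.
    by rewrite -Nh -scaleN1r (le_trans (ND _ _))// ?NZ ?normrN ?normr1 ?mul1r//; exact: KZ.
  by rewrite /M; have := N0 F; lra.
have Ku1 := KD Kv1 KF; have Ku2 := KD Kv2 KF.
have u1M : N (v1 + F) <= M by have := ND Kv1 KF; rewrite /M; lra.
have u2M : N (v2 + F) <= M by have := ND Kv2 KF; rewrite /M; lra.
have [[Gp1 p1k] pdk _ /(_ _ Kw)[Gl1 _ ldk]] := kP _ _ Ku1 Kh u1M hM.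
have [[Gp2 _] _ _ /(_ _ Kw)[Gl2 l2k _]] := kP _ _ Ku2 Kh u2M hM.
have uE : v1 + F + h = v2 + F by rewrite /h addrAC subrKC.
rewrite uE in pdk ldk.
have key : N w ^+ 2 <= (4 * c * k ^+ 2 + 2 * b) * N h * N w.
  have wE : B w w = tikhonov_diff v1 w - tikhonov_diff v2 w.
    rewrite -(tikhonov_frechetE Hv1 D1 Hw) -(tikhonov_frechetE Hv2 D2 Hw).
    exact: (BBl (HK Hd1) (HK Hd2) Kw).
  rewrite Nsqr// {1}wE /tikhonov_diff.
  set p1 := P (v1 + F) in Gp1 p1k pdk *; set p2 := P (v2 + F) in Gp2 pdk *.
  set l1 := L (v1 + F) w in Gl1 ldk *; set l2 := L (v2 + F) w in Gl2 l2k ldk *.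
  (* In the increment of a product each term pairs one increment with one bounded factor, whence
     [2 * c * (k ^+ 2 + k ^+ 2)] in the constant. *)
  have e1 : I p2 l2 - I p1 l1 = I (p2 - p1) l2 + I p1 (l2 - l1).
    have Gdl := GB Gl2 Gl1.
    by rewrite IBl// (IC p1 (l2 - l1)) IBl// !(IC _ p1); ring.
  have e2 : B v2 w - B v1 w = B h w.
    by rewrite BBl.
  have f1 : `|I (p2 - p1) l2| <= k * N h * (k * N w).
    by apply: le_trans (I_le (GB Gp2 Gp1) Gl2) _; apply: ler_pM.
  have f2 : `|I p1 (l2 - l1)| <= k * (k * N h * N w).
    by apply: le_trans (I_le Gp1 (GB Gl2 Gl1)) _; apply: ler_pM.
  have f3 : `|B h w| <= N h * N w := B_le Kh Kw.
  rewrite (_ : _ + _ = - (2 * c * (I p2 l2 - I p1 l1)) - 2 * b * (B v2 w - B v1 w)); last by ring.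
  rewrite e1 e2.
  move: (I (p2 - p1) l2) (I p1 (l2 - l1)) (B h w) f1 f2 f3 => x y z.
  rewrite !ler_norml => /andP[f1 _] /andP[f2 _] /andP[f3 _].
  have g1 : - (c * (x + y)) <= c * (2 * (k * N h * (k * N w))).
    by rewrite -mulrN; apply: ler_wpM2l => //; lra.
  have g2 : - (b * z) <= b * (N h * N w) by rewrite -mulrN; apply: ler_wpM2l => //; lra.
  by lra.
rewrite Nh -/w; have [w0|w0] := ler0P (N w).
  by rewrite (le_trans w0)// mulr_ge0// addr_ge0// !mulr_ge0// sqr_ge0.
by rewrite -(ler_pM2r w0) -expr2.
Qed.

End tikhonov_functional.

(** * Square-integrable functions: inner product, norm and completeness *)

Section square_integrable.
Context d (T : measurableType d) (R : realType).
Variables (mu : {measure set T -> \bar R}) (D : set T) (mD : measurable D).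
Implicit Types f g h : T -> R.

Definition sqint f : Prop :=
  measurable_fun D f /\ mu.-integrable D (EFin \o (fun x => f x ^+ 2)).

Definition sqip f g : R := \int[mu]_(x in D) (f x * g x).

Definition sqnorm f : R := Num.sqrt (sqip f f).

Lemma le_ae_integrable f g : measurable_fun D f ->
  mu.-integrable D (EFin \o g) ->
  {ae mu, forall x, D x -> `|f x| <= g x} -> mu.-integrable D (EFin \o f).
Proof.
move=> mf /integrableP[mg gfin] fg; apply/integrableP; split.
  exact/measurable_EFinP.
apply: le_lt_trans gfin.
apply: ae_ge0_le_integral => //.
- by apply: measurableT_comp => //; exact/measurable_EFinP.
- by apply: measurableT_comp => //; exact/measurable_EFinP.
apply: filterS fg => x /[apply] /= fg.
by rewrite lee_fin (le_trans fg)// ler_norm.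
Qed.

Lemma sqintM f g : sqint f -> sqint g ->
  mu.-integrable D (EFin \o (fun x => f x * g x)).
Proof.
move=> [mf f2] [mg g2].
apply: (@le_ae_integrable _ (fun x => f x ^+ 2 + g x ^+ 2)).
- exact: measurable_funM.
- have := integrableD mD f2 g2.
  by apply: eq_integrable => // x _ /=; rewrite EFinD.
- apply: aeW => x /= _; rewrite normrM -(real_normK (num_real (f x))).
  rewrite -(real_normK (num_real (g x))); nra.
Qed.

Lemma sqint_le f g : measurable_fun D f -> sqint g ->
  {ae mu, forall x, D x -> `|f x| <= `|g x|} -> sqint f.
Proof.
move=> mf [mg g2] fg; split => //.
apply: (le_ae_integrable _ g2); first exact: measurable_funX.
apply: filterS fg => x /[apply] fg.
by rewrite normrX -(real_normK (num_real (g x))) lerXn2r// nnegrE.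
Qed.

Lemma sqintD f g : sqint f -> sqint g -> sqint (f \+ g).
Proof.
move=> sf sg; have := sqintM sf sg; case: sf => mf f2; case: sg => mg g2 fg.
split; first exact: measurable_funD.
have := integrableD mD (integrableD mD f2 g2) (integrableD mD fg fg).
by apply: eq_integrable => // x _ /=; rewrite -!EFinD; congr EFin; ring.
Qed.

Lemma sqintZ c f : sqint f -> sqint (fun x => c * f x).
Proof.
move=> [mf f2]; split; first exact: measurable_funM.
have := integrableZl mD (c ^+ 2) f2.
by apply: eq_integrable => // x _ /=; rewrite -!EFinM; congr EFin; ring.
Qed.

Lemma sqintB f g : sqint f -> sqint g -> sqint (f \- g).
Proof.
move=> sf /(sqintZ (-1)) sg; have := sqintD sf sg.
by rewrite (_ : f \+ _ = f \- g)//; apply/funext => x /=; rewrite mulN1r.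
Qed.

Lemma sqint0 : sqint (fun=> 0).
Proof.
split; first exact: measurable_cst.
apply: eq_integrable (integrable0 mu D) => // x _ /=.
by rewrite expr0n.
Qed.

Lemma sqint_sum I (r : seq I) (P : pred I) (f : I -> T -> R) :
  (forall i, P i -> sqint (f i)) -> sqint (fun x => \sum_(i <- r | P i) f i x).
Proof.
move=> sf; elim: r => [|i r IH].
  by under eq_fun do rewrite big_nil; exact: sqint0.
case: (boolP (P i)) => Pi; last by under eq_fun do rewrite big_cons (negPf Pi).
by under eq_fun do rewrite big_cons Pi; apply: sqintD IH; exact: sf.
Qed.

Lemma sqint_cst c : (mu D < +oo)%E -> sqint (fun=> c).
Proof.
move=> Dfin; split; first exact: measurable_cst.
apply: measurable_bounded_integrable => //.
by exists `|c ^+ 2|; split=> // M cM x _ /=; exact: ltW.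
Qed.

Lemma sqintMb (b : T -> R) f : measurable_fun D b -> sqint f ->
  (exists M, {ae mu, forall x, D x -> `|b x| <= M}) -> sqint (fun x => b x * f x).
Proof.
move=> mb sf [M bM]; apply: (@sqint_le _ (fun x => M * f x)).
- by apply: measurable_funM => //; case: sf.
- exact: sqintZ.
- apply: filterS bM => x /[apply] bM; rewrite !normrM ler_wpM2r//.
  by rewrite (le_trans bM)// ler_norm.
Qed.

Lemma sqint_integrable f : (mu D < +oo)%E -> sqint f ->
  mu.-integrable D (EFin \o f).
Proof.
move=> Dfin sf; have := sqintM sf (sqint_cst 1 Dfin).
by apply: eq_integrable => // x _ /=; rewrite mulr1.
Qed.

Lemma sqipC f g : sqip f g = sqip g f.
Proof. by apply: eq_Rintegral => x _; rewrite mulrC. Qed.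

Lemma sqipDl f g h : sqint f -> sqint g -> sqint h ->
  sqip (f \+ g) h = sqip f h + sqip g h.
Proof.
move=> sf sg sh; rewrite -RintegralD//; [|exact: sqintM|exact: sqintM].
by apply: eq_Rintegral => x _ /=; rewrite mulrDl.
Qed.

Lemma sqipZl c f h : sqint f -> sqint h ->
  sqip (fun x => c * f x) h = c * sqip f h.
Proof.
move=> sf sh; rewrite -RintegralZl//; last exact: sqintM.
by apply: eq_Rintegral => x _ /=; rewrite mulrA.
Qed.

Lemma ae_eq_Rintegral f g : measurable_fun D f -> measurable_fun D g ->
  {ae mu, forall x, D x -> f x = g x} ->
  \int[mu]_(x in D) f x = \int[mu]_(x in D) g x.
Proof.
move=> mf mg fg; rewrite /Rintegral; congr fine.
apply: ae_eq_integral => //; [exact/measurable_EFinP|exact/measurable_EFinP|].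
by apply: filterS fg => x /[apply] ->.
Qed.

Lemma eq_sqip f f' g g' : sqint f -> sqint f' -> sqint g -> sqint g' ->
  {ae mu, forall x, D x -> f x = f' x} -> {ae mu, forall x, D x -> g x = g' x} ->
  sqip f g = sqip f' g'.
Proof.
move=> [mf _] [mf' _] [mg _] [mg' _] ff' gg'; apply: ae_eq_Rintegral.
- exact: measurable_funM.
- exact: measurable_funM.
- by apply: filterS2 ff' gg' => x ff' gg' Dx; rewrite ff'// gg'.
Qed.

Lemma sqip_ge0 f : 0 <= sqip f f.
Proof. by apply: Rintegral_ge0 => x _; rewrite -expr2 sqr_ge0. Qed.

Lemma sqnorm_ge0 f : 0 <= sqnorm f. Proof. exact: sqrtr_ge0. Qed.

Lemma sqr_sqnorm f : sqnorm f ^+ 2 = sqip f f.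
Proof. by rewrite sqr_sqrtr// sqip_ge0. Qed.

Lemma sqip_le f g : sqint f -> sqint g -> `|sqip f g| <= sqnorm f * sqnorm g.
Proof.
exact: (semi_ip_CauchySchwarz sqintD sqintZ sqipC sqipDl sqipZl
  (fun f _ => sqip_ge0 f)).
Qed.

Lemma le_sqnorm f g : sqint f -> sqint g ->
  {ae mu, forall x, D x -> `|f x| <= `|g x|} -> sqnorm f <= sqnorm g.
Proof.
move=> sf sg fg; rewrite ler_wsqrtr// /sqip /Rintegral fine_le//.
- exact/integrable_fin_num/sqintM.
- exact/integrable_fin_num/sqintM.
apply: ae_ge0_le_integral => //.
- by move=> x _; rewrite lee_fin -expr2 sqr_ge0.
- by apply/measurable_EFinP/measurable_funM; case: sf.
- by move=> x _; rewrite lee_fin -expr2 sqr_ge0.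
- by apply/measurable_EFinP/measurable_funM; case: sg.
- apply: filterS fg => x /[apply] fg; rewrite lee_fin -!expr2.
  rewrite -(real_normK (num_real (g x))) -(real_normK (num_real (f x))).
  by rewrite lerXn2r// nnegrE.
Qed.

Lemma sqnormD f g : sqint f -> sqint g ->
  sqnorm (f \+ g) <= sqnorm f + sqnorm g.
Proof.
exact: (semi_ip_normD sqintD sqintZ sqipC sqipDl sqipZl
  (fun f _ => sqip_ge0 f)).
Qed.

Lemma sqnormZ c f : sqint f -> sqnorm (fun x => c * f x) = `|c| * sqnorm f.
Proof. exact: (semi_ip_normZ sqintZ sqipC sqipZl). Qed.

Lemma sqnorm_cst c : sqnorm (fun=> c) = `|c| * Num.sqrt (fine (mu D)).
Proof. by rewrite /sqnorm /sqip Rintegral_cst// -expr2 sqrtrM ?sqr_ge0// sqrtr_sqr. Qed.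

Lemma sqnorm_sum I (r : seq I) (P : pred I) (f : I -> T -> R) :
  (forall i, P i -> sqint (f i)) ->
  sqnorm (fun x => \sum_(i <- r | P i) f i x) <= \sum_(i <- r | P i) sqnorm (f i).
Proof.
move=> sf; elim: r => [|i r IH].
  under eq_fun do rewrite big_nil; rewrite big_nil /sqnorm /sqip.
  under eq_Rintegral do rewrite mulr0.
  by rewrite Rintegral_cst// mul0r sqrtr0.
rewrite big_cons; case: (boolP (P i)) => Pi; last first.
  by under eq_fun do rewrite big_cons (negPf Pi).
under eq_fun do rewrite big_cons Pi.
apply: le_trans (sqnormD _ _) _; [exact: sf|exact: sqint_sum|].
by rewrite lerD2l.
Qed.

(* Summability of the increments gives almost everywhere convergence, and
   Fatou's lemma upgrades it to convergence in norm. *)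
Lemma sqint_complete (f : nat -> T -> R) : (mu D < +oo)%E ->
  (forall j, sqint (f j)) ->
  (forall j, sqnorm (f j.+1 \- f j) <= 2^-1 ^+ j) ->
  exists2 g, sqint g & forall j, sqnorm (f j \- g) <= 2 * 2^-1 ^+ j.
Proof.
move=> Dfin sf fast.
have mf j : measurable_fun D (f j) by case: (sf j).
pose dd j := f j.+1 \- f j.
have sd j : sqint (dd j) by exact: sqintB.
have md j : measurable_fun D (dd j) by case: (sd j).
(* On a set of finite measure the L^1 norm is at most [C] times the L^2 norm, by Cauchy-Schwarz
   against 1. *)
pose C := sqnorm (fun=> 1).
have int_d j : (\int[mu]_(x in D) `|dd j x|%:E <= (C * 2^-1 ^+ j)%:E)%E.
  have sad : sqint (fun x => `|dd j x|).
    apply: (@sqint_le _ (dd j)) => //; first exact: measurableT_comp.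
    by apply: aeW => x _; rewrite normr_id.
  have := sqip_le (sqint_cst 1 Dfin) sad; rewrite /sqip.
  under eq_Rintegral do rewrite mul1r.
  have ind : mu.-integrable D (EFin \o (fun x => `|dd j x|)).
    exact: sqint_integrable.
  have /fineK <- := integrable_fin_num mD ind.
  rewrite lee_fin => h; apply: le_trans (ler_norm _) _; apply: le_trans h _.
  apply: ler_wpM2l; first exact: sqnorm_ge0.
  apply: le_trans (fast j); apply: le_sqnorm => //; first exact: sd.
  by apply: aeW => x _; rewrite normr_id.
pose G x := (\sum_(j <oo) `|dd j x|%:E)%E.
have G_int : (\int[mu]_(x in D) G x < +oo)%E.
  rewrite integral_nneseries//; last first.
    by move=> j; apply/measurable_EFinP; exact: measurableT_comp.
  apply: (@le_lt_trans _ _ (\sum_(j <oo) (C * 2^-1 ^+ j)%:E)%E).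
    by apply: lee_nneseries => *; [exact: integral_ge0|exact: int_d].
  have cv : series (geometric C (2^-1 : R)) @ \oo --> C * (1 - 2^-1)^-1.
    by apply: cvg_geometric_series; rewrite ger0_norm// invf_lt1// ltr1n.
  have -> : (\sum_(j <oo) (C * 2^-1 ^+ j)%:E = (C * (1 - 2^-1)^-1)%:E)%E.
    apply/cvg_lim => //; under eq_fun do rewrite sumEFin.
    by apply: cvg_EFin; [exact: nearW|exact: cv].
  exact: ltry.
have mG : measurable_fun D G.
  apply: ge0_emeasurable_sum => // j _.
  by apply/measurable_EFinP; exact: measurableT_comp.
have iG : mu.-integrable D G.
  apply/integrableP; split => //; apply: le_lt_trans G_int.
  rewrite le_eqVlt; apply/orP; left; apply/eqP; apply: eq_integral => x _.
  by rewrite gee0_abs// nneseries_ge0.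
have cvf : {ae mu, forall x, D x -> cvgn (f ^~ x)}.
  apply: filterS (integrable_ae mD iG) => x /[apply] Gx.
  have cvs : cvgn [normed series (dd ^~ x)].
    apply: nondecreasing_is_cvgn.
      by apply: (@nondecreasing_series _ (fun i => `|dd i x|) xpredT 0%N).
    exists (fine (G x)) => _ [m _ <-] /=.
    rewrite -lee_fin fineK// -sumEFin.
    by apply: nneseries_lim_ge.
  have := normed_cvg cvs.
  rewrite (_ : series _ = (fun m => f m x - f 0%N x)); last first.
    apply/funext => m; rewrite /series/=.
    by rewrite (telescope_sumr (fun i => f i x)).
  move=> /is_cvgD/(_ (is_cvg_cst (f 0%N x))).
  suff -> : (fun m => f m x - f 0%N x) + (fun=> f 0%N x) = f ^~ x by [].
  by apply/funext => m; rewrite -[RHS](subrK (f 0%N x)).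
(* The upper limit is defined at every point and measurable on [D], and it is the limit wherever the
   sequence converges. *)
pose g x := fine (limn_esup (fun j => (f j x)%:E)).
have mg : measurable_fun D g.
  apply: (measurableT_comp (fine_measurable measurableT)).
  by apply: measurable_fun_limn_esup => j; exact/measurable_EFinP.
have fg : {ae mu, forall x, D x -> f ^~ x @ \oo --> g x}.
  apply: filterS cvf => x /[apply] cvx.
  suff -> : g x = limn (f ^~ x) by [].
  rewrite /g; have fxE : (f j x)%:E @[j --> \oo] --> (limn (f ^~ x))%:E.
    by apply: cvg_EFin; [exact: nearW|exact: cvx].
  by rewrite (cvg_limn_einf_sup fxE).2.
have tail j m : sqnorm (f j \- f (j + m)%N) <= 2 * 2^-1 ^+ j.
  (* Subtracting [2 * 2^-1 ^+ (j + m)] strengthens the claim enough for an induction on [m]: one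
     more increment costs exactly [2^-1 ^+ (j + m)]. *)
  have: sqnorm (f j \- f (j + m)%N) <= 2 * 2^-1 ^+ j - 2 * 2^-1 ^+ (j + m).
    elim: m => [|m IH].
      rewrite addn0 subrr /sqnorm /sqip.
      under eq_Rintegral do rewrite /= subrr mulr0.
      by rewrite Rintegral_cst// mul0r sqrtr0.
    have -> : f j \- f (j + m.+1)%N =
        (f j \- f (j + m)%N) \+ (fun x => -1 * (dd (j + m)%N x)).
      by apply/funext => x /=; rewrite /dd/= addnS; ring.
    apply: le_trans (sqnormD _ _) _; [exact: sqintB|exact: sqintZ|].
    rewrite sqnormZ// normrN1 mul1r.
    have := fast (j + m)%N; rewrite -/(dd _) addnS exprS; lra.
  move/le_trans; apply; rewrite gerBl// mulr_ge0// exprn_ge0//.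
have fatouj j : (\int[mu]_(x in D) ((f j x - g x) ^+ 2)%:E <=
    ((2 * 2^-1 ^+ j) ^+ 2)%:E)%E.
  pose h m x := ((f j x - f (j + m)%N x) ^+ 2)%:E.
  have mh m : measurable_fun D (h m).
    by apply/measurable_EFinP/measurable_funX/measurable_funB.
  have h0 m x : D x -> (0 <= h m x)%E by rewrite lee_fin sqr_ge0.
  (* With [j] fixed and [m] going to infinity, the integrand tends almost everywhere to
     [(f j x - g x) ^+ 2], while its integrals stay under the tail bound. *)
  have := fatou mu mD mh h0.
  have -> : (\int[mu]_(x in D) limn_einf (h ^~ x) =
      \int[mu]_(x in D) ((f j x - g x) ^+ 2)%:E)%E.
    apply: ae_eq_integral => //.
    - rewrite /limn_einf; apply: measurableT_comp => //.
      apply: measurable_fun_limn_esup => m.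
      by apply: measurableT_comp => //; exact: mh.
    - by apply/measurable_EFinP/measurable_funX/measurable_funB.
    apply: filterS fg => x /[apply] fx.
    apply: (@cvg_limn_einf_sup _ (h ^~ x) _ _).1.
    apply: cvg_EFin; first exact: nearW.
    have fxj : f (j + m)%N x @[m --> \oo] --> g x.
      by have := fx; rewrite -(cvg_shiftn j); under eq_fun do rewrite addnC.
    by apply: cvgM; apply: cvgB => //; exact: cvg_cst.
  move/le_trans; apply; rewrite limn_einf_lim.
  apply: lime_le; first exact: is_cvg_einfs.
  apply: nearW => m; apply: (@le_trans _ _ (\int[mu]_(x in D) h m x)%E).
    by apply: ereal_inf_lbound; exists m => /=.
  rewrite /h; have hi := (sqintB (sf j) (sf (j + m)%N)).2.
  have /fineK <- := integrable_fin_num mD hi.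
  have := tail j m; rewrite lee_fin => tailjm.
  have : sqnorm (f j \- f (j + m)%N) ^+ 2 <= (2 * 2^-1 ^+ j) ^+ 2.
    by rewrite ler_pXn2r// ?nnegrE ?sqnorm_ge0// ?mulr_ge0 ?exprn_ge0.
  rewrite sqr_sqnorm /sqip; apply: le_trans; rewrite le_eqVlt; apply/orP; left.
  by apply/eqP; apply: eq_Rintegral => x _; rewrite expr2.
have sfg j : sqint (f j \- g).
  split; first exact: measurable_funB.
  apply/integrableP; split.
    by apply/measurable_EFinP/measurable_funX/measurable_funB.
  apply: le_lt_trans (ltry _); apply: le_trans (fatouj j).
  rewrite le_eqVlt; apply/orP; left; apply/eqP; apply: eq_integral => x _ /=.
  by rewrite ger0_norm// sqr_ge0.
exists g.
  have := sqintB (sf 0%N) (sfg 0%N).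
  by rewrite (_ : _ \- _ = g)//; apply/funext => x /=; ring.
move=> j; rewrite -(@ler_pXn2r _ 2)// ?nnegrE ?sqnorm_ge0// ?mulr_ge0 ?exprn_ge0//.
rewrite sqr_sqnorm -lee_fin.
rewrite /sqip /Rintegral fineK; last first.
  by apply: integrable_fin_num => //; exact: sqintM.
apply: le_trans (fatouj j); rewrite le_eqVlt; apply/orP; left; apply/eqP.
by apply: eq_integral => x _; rewrite expr2.
Qed.

End square_integrable.

(** * Boxes, measurability of open sets, and Lebesgue measure on R^n *)

Section boxes.
Context {R : realType}.

Definition obox n (a b : 'I_n -> R) : set 'rV[R]_n :=
  [set x | forall i, a i < x ord0 i < b i].

Definition cbox n (a b : 'I_n -> R) : set 'rV[R]_n :=
  [set x | forall i, a i <= x ord0 i <= b i].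

Lemma obox_sub_cbox n (a b : 'I_n -> R) : obox a b `<=` cbox a b.
Proof. by move=> x ab i; have /andP[ax xb] := ab i; rewrite !ltW. Qed.

Lemma compact_cbox n (a b : 'I_n -> R) : compact (cbox a b).
Proof.
rewrite (_ : cbox a b = [set v | forall i, `[a i, b i]%classic (v ord0 i)]).
  by apply: (@rV_compact R n (fun i => `[a i, b i]%classic)) => i; exact: segment_compact.
by apply/seteqP; split => x ab i; have := ab i; rewrite /= in_itv.
Qed.

Lemma measurable_obox n (a b : 'I_n -> R) : measurable (obox a b).
Proof.
rewrite (_ : obox a b =
    \bigcap_(i in [set: 'I_n]) [set x | `]a i, b i[%classic (x ord0 i)]).
  apply: fin_bigcap_measurable => // i _; rewrite -[X in measurable X]setTI.
  by apply: (measurable_coord i) => //; exact: measurable_itv.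
apply/seteqP; split => [x ab i _|x ab i]; first by rewrite /= in_itv/=.
by have := ab i Logic.I; rewrite /= in_itv.
Qed.

Lemma nbhs_box n (x : 'rV[R]_n) (A : set 'rV[R]_n) : nbhs x A ->
  exists a b : 'I_n -> rat,
    obox (fun i => ratr (a i)) (fun i => ratr (b i)) x /\
    cbox (fun i => ratr (a i)) (fun i => ratr (b i)) `<=` A.
Proof.
move=> [P xP PA].
have ab i : exists p : rat * rat, ratr p.1 < x ord0 i < ratr p.2 /\
    forall y, ratr p.1 <= y <= ratr p.2 -> P ord0 i y.
  have /nbhs_ballP[e /= e0 eP] := xP ord0 i.
  have /rat_in_itvoo[p] : x ord0 i - e < x ord0 i by rewrite gtrBl.
  have /rat_in_itvoo[q] : x ord0 i < x ord0 i + e by rewrite ltrDl.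
  rewrite !in_itv/= => /andP[xq qe] /andP[ep px].
  exists (p, q) => /=; rewrite px xq; split=> // y /andP[py yq].
  apply: eP; rewrite /ball/= ltr_norml; apply/andP; split; lra.
have [p pP] := choice ab.
exists (fun i => (p i).1), (fun i => (p i).2); split.
  by move=> i; have [] := pP i.
move=> y yp; apply: PA => i j; rewrite (ord1 i).
by have [_] := pP j; apply; exact: yp.
Qed.

(** Boxes with rational corners are enumerated through [unpickle], and those whose closed box leaves
    [U] are replaced by the empty set. The containment of the closed boxes is recorded because bumps
    will be supported in them. *)
Lemma open_bigcup_box n (U : set 'rV[R]_n) : open U ->
  exists2 B : nat -> set 'rV[R]_n, U = \bigcup_k B k &
    forall k, B k = set0 \/
      exists a b : 'I_n -> R, B k = obox a b /\ cbox a b `<=` U.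
Proof.
move=> oU.
pose lo (p : {ffun 'I_n -> rat * rat}) i : R := ratr (p i).1.
pose hi (p : {ffun 'I_n -> rat * rat}) i : R := ratr (p i).2.
pose B k := if unpickle k is Some p then
  if `[< cbox (lo p) (hi p) `<=` U >] then obox (lo p) (hi p) else set0
  else set0.
have BE k : B k = set0 \/
    exists a b : 'I_n -> R, B k = obox a b /\ cbox a b `<=` U.
  rewrite /B; case: unpickle => [p|]; last by left.
  by case: asboolP => abU; [right; exists (lo p), (hi p)|left].
exists B => //; apply/seteqP; split => [x Ux|x [k _ Bx]].
  have : nbhs x U by exact: open_nbhs_nbhs.
  move=> /nbhs_box[a [b [xab abU]]].
  pose p := [ffun i => (a i, b i)] : {ffun 'I_n -> rat * rat}.
  have loE : lo p = fun i => ratr (a i) by apply/funext => i; rewrite /lo ffunE.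
  have hiE : hi p = fun i => ratr (b i) by apply/funext => i; rewrite /hi ffunE.
  exists (pickle p) => //; rewrite /B pickleK loE hiE.
  by case: asboolP => // /(_ abU).
have [B0|[a [b [BkE abU]]]] := BE k; first by move: Bx; rewrite B0.
by apply: abU; apply: obox_sub_cbox; rewrite -BkE.
Qed.

(** The measurable structure of row vectors is generated by the coordinates and not by the open
    sets, hence the passage through a countable union of boxes. *)
Lemma measurable_open_row n (U : set 'rV[R]_n) : open U -> measurable U.
Proof.
move=> /open_bigcup_box[B -> Bk]; apply: bigcup_measurable => k _.
by have [->|[a [b [-> _]]]] := Bk k => //; exact: measurable_obox.
Qed.

Lemma measurable_compact_row n (K : set 'rV[R]_n) : compact K -> measurable K.
Proof.
move=> cK; rewrite -(setCK K); apply: measurableC; apply: measurable_open_row.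
apply: closed_openC; apply: compact_closed => //; exact: norm_hausdorff.
Qed.

Lemma measurable_fun_open_continuous n (U : set 'rV[R]_n) (f : 'rV[R]_n -> R) :
  open U -> (forall x, U x -> {for x, continuous f}) -> measurable_fun U f.
Proof.
move=> oU cf.
move=> mU; apply: (measurability _ (RGenOInfty.measurableE R)) => //.
move=> _ [_ [a ->] <-]; apply: measurable_open_row.
rewrite openE => x [Ux /= fx]; apply: filterI; first exact: open_nbhs_nbhs.
by apply: cf => //; apply: open_nbhs_nbhs; split; [exact: interval_open|].
Qed.

Lemma continuous_bounded_compact n (K : set 'rV[R]_n) (f : 'rV[R]_n -> R) :
  compact K -> {within K, continuous f} ->
  exists M, forall x, K x -> `|f x| <= M.
Proof.
move=> cK cf; have := continuous_compact cf cK.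
move=> /compact_bounded[M [_ MP]]; exists (M + 1) => x Kx.
by apply: (MP (M + 1)); [rewrite ltrDl|exists x].
Qed.

Lemma cons_row_obox n (a b : 'I_n.+1 -> R) :
  @cons_row R n @^-1` obox a b =
  `]a ord0, b ord0[%classic `*` obox (a \o lift ord0) (b \o lift ord0).
Proof.
apply/seteqP; split => [[t y] /= ab|[t y] /= [t_ab y_ab] i].
  split=> [|i] /=.
    have := ab (lshift n (ord0 : 'I_1)); rewrite cons_rowEl in_itv/=.
    by rewrite (_ : lshift n (ord0 : 'I_1) = ord0)//; exact: val_inj.
  have := ab (rshift 1 i); rewrite cons_rowEr.
  by rewrite (_ : rshift 1 i = lift ord0 i)//; exact: val_inj.
case: (@split_ordP 1 n i) => j ->.
  rewrite cons_rowEl; move: t_ab; rewrite in_itv (ord1 j)/=.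
  by rewrite (_ : lshift n (ord0 : 'I_1) = ord0)//; exact: val_inj.
rewrite cons_rowEr; have := y_ab j.
by rewrite /= (_ : rshift 1 j = lift ord0 j)//; exact: val_inj.
Qed.

Lemma lebSE n (A : set 'rV[R]_n.+1) :
  leb n.+1 A = (@lebesgue_measure R \x leb n)%E (@cons_row R n @^-1` A).
Proof. by []. Qed.

Lemma leb_obox n (a b : 'I_n -> R) : (forall i, a i < b i) ->
  leb n (obox a b) = (\prod_i (b i - a i))%:E.
Proof.
elim: n a b => [|n IH] a b ab.
  by rewrite big_ord0 /= diracE mem_set// => -[].
rewrite lebSE cons_row_obox product_measure1E//; last exact: measurable_obox.
rewrite IH; last by move=> i; exact: ab.
rewrite big_ord_recl EFinM; congr (_ * _)%E.
by have := lebesgue_measure_itv `]a ord0, b ord0[; rewrite /= lte_fin ab => ->.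
Qed.

Lemma norm_coord n (x : 'rV[R]_n) i : `|x ord0 i| <= `|x|.
Proof.
have /mapP[j _ jE] : `|x ord0 i| \in [seq `|x j.1 j.2| | j : 'I_1 * 'I_n].
  by apply/mapP; exists (ord0, i) => //=; rewrite mem_enum.
by rewrite jE [leRHS]/Num.norm /= mx_normrE; apply/bigmax_geP; right; exists j.
Qed.

Lemma bounded_sub_box n (D : set 'rV[R]_n) : bounded_set D ->
  exists2 M, 0 < M & D `<=` obox (fun=> - M) (fun=> M).
Proof.
move=> [M [_ DM]]; pose M' := `|M| + 1.
have M'0 : 0 < M' by rewrite ltr_pwDr.
exists (M' + 1); first by rewrite addr_gt0.
move=> x Dx i; have : `|x| <= M'.
  by apply: DM => //; rewrite (le_lt_trans (ler_norm M))// ltrDl.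
move=> /(le_trans (norm_coord x i)); rewrite ler_norml; lra.
Qed.

Lemma leb_bounded n (D : set 'rV[R]_n) : measurable D -> bounded_set D ->
  (leb n D < +oo)%E.
Proof.
move=> mD /bounded_sub_box[M M0 DM].
apply: (@le_lt_trans _ _ (leb n (obox (fun=> - M) (fun=> M)))).
  by apply: le_measure; rewrite ?inE//; exact: measurable_obox.
by rewrite leb_obox ?ltry// => i; lra.
Qed.

Lemma leb_compact n (K : set 'rV[R]_n) : compact K -> (leb n K < +oo)%E.
Proof.
by move=> cK; apply: leb_bounded;
  [exact: measurable_compact_row|exact: compact_bounded].
Qed.

(** A disagreement at one point of [U] would persist on an open box, whose measure is positive by
    [leb_obox]. *)
Lemma ae_continuous_eq n (U : set 'rV[R]_n) (f g : 'rV[R]_n -> R) : open U ->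
  (forall x, U x -> {for x, continuous f}) ->
  (forall x, U x -> {for x, continuous g}) ->
  {ae leb n, forall x, U x -> f x = g x} -> forall x, U x -> f x = g x.
Proof.
move=> oU cf cg [N [mN N0 fgN]] x Ux; apply/eqP; apply: contrapT => /negP fgx.
have nfg : \forall y \near x, U y /\ f y - g y != 0.
  near=> y; split; first by near: y; exact: open_nbhs_nbhs.
  near: y; have cfg : {for x, continuous (f \- g)}.
    by apply: continuousB; [exact: cf|exact: cg].
  apply: (cfg [set z | z != 0]); apply: open_nbhs_nbhs; split.
    exact: open_neq.
  by rewrite /= subr_eq0.
have [a [b [xab abU]]] := nbhs_box nfg.
have ab i : ratr (a i) < ratr (b i) :> R.
  by have /andP[/lt_trans] := xab i; apply.
have : (leb n (obox (fun i => ratr (a i)) (fun i => ratr (b i))) <= leb n N)%E.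
  apply: le_measure; rewrite ?inE//; first exact: measurable_obox.
  move=> y /obox_sub_cbox/abU[Uy fgy]; apply: fgN => /= /(_ Uy) fg.
  by move: fgy; rewrite fg subrr eqxx.
rewrite N0 leb_obox// lee_fin leNgt prodr_gt0// => i _.
by rewrite subr_gt0.
Unshelve. all: by end_near. Qed.

End boxes.

(** * Directional derivatives, and the integral over R^n of a compactly supported partial
    derivative *)

Section lines.
Context {R : realType}.

Lemma rV_cvg (T : Type) (F : set_system T) {FF : Filter F} n
    (f : T -> 'rV[R]_n) (l : 'rV[R]_n) :
  (forall i, f x ord0 i @[x --> F] --> l ord0 i) -> f @ F --> l.
Proof.
move=> fl A [P lP PA]; rewrite /nbhs/=.
have h i : \forall x \near F, P ord0 i (f x ord0 i) by exact/fl/lP.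
by apply: filterS (filter_forall FF h) => x hx; apply: PA => i j; rewrite (ord1 i).
Qed.

(** A directional derivative only sees the restriction to one line, which may as well lie in another
    normed space: this is how derivatives pass to functions of one variable and to slices of
    R^n.+1. *)
Lemma eq_derive_lines (V V' : normedModType R) (f : V -> R) (g : V' -> R) x v x' v' :
  (forall h : R, f (h *: v + x) = g (h *: v' + x')) ->
  (derivable f x v -> derivable g x' v') /\ 'D_v f x = 'D_v' g x'.
Proof.
move=> fg; suff E : (fun h : R => h^-1 *: ((f \o shift x) (h *: v) - f x)) =
    (fun h => h^-1 *: ((g \o shift x') (h *: v') - g x')).
  by rewrite /derivable /derive E.
apply/funext => h; rewrite /= fg; congr (_ *: (_ - _)).
by have := fg 0; rewrite !scale0r !add0r.
Qed.

Section line.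
Context {V : normedModType R}.
Implicit Types (f : V -> R) (x v : V).

Let lineE f x v (t h : R) :
  f (h *: v + (x + t *: v)) = (fun s : R => f (x + s *: v)) (h *: 1 + t).
Proof. by rewrite [h *: 1]mulr1 scalerDl addrCA. Qed.

Lemma is_derive_line f x v (t : R) : derivable f (x + t *: v) v ->
  is_derive t (1 : R) (fun s : R => f (x + s *: v)) ('D_v f (x + t *: v)).
Proof.
have [dd dE] := eq_derive_lines (lineE f x v t).
by move=> /dd dfv; split.
Qed.

End line.

Lemma derive_eq0_nbhs (V : normedModType R) (f : V -> R) (x v : V) :
  (\forall y \near x, f y = 0) -> 'D_v f x = 0.
Proof.
move=> f0; rewrite (@near_eq_derive _ _ _ f (cst 0))//.
by rewrite derive_cst.
Qed.

End lines.

Section integral_partial.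
Context {R : realType}.

Lemma cons_row0E n (t : R) (y : 'rV[R]_n) :
  cons_row (t, y) = cons_row (0, y) + t *: basis_vec (lshift n (ord0 : 'I_1)).
Proof.
apply/rowP => i; rewrite [RHS]mxE [X in _ = _ + X]mxE.
case: (@split_ordP 1 n i) => j ->.
  by rewrite !cons_rowEl/= mxE (ord1 j) !eqxx mulr1 add0r.
by rewrite !cons_rowEr/= mxE eq_rlshift andbF mulr0 addr0.
Qed.

Lemma cons_row_shift n (t h : R) (y : 'rV[R]_n) (j : 'I_n) :
  cons_row (t, h *: basis_vec j + y) =
  h *: basis_vec (rshift 1 j) + cons_row (t, y).
Proof.
apply/rowP => i; rewrite [RHS]mxE [X in _ = X + _]mxE.
case: (@split_ordP 1 n i) => k ->.
  by rewrite !cons_rowEl/= mxE eq_lrshift andbF mulr0 add0r.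
by rewrite !cons_rowEr/= !mxE eq_rshift.
Qed.

Lemma continuous_cons_row2 n (t : R) : continuous (fun y : 'rV[R]_n => cons_row (t, y)).
Proof.
move=> y; apply: (@rV_cvg R _ (nbhs y) (nbhs_filter y)) => i; case: (@split_ordP 1 n i) => j ->.
  by rewrite cons_rowEl; under eq_fun do rewrite cons_rowEl; exact: cvg_cst.
by rewrite cons_rowEr; under eq_fun do rewrite cons_rowEr; exact: coord_continuous.
Qed.

Lemma continuous_cons_row1 n (y : 'rV[R]_n) : continuous (fun t : R => cons_row (t, y)).
Proof.
move=> t; apply: rV_cvg => i; case: (@split_ordP 1 n i) => j ->.
  by rewrite cons_rowEl; under eq_fun do rewrite cons_rowEl; exact: cvg_id.
by rewrite cons_rowEr; under eq_fun do rewrite cons_rowEr; exact: cvg_cst.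
Qed.

Lemma closed_cbox n (a b : 'I_n -> R) : closed (cbox a b).
Proof. by apply: compact_closed; [exact: norm_hausdorff|exact: compact_cbox]. Qed.

Lemma derive_outside n (K : set 'rV[R]_n) (f : 'rV[R]_n -> R) v : closed K ->
  (forall x, ~ K x -> f x = 0) -> forall x, ~ K x -> 'D_v f x = 0.
Proof.
move=> cK f0 x Kx; apply: derive_eq0_nbhs.
have : nbhs x (~` K) by apply: open_nbhs_nbhs; split=> //; exact: closed_openC.
by apply: filterS => y /f0.
Qed.

Lemma compact_support_integrable n (K : set 'rV[R]_n) (f : 'rV[R]_n -> R) :
  compact K -> continuous f -> (forall x, ~ K x -> f x = 0) ->
  (leb n).-integrable setT (EFin \o f).
Proof.
move=> cK cf f0; have mK := measurable_compact_row cK.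
have mf : measurable_fun setT f.
  by apply: measurable_fun_open_continuous; [exact: openT|move=> x _; exact: cf].
have fK : (EFin \o f) \_ K = EFin \o f.
  apply/funext => x; rewrite patchE; case: ifPn => //.
  by rewrite notin_setE => /f0 /= ->.
rewrite -fK -integrable_mkcond//.
apply: measurable_bounded_integrable => //; first exact: leb_compact.
  exact: measurable_funTS.
have [M fM] := continuous_bounded_compact cK (continuous_subspaceT cf).
exists M; split; first exact: num_real.
by move=> N MN x Kx; apply: (le_trans (fM x Kx)); exact: ltW.
Qed.

Lemma integral_derive_compact (g dg : R -> R) (M : R) : 0 < M ->
  (forall t : R, is_derive t (1 : R) g (dg t)) -> continuous dg ->
  (forall t, M < `|t| -> g t = 0) ->
  (\int[lebesgue_measure]_t (dg t)%:E = 0)%E.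
Proof.
move=> M0 gdg cdg g0.
have dg0 t : M < `|t| -> dg t = 0.
  move=> Mt; have [_ <-] := gdg t; apply: derive_eq0_nbhs.
  have : \forall s \near t, M < `|s|.
    by have /cvgr_gt/(_ _ Mt) := @norm_continuous _ R t.
  by apply: filterS => s /g0.
(* [g] is known to vanish only where [M < |t|], so the endpoints are moved out to [M + 1]. *)
have -> : (fun t => (dg t)%:E) = (EFin \o dg) \_ `[- (M + 1), M + 1].
  apply/funext => t; rewrite patchE; case: ifPn => //.
  rewrite notin_setE/= in_itv/= => tM /=; rewrite dg0//.
  by rewrite ltNge; apply/negP => tM'; apply: tM; move: tM'; rewrite ler_norml; lra.
rewrite -integral_mkcond.
rewrite (@continuous_FTC2 _ dg g).
- have M1 : M < M + 1 by rewrite ltrDl.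
  by rewrite !g0 ?normrN ?gtr0_norm ?addr_gt0// subee.
- by lra.
- exact: continuous_subspaceT.
- split=> [t _| |].
  + by have [] := gdg t.
  + apply: cvg_at_right_filter; apply: differentiable_continuous.
    by apply/derivable1_diffP; have [] := gdg (- (M + 1)).
  + apply: cvg_at_left_filter; apply: differentiable_continuous.
    by apply/derivable1_diffP; have [] := gdg (M + 1).
- by move=> t _; rewrite derive1E; have [_ ->] := gdg t.
Qed.

(* Fubini reduces the coordinate [i] of R^n.+1 to the one-dimensional
   fundamental theorem of calculus when [i] is the first coordinate, and to
   the hyperplanes on which the first coordinate is constant otherwise. *)
Lemma integral_partial_eq0 n (i : 'I_n) (G : 'rV[R]_n -> R) (M : R) : 0 < M ->
  continuous G -> (forall x, derivable G x (basis_vec i)) ->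
  continuous (fun x => 'D_(basis_vec i) G x) ->
  (forall x, ~ cbox (fun=> - M) (fun=> M) x -> G x = 0) ->
  (\int[leb n]_x ('D_(basis_vec i) G x)%:E = 0)%E.
Proof.
move=> M0; elim: n i G => [[]//|n IH] i G cG dG cdG G0.
pose H x := 'D_(basis_vec i) G x.
have H0 := derive_outside (basis_vec i) (closed_cbox (b := _)) G0.
have iH : (leb n.+1).-integrable setT (EFin \o H).
  exact: (@compact_support_integrable _ (cbox (fun=> - M) (fun=> M)) H
    (@compact_cbox _ _ _ _) cdG H0).
have mH : measurable_fun setT H.
  by apply: measurable_fun_open_continuous; [exact: openT|move=> x _; exact: cdG].
have mHc : measurable_fun setT (H \o @cons_row R n).
  by apply: measurableT_comp => //; exact: measurable_cons_row.
have iHc : (@lebesgue_measure R \x leb n)%E.-integrable setT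
    (EFin \o (H \o @cons_row R n)).
  apply/integrableP; split; first exact/measurable_EFinP.
  have /integrableP[_] := iH; apply: le_lt_trans.
  have mabs : measurable_fun setT (fun x => `|(H x)%:E|%E).
    by apply: measurableT_comp => //; exact/measurable_EFinP.
  have := ge0_integral_pushforward (@measurable_cons_row R n)
    (@lebesgue_measure R \x leb n)%E measurableT mabs (fun _ _ => abse_ge0 _).
  rewrite preimage_setT => <-; rewrite le_eqVlt; apply/orP; left; apply/eqP.
  apply: eq_measure_integral; first exact: measurable_cons_row.
  by move=> ? A _ _; rewrite [RHS]lebSE.
(* [leb n.+1] is the image of the product measure under [cons_row]; after this change of variables
   Fubini applies. *)
transitivity (\int[(@lebesgue_measure R \x leb n)%E]_z
    ((EFin \o (H \o @cons_row R n)) z))%E.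
  have mHE : measurable_fun setT (EFin \o H) by exact/measurable_EFinP.
  have := @integral_pushforward _ _ _ _ R _ (@measurable_cons_row R n)
    (@lebesgue_measure R \x leb n)%E setT _ mHE.
  rewrite preimage_setT => /(_ iHc measurableT) <-.
  apply: eq_measure_integral; first exact: measurable_cons_row.
  by move=> ? A _ _; rewrite [LHS]lebSE.
case: (@split_ordP 1 n i) => j iE.
  rewrite -integral21_prod_meas1//; rewrite integral0_eq// => y _.
  rewrite /fubini_G/=.
  apply: (@integral_derive_compact (fun t => G (cons_row (t, y)))
     (fun t => H (cons_row (t, y))) M M0).
  - move=> t; rewrite /H iE (ord1 j).
    rewrite (_ : (fun t => G _) = (fun t => G (cons_row (0, y) + t *:
        basis_vec (lshift n (ord0 : 'I_1) : 'I_n.+1)))); last first.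
      by apply/funext => s; rewrite -cons_row0E.
    rewrite (cons_row0E t y); apply: is_derive_line.
    by have := dG (cons_row (0, y) + t *: basis_vec (lshift n (ord0 : 'I_1) : 'I_n.+1));
      rewrite iE (ord1 j).
  - move=> t; apply: continuous_comp; first exact: continuous_cons_row1.
    exact: cdG.
  - move=> t Mt; apply: G0 => /(_ (lshift n (ord0 : 'I_1))).
    by rewrite cons_rowEl/=; apply/negP; move: Mt; rewrite -ler_norml -ltNge.
rewrite -integral12_prod_meas1//; rewrite integral0_eq// => t _.
rewrite /fubini_F/=.
(* Moving along [basis_vec j] in a slice is moving along [basis_vec i] in the whole space, so the
   two partial derivatives agree and the induction hypothesis applies to the slice. *)
have shiftE h y : (fun y => G (cons_row (t, y))) (h *: basis_vec j + y) =
    G (h *: basis_vec i + cons_row (t, y)).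
  by rewrite cons_row_shift iE.
have dE y := @eq_derive_lines R _ _ (fun y => G (cons_row (t, y))) G y
  (basis_vec j) (cons_row (t, y)) (basis_vec i) (shiftE ^~ y).
have -> : (fun y => (H (cons_row (t, y)))%:E) =
   (fun y => ('D_(basis_vec j) (fun y => G (cons_row (t, y))) y)%:E).
  by apply/funext => y; rewrite (dE y).2.
apply: IH.
- by move=> y; apply: continuous_comp; [exact: continuous_cons_row2|exact: cG].
- move=> y; apply: (@eq_derive_lines R _ _ G _ _ _ _ _ (fun h => esym (shiftE h y))).1; exact: dG.
- rewrite (_ : (fun y => _) = (fun y => H (cons_row (t, y)))); last first.
    by apply/funext => y; rewrite (dE y).2.
  by move=> y; apply: continuous_comp; [exact: continuous_cons_row2|exact: cdG].
- move=> y yM; apply: G0 => ab; apply: yM => k.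
  by have := ab (rshift 1 k); rewrite cons_rowEr.
Qed.

End integral_partial.

(** * Smooth bump functions supported in boxes *)

Section flat_function.
Context {R : realType}.
Implicit Types (x t : R) (j : nat).

(* [flat 0] is the standard smooth function [exp (- 1 / x)], flat at the
   origin; the whole family is stable under differentiation up to linear
   combinations. *)
Definition flat j x : R := if 0 < x then x^-1 ^+ j * expR (- x^-1) else 0.

(** For positive [k], raise [t / k <= exp (t / k)] to the power [k]. *)
Lemma expr_le_expR k t : 0 <= t -> t ^+ k <= k%:R ^+ k * expR t.
Proof.
move=> t0; case: k => [|k]; first by rewrite !expr0 mul1r -expR0 ler_expR.
have k0 : 0 < k.+1%:R :> R by [].
have -> : t = k.+1%:R * (t / k.+1%:R) by field; rewrite gt_eqF.
rewrite expRM_natl exprMn ler_wpM2l ?exprn_ge0//.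
rewrite lerXn2r ?nnegrE ?expR_ge0 ?divr_ge0//.
by apply: le_trans (expR_ge1Dx _); rewrite lerDr.
Qed.

(** This is [expr_le_expR] at [1 / x] with two spare powers; the factor [x ^+ 2] is what forces a
    zero derivative at the origin. *)
Lemma flat_le j x : `|flat j x| <= (j + 2)%:R ^+ (j + 2) * x ^+ 2.
Proof.
rewrite /flat; case: ifPn => x0; last first.
  by rewrite normr0 mulr_ge0 ?sqr_ge0 ?exprn_ge0.
rewrite ger0_norm ?mulr_ge0 ?exprn_ge0 ?invr_ge0 ?expR_ge0 ?(ltW x0)//.
have xV : 0 <= x^-1 by rewrite invr_ge0 ltW.
rewrite expRN ler_pdivrMr ?expR_gt0//.
have := expr_le_expR (j + 2) xV; rewrite exprD => h.
have -> : x^-1 ^+ j = x^-1 ^+ j * x^-1 ^+ 2 * x ^+ 2 by field; rewrite gt_eqF.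
by rewrite [leRHS]mulrAC ler_wpM2r ?sqr_ge0.
Qed.

Lemma flat0_le1 x : `|flat 0 x| <= 1.
Proof.
rewrite /flat; case: ifPn => x0; last by rewrite normr0.
rewrite expr0 mul1r ger0_norm ?expR_ge0// -expR0 ler_expR.
by rewrite oppr_le0 invr_ge0 ltW.
Qed.

(** For positive [x] this is the product rule applied to a power of [1 / x] times [exp (- 1 / x)];
    at the origin the difference quotient tends to zero by [flat_le]. *)
Lemma is_derive_flat j x :
  is_derive x 1 (flat j) (- j%:R * flat j.+1 x + flat j.+2 x).
Proof.
have [x0|x0|->] := ltgtP x 0.
- rewrite [X in is_derive _ _ _ X](_ : _ = 0); last first.
    by rewrite /flat ltNge (ltW x0)/= mulr0 addr0.
  have fE : \near x, cst 0 x = flat j x.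
    have : \forall y \near x, y < 0 by exact: lt_nbhsl.
    by apply: filterS => y y0; rewrite /flat ltNge (ltW y0).
  exact: near_eq_is_derive fE (is_derive_cst _ _ _).
- pose g := (fun y : R => y^-1) ^+ j * (expR \o (- (fun y : R => y^-1))).
  have xn0 : x != 0 by rewrite gt_eqF.
  have fE : \near x, g x = flat j x.
    have : \forall y \near x, 0 < y by exact: lt_nbhsr.
    by apply: filterS => y y0; rewrite /flat y0 /g !fctE.
  apply: near_eq_is_derive fE _.
  have dV : is_derive x 1 (fun y : R => y^-1) (- x ^- 2 *: 1).
    exact: (@is_deriveV _ id x 1 1 xn0 (is_derive_id _ _)).
  have dE := is_derive1_comp (is_derive_expR ((- (fun y : R => y^-1)) x)) (is_deriveN dV).
  apply: is_derive_eq (is_deriveM (is_deriveX j dV) dE) _.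
  rewrite /flat x0 !fctE /GRing.scale/= !mulr1.
  case: j {g} => [|j]; first by rewrite !expr0; field.
  rewrite succnK !exprVn !exprS; field.
  by rewrite xn0 expf_neq0.
- rewrite [X in is_derive _ _ _ X](_ : _ = 0); last first.
    by rewrite /flat ltxx mulr0 addr0.
  have fl0 : flat j 0 = 0 by rewrite /flat ltxx.
  pose C : R := (j + 2)%:R ^+ (j + 2).
  have C0 : 0 < C + 1 by rewrite ltr_wpDl ?exprn_ge0.
  suff cv : h^-1 *: ((flat j \o shift 0) (h *: 1) - flat j 0) @[h --> 0^'] --> (0 : R).
    by apply: DeriveDef; [exact: cvgP cv|exact: cvg_lim cv].
  apply/cvgr0Pnorm_lt => e e0; near=> h.
  have h0 : h != 0 by near: h; exact: nbhs_dnbhs_neq.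
  rewrite /= fl0 subr0 addr0 [h *: 1]mulr1 normrZ normfV.
  rewrite ltr_pdivrMl ?normr_gt0//; apply: le_lt_trans (flat_le j h) _.
  rewrite -/C -(real_normK (num_real h)) expr2 mulrA mulrC ltr_pM2l ?normr_gt0//.
  apply: (@le_lt_trans _ _ ((C + 1) * `|h|)).
    by rewrite ler_wpM2r// lerDl.
  rewrite -ltr_pdivlMl//; near: h; apply: dnbhs0_lt.
  by rewrite mulr_gt0// invr_gt0.
Unshelve. all: by end_near. Qed.

End flat_function.

Section bumps.
Context {R : realType}.

Lemma is_derive_lines (V V' : normedModType R) (f : V -> R) (g : V' -> R) x v x' v' df :
  (forall h : R, f (h *: v + x) = g (h *: v' + x')) ->
  is_derive x v f df -> is_derive x' v' g df.
Proof.
by move=> fg [dfx <-]; have [dg ->] := eq_derive_lines fg; split => //; exact: dg.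
Qed.

(** A syntactic class stable under partial derivatives: continuity of its members then yields every
    order of differentiability, by induction on the list of directions. *)
Inductive smooth_gen n : ('rV[R]_n -> R) -> Prop :=
| SmoothCst (c : R) : smooth_gen (fun=> c)
| SmoothFlat j (k : 'I_n) (c d : R) : smooth_gen (fun x => flat j (c * x ord0 k + d))
| SmoothD f g : smooth_gen f -> smooth_gen g -> smooth_gen (fun x => f x + g x)
| SmoothM f g : smooth_gen f -> smooth_gen g -> smooth_gen (fun x => f x * g x).

Lemma continuous_flat j : continuous (@flat R j).
Proof.
move=> x; apply: differentiable_continuous; apply/derivable1_diffP.
by have [] := is_derive_flat j x.
Qed.

Lemma smooth_gen_continuous n (f : 'rV[R]_n -> R) : smooth_gen f -> continuous f.
Proof.
elim=> [c|j k c d|g h _ cg _ ch|g h _ cg _ ch] x.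
- exact: cst_continuous.
- apply: (@continuous_comp _ _ _ (fun x : 'rV[R]_n => c * x ord0 k + d) (flat j)); last first.
    exact: continuous_flat.
  apply: continuousD; last exact: cst_continuous.
  by apply: continuousM; [exact: cst_continuous|exact: coord_continuous].
- by apply: continuousD; [exact: cg|exact: ch].
- by apply: continuousM; [exact: cg|exact: ch].
Qed.

Lemma smooth_gen_derive n (f : 'rV[R]_n -> R) i : smooth_gen f ->
  exists2 g, smooth_gen g & forall x, is_derive x (basis_vec i) f (g x).
Proof.
elim=> [c|j k c d|g h sg [g' sg' gg'] sh [h' sh' hh']|
  g h sg [g' sg' gg'] sh [h' sh' hh']].
- by exists (fun=> 0) => [|x]; [exact: SmoothCst|exact: is_derive_cst].
- have [<-{i}|ki] := eqVneq k i; last first.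
    exists (fun=> 0) => [|x]; first exact: SmoothCst.
    have hE (h : R) : cst (flat j (c * x ord0 k + d)) (h *: (1 : R) + 0) =
        flat j (c * (h *: basis_vec i + x) ord0 k + d).
      by rewrite !mxE eqxx/= (negPf ki) mulr0 add0r.
    exact: is_derive_lines hE (is_derive_cst _ _ _).
  pose dg (x : 'rV[R]_n) := c * (- j%:R * flat j.+1 (c * x ord0 k + d) + flat j.+2 (c * x ord0 k + d)).
  exists dg => [|x].
    apply: SmoothM; first exact: SmoothCst.
    apply: SmoothD; last exact: SmoothFlat.
    by apply: SmoothM; [exact: SmoothCst|exact: SmoothFlat].
  have dA : is_derive (x ord0 k) 1 (fun t : R => c * t + d) c.
    apply: is_derive_eq (is_deriveD (is_deriveZ c (is_derive_id (x ord0 k) (1 : R)))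
      (is_derive_cst d _ _)) _.
    by rewrite addr0 [c *: 1]mulr1.
  have := @is_derive1_comp _ (flat j) (fun t : R => c * t + d) _ _ _
    (is_derive_flat j (c * x ord0 k + d)) dA.
  rewrite mulrC; apply: is_derive_lines => s.
  by rewrite /= !mxE !eqxx.
- exists (fun x => g' x + h' x) => [|x]; first exact: SmoothD.
  exact: is_deriveD.
- exists (fun x => g x * h' x + h x * g' x) => [|x].
    by apply: SmoothD; exact: SmoothM.
  exact: is_deriveM.
Qed.

Lemma smooth_gen_Cm n (f : 'rV[R]_n -> R) m : smooth_gen f -> Cm m setT f.
Proof.
move=> sf l _.
have sl : smooth_gen (partials l f).
  elim: l => [//|i l /= sl]; have [g sg dg] := smooth_gen_derive i sl.
  suff -> : (fun x => 'D_(basis_vec i) (partials l f) x) = g by [].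
  by apply/funext => x; have [_] := dg x.
split=> [x _|_ i x _]; first exact: smooth_gen_continuous.
by have [g _ dg] := smooth_gen_derive i sl; have [] := dg x.
Qed.

(** Inside the box the factors are [exp (- 1 / ((k + 1) * (x_i - a_i)))] and
    [exp (- 1 / ((k + 1) * (b_i - x_i)))]; as [k] grows the product tends to the indicator of the
    open box. The affine arguments have the shape that [SmoothFlat] expects. *)
Definition bump n (a b : 'I_n -> R) (k : nat) (x : 'rV[R]_n) : R :=
  \prod_i (flat 0 (k.+1%:R * x ord0 i + - k.+1%:R * a i) *
           flat 0 (- k.+1%:R * x ord0 i + k.+1%:R * b i)).

Lemma smooth_gen_bump n (a b : 'I_n -> R) k : smooth_gen (bump a b k).
Proof.
rewrite /bump; elim: (index_enum _) => [|i r IH].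
  by under eq_fun do rewrite big_nil; exact: SmoothCst.
under eq_fun do rewrite big_cons.
by apply: SmoothM => //; apply: SmoothM; exact: SmoothFlat.
Qed.

Lemma bump_eq0 n (a b : 'I_n -> R) k x : ~ obox a b x -> bump a b k x = 0.
Proof.
move=> /existsNP[i /negP xi]; rewrite /bump (bigD1 i)//=.
suff -> : flat 0 (k.+1%:R * x ord0 i + - k.+1%:R * a i) *
  flat 0 (- k.+1%:R * x ord0 i + k.+1%:R * b i) = 0 by rewrite mul0r.
have k0 : 0 < k.+1%:R :> R by [].
move: xi; rewrite negb_and -!leNgt => /orP[h|h].
  by rewrite {1}/flat ltNge (_ : _ <= 0) ?mul0r//; nra.
by rewrite {2}/flat ltNge (_ : _ <= 0) ?mulr0//; nra.
Qed.

Lemma bump_le1 n (a b : 'I_n -> R) k x : `|bump a b k x| <= 1.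
Proof.
rewrite /bump normr_prod; apply: prodr_ile1 => i _.
by rewrite normr_ge0/= normrM mulr_ile1// flat0_le1.
Qed.

Lemma flat0_cvg1 (t : R) : 0 < t -> flat 0 (k.+1%:R * t) @[k --> \oo] --> (1 : R).
Proof.
move=> t0; have -> : (fun k => flat 0 (k.+1%:R * t)) = (fun k => expR (- (harmonic k * t^-1))).
  apply/funext => k; rewrite /flat mulr_gt0// expr0 mul1r invfM.
  by rewrite /harmonic/=.
rewrite -expR0; apply: (continuous_cvg _ (@continuous_expR R _)).
rewrite -oppr0 -(mul0r t^-1); apply: cvgN; apply: cvgM; last exact: cvg_cst.
exact: cvg_harmonic.
Qed.

Lemma bump_cvg n (a b : 'I_n -> R) x :
  bump a b k x @[k --> \oo] --> (\1_(obox a b) x : R).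
Proof.
rewrite indicE; have [xab|xab] := pselect (obox a b x); last first.
  rewrite memNset//; under eq_fun do rewrite bump_eq0//.
  exact: cvg_cst.
rewrite mem_set// /bump -[X in _ --> X](_ : \prod_(i < n) (1 * 1 : R) = _); last first.
  by rewrite mulr1 big1.
apply: cvg_big; first exact: mul_continuous.
move=> i _; have /andP[ai bi] := xab i; apply: cvgM.
  have := flat0_cvg1 (_ : 0 < x ord0 i - a i); rewrite subr_gt0 => /(_ ai).
  by under eq_fun do rewrite mulrBr -mulNr.
have := flat0_cvg1 (_ : 0 < b i - x ord0 i); rewrite subr_gt0 => /(_ bi).
by under eq_fun do rewrite mulrBr -mulNr addrC.
Qed.

Lemma test_function_bump n (Omega : set 'rV[R]_n) (a b : 'I_n -> R) k :
  cbox a b `<=` Omega -> test_function Omega (bump a b k).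
Proof.
move=> abO; split; first by move=> m; exact/smooth_gen_Cm/smooth_gen_bump.
exists (cbox a b); split=> //; first exact: compact_cbox.
by move=> x xab; apply: bump_eq0 => /obox_sub_cbox.
Qed.

End bumps.

(** * Fundamental lemma of the calculus of variations *)

Section fundamental_lemma.
Context {R : realType}.
Local Notation ms := (measure_row_display default_measure_display).

Definition oboxes n : set (set 'rV[R]_n) :=
  [set A | exists a b : 'I_n -> R, A = obox a b].

Lemma oboxI n (a b c d : 'I_n -> R) : obox a b `&` obox c d =
  obox (fun i => Num.max (a i) (c i)) (fun i => Num.min (b i) (d i)).
Proof.
apply/seteqP; split => [x [ab cd] i|x abcd].
  by rewrite gt_max lt_min; have /andP[-> ->] := ab i; have /andP[-> ->] := cd i.
split=> i; have := abcd i; rewrite gt_max lt_min => /andP[/andP[h1 h2] /andP[h3 h4]];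
  exact/andP.
Qed.

(** Boxes are stable under intersection, so generating the sigma-algebra makes them fit for a
    pi-lambda argument. For the inclusion that is not immediate, a half-space is exhausted by
    growing boxes. *)
Lemma measurable_oboxesE n : @measurable ms 'rV[R]_n = <<s @oboxes n >>.
Proof.
apply/seteqP; split; last first.
  apply: smallest_sub; first exact: sigma_algebra_measurable.
  by move=> _ [a [b ->]]; exact: measurable_obox.
pose T := g_sigma_algebraType (@oboxes n).
have : @measurable_fun _ _ T 'rV[R]_n setT (fun x : T => x : 'rV[R]_n).
  apply: measurable_fun_rowP => i.
  move=> mU; apply: (measurability _ (RGenOInfty.measurableE R)) => //.
  move=> _ [_ [p ->] <-].
  rewrite setTI (_ : _ @^-1` _ = \bigcup_k obox
     (fun j => if j == i then p else - k%:R) (fun=> k%:R)); last first.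
    apply/seteqP; split => [x /= px|x [k _ /(_ i)]]; last first.
      by rewrite eqxx => /andP[px _]; rewrite /= in_itv/= px.
    have [k xk] : exists k : nat, `|x : 'rV[R]_n| < k%:R.
      by exists (Num.Def.archi_bound `|x : 'rV[R]_n|); rewrite archi_boundP.
    exists k => //= j; have := le_lt_trans (norm_coord x j) xk.
    rewrite ltr_norml => /andP[h1 ->]; rewrite andbT; case: eqP => // ->.
    by move: px; rewrite in_itv/= andbT.
  apply: bigcupT_measurable => k; apply: sub_sigma_algebra.
  by exists (fun j => if j == i then p else - k%:R), (fun=> k%:R).
by move=> mid A mA; have := mid measurableT A mA; rewrite setTI.
Qed.

(** Dominated convergence: the bumps tend to the indicator of the open box and are at most 1 in
    absolute value, so [|w|], integrable on the closed box, dominates. *)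
Lemma negligible_bumps n (Omega : set 'rV[R]_n) (w : 'rV[R]_n -> R) a b :
  cbox a b `<=` Omega -> loc_integrable Omega w ->
  (forall phi, test_function Omega phi ->
    \int[leb n]_(x in Omega) (w x * phi x) = 0) ->
  (\int[leb n]_(x in obox a b) (w x)%:E = 0)%E.
Proof.
move=> abO [mw iw] w0.
have cK := @compact_cbox R n a b; have mK := measurable_compact_row cK.
have iK := iw _ cK abO.
have /integrableP[/measurable_EFinP mwK _] := iK.
have mo := @measurable_obox R n a b.
have mbump k : measurable_fun (cbox a b) (bump a b k).
  apply: (@measurable_funS _ _ _ _ setT) => //.
  apply: measurable_fun_open_continuous; first exact: openT.
  by move=> x _; exact/smooth_gen_continuous/smooth_gen_bump.
have int0 k : (\int[leb n]_(x in cbox a b) (w x * bump a b k x)%:E = 0)%E.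
  have := w0 _ (test_function_bump k abO).
  rewrite /Rintegral.
  have -> : (\int[leb n]_(x in Omega) (w x * bump a b k x)%:E =
             \int[leb n]_(x in cbox a b) (w x * bump a b k x)%:E)%E.
    rewrite integral_mkcond [in RHS]integral_mkcond; congr integral.
    apply/funext => x; rewrite !patchE; case: ifPn => [_|].
      case: ifPn => //; rewrite notin_setE => xab.
      by rewrite bump_eq0 ?mulr0// => /obox_sub_cbox.
    by rewrite notin_setE => xO; rewrite memNset// => /abO.
  have iwb : (leb n).-integrable (cbox a b) (EFin \o (fun x => w x * bump a b k x)).
    apply: le_integrable iK => //; first exact/measurable_EFinP/measurable_funM.
    by move=> x _; rewrite lee_fin normrM ler_piMr// bump_le1.
  by move=> E; rewrite -[LHS](fineK (integrable_fin_num mK iwb))/= E.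
have := dominated_convergence (mu := leb n) mK (f_ := fun k x => (w x * bump a b k x)%:E)
  (f := fun x => (w x * \1_(obox a b) x)%:E) (g := fun x => `|w x|%:E).
case.
- by move=> k; exact/measurable_EFinP/measurable_funM.
- by apply/measurable_EFinP/measurable_funM => //; exact: measurable_indic.
- apply: aeW => x _; apply: cvg_EFin; first exact: nearW.
  by apply: cvgM; [exact: cvg_cst|exact: bump_cvg].
- exact: integrable_norm.
- by apply: aeW => x k _; rewrite lee_fin normrM ler_piMr// bump_le1.
move=> _ _; under eq_fun do rewrite int0.
move=> /cvg_lim; rewrite lim_cst// => /(_ (@ereal_hausdorff R)) E; rewrite [RHS]E.
rewrite -[in LHS](setIidr (@obox_sub_cbox R n a b)) integral_mkcondr.
apply: eq_integral => x _; rewrite patchE indicE; case: ifPn => xab.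
  by rewrite mulr1.
by rewrite mulr0.
Qed.

(** The sets [A] over whose trace on the box [w] integrates to zero form a Dynkin system containing
    all boxes, hence all measurable sets; an integrable function with this property vanishes almost
    everywhere. *)
Lemma ae_eq0_obox n (w : 'rV[R]_n -> R) a b :
  (leb n).-integrable (obox a b) (EFin \o w) ->
  (forall c d, cbox c d `<=` cbox a b -> (\int[leb n]_(x in obox c d) (w x)%:E = 0)%E) ->
  {ae leb n, forall x, obox a b x -> w x = 0}.
Proof.
move=> iw w0; pose B := obox a b; have mB : measurable B by exact: measurable_obox.
suff h A : measurable A -> (\int[leb n]_(x in A `&` B) (w x)%:E = 0)%E.
  have := @integral_ae_eq _ _ _ (leb n) B mB (cst 0%E) (EFin \o w) iw (measurable_cst _).
  have hE E : E `<=` B -> measurable E ->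
      (\int[leb n]_(x in E) (EFin \o w) x = \int[leb n]_(x in E) cst 0 x)%E.
    by move=> EB mE; rewrite integral0 -(setIidl EB); exact: h.
  by move=> /(_ hE); apply: filterS => x /[apply] -[].
rewrite measurable_oboxesE; apply: (@dynkin_induction ms 'rV[R]_n (@oboxes n)
  (fun A => (\int[leb n]_(x in A `&` B) (w x)%:E = 0)%E)) => //.
- exact: measurable_oboxesE.
- move=> _ _ [c [d ->]] [e [f ->]]; rewrite oboxI.
  by eexists; eexists.
- by rewrite setTI; exact: w0.
- move=> _ [c [d ->]]; rewrite oboxI; apply: w0 => x xab i.
  by have := xab i; rewrite ge_max le_min => /andP[/andP[_ ->] /andP[_ ->]].
- move=> S mS S0.
  have mSB : measurable (S `&` B) by exact: measurableI.
  have mSB' : measurable (~` S `&` B) by apply: measurableI => //; exact: measurableC.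
  have BE : B = (S `&` B) `|` (~` S `&` B) by rewrite -setIUl setUv setTI.
  have := w0 a b (fun x h => h); rewrite -/B {1}BE integral_setU_EFin//.
  + by rewrite S0 add0e.
  + by rewrite -BE; have /integrableP[/measurable_EFinP] := iw.
  + by apply/disj_setPS => x [[Sx _] [nSx _]].
- move=> F mF tF F0; rewrite setI_bigcupl integral_bigcup.
  + by rewrite eseries0// => i _ _; exact: F0.
  + exact: trivIset_setIr.
  + by move=> k; exact: measurableI.
  + apply: integrableS iw => //; last by move=> x [k _ []].
    by apply: bigcupT_measurable => k; exact: measurableI.
Qed.

Lemma fundamental_lemma n (Omega : set 'rV[R]_n) (w : 'rV[R]_n -> R) :
  open Omega -> loc_integrable Omega w ->
  (forall phi, test_function Omega phi ->
    \int[leb n]_(x in Omega) (w x * phi x) = 0) ->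
  {ae leb n, forall x, Omega x -> w x = 0}.
Proof.
move=> oO lw w0; have [B OE Bk] := open_bigcup_box oO.
suff h k : {ae leb n, forall x, B k x -> w x = 0}.
  by apply: filterS (ae_foralln h) => x hx; rewrite OE => -[k _ /hx].
have [->|[a [b [-> abO]]]] := Bk k; first exact: aeW.
apply: ae_eq0_obox => [|c d cdab].
  have cK := @compact_cbox R n a b; have [_ /(_ _ cK abO)] := lw.
  apply: integrableS; [exact: measurable_compact_row|exact: measurable_obox|].
  exact: obox_sub_cbox.
by apply: (negligible_bumps (Omega := Omega)) => //; exact: subset_trans abO.
Qed.

End fundamental_lemma.

(** * Weak derivatives: linearity, uniqueness, agreement with classical derivatives *)

Lemma near_eq_continuous (T : topologicalType) (R : realType) (f g : T -> R) x :
  (\near x, f x = g x) -> {for x, continuous f} -> {for x, continuous g}.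
Proof.
move=> fg cf; rewrite /prop_for /continuous_at -(nbhs_singleton fg).
by apply: cvg_trans cf; apply: near_eq_cvg.
Qed.

Section weak_derivatives.
Context {R : realType} {n : nat}.
Variable Omega : set 'rV[R]_n.
Hypothesis oO : open Omega.
Implicit Types (u v w g phi : 'rV[R]_n -> R) (s : 'I_n -> nat).

Let mO : measurable Omega. Proof. exact: measurable_open_row. Qed.

(** The same compact set carries all partial derivatives: its complement is open, so a function
    vanishing there has vanishing derivatives there. *)
Lemma test_function_partials phi : test_function Omega phi ->
  exists K, [/\ compact K, K `<=` Omega &
    forall l, (forall x i, derivable (partials l phi) x (basis_vec i)) /\
      continuous (partials l phi) /\ forall x, ~ K x -> partials l phi x = 0].
Proof.
move=> [sphi [K [cK KO phi0]]]; exists K; split => // l; split; last split.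
- move=> x i; have [_ /(_ (ltnSn _))] := sphi (size l).+1 l (leqnSn _).
  exact.
- by move=> x; have [/(_ x Logic.I)] := sphi (size l) l (leqnn _).
- elim: l => [//|i l IH]; apply: derive_outside => //.
  by apply: compact_closed => //; exact: norm_hausdorff.
Qed.

Lemma loc_integrableM u phi (K : set 'rV[R]_n) : loc_integrable Omega u ->
  compact K -> K `<=` Omega -> continuous phi -> (forall x, ~ K x -> phi x = 0) ->
  (leb n).-integrable Omega (EFin \o (fun x => u x * phi x)).
Proof.
move=> [_ lu] cK KO cphi phi0; have mK := measurable_compact_row cK.
have uphiK : (leb n).-integrable K (EFin \o (fun x => u x * phi x)).
  have [M phiM] := continuous_bounded_compact cK (continuous_subspaceT cphi).
  have iu := lu K cK KO; have /integrableP[/measurable_EFinP mu _] := iu.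
  apply: (le_ae_integrable mK (g := fun x => M * `|u x|)).
  - apply: measurable_funM => //; apply: (@measurable_funS _ _ _ _ setT) => //.
    by apply: measurable_fun_open_continuous; [exact: openT|move=> x _; exact: cphi].
  - by have := integrableZl mK M (integrable_norm iu); apply: eq_integrable.
  - by apply: aeW => x Kx; rewrite normrM mulrC ler_wpM2r// phiM.
apply/(integrable_mkcond _ mO); have /(integrable_mkcond _ mK) := uphiK.
apply: eq_integrable => // x _; rewrite !patchE; case: ifPn => [|].
  by rewrite inE => /KO xO; rewrite mem_set.
by rewrite notin_setE => xK; case: ifPn => // _; rewrite /= phi0// mulr0.
Qed.

Lemma loc_integrableD u v : loc_integrable Omega u -> loc_integrable Omega v ->
  loc_integrable Omega (fun x => u x + v x).
Proof.
move=> [mu lu] [mv lv]; split; first exact: measurable_funD.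
move=> K cK KO; have mK := measurable_compact_row cK.
have := integrableD mK (lu K cK KO) (lv K cK KO).
by apply: eq_integrable => // x _ /=; rewrite EFinD.
Qed.

Lemma loc_integrableZ c u : loc_integrable Omega u ->
  loc_integrable Omega (fun x => c * u x).
Proof.
move=> [mu lu]; split; first exact: measurable_funM.
move=> K cK KO; have mK := measurable_compact_row cK.
have := integrableZl mK c (lu K cK KO).
by apply: eq_integrable => // x _ /=; rewrite EFinM.
Qed.

Lemma weak_derivativeD s u v w w' : weak_derivative Omega s u w ->
  weak_derivative Omega s v w' ->
  weak_derivative Omega s (fun x => u x + v x) (fun x => w x + w' x).
Proof.
move=> [lu lw uw] [lv lw' vw]; split; [exact: loc_integrableD..|] => phi tphi.
have [K [cK KO hK]] := test_function_partials tphi.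
have [_ [c0 z0]] := hK [::]; have [_ [cs zs]] := hK (mseq s).
under eq_Rintegral do rewrite mulrDl.
under [in RHS]eq_Rintegral do rewrite mulrDl.
by rewrite !RintegralD ?mulrDr ?uw ?vw//; apply: (loc_integrableM _ cK KO).
Qed.

Lemma weak_derivativeZ s c u w : weak_derivative Omega s u w ->
  weak_derivative Omega s (fun x => c * u x) (fun x => c * w x).
Proof.
move=> [lu lw uw]; split; [exact: loc_integrableZ..|] => phi tphi.
have [K [cK KO hK]] := test_function_partials tphi.
have [_ [c0 z0]] := hK [::]; have [_ [cs zs]] := hK (mseq s).
under eq_Rintegral do rewrite -mulrA.
under [in RHS]eq_Rintegral do rewrite -mulrA.
rewrite !RintegralZl//; [|by apply: (loc_integrableM _ cK KO)..].
by rewrite uw// mulrCA.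
Qed.

Lemma weak_derivativeB s u v w w' : weak_derivative Omega s u w ->
  weak_derivative Omega s v w' ->
  weak_derivative Omega s (fun x => u x - v x) (fun x => w x - w' x).
Proof.
move=> uw /(weak_derivativeZ (-1)) vw; have := weak_derivativeD uw vw.
by under eq_fun do rewrite mulN1r; under [X in weak_derivative _ _ _ X]eq_fun
  do rewrite mulN1r.
Qed.

(** The difference of two candidates integrates to zero against every test function. As [wD] is a
    mere choice of representative, the identities about it rest on this lemma. *)
Lemma weak_derivative_unique s u w w' : weak_derivative Omega s u w ->
  weak_derivative Omega s u w' -> ae_eq_on Omega w w'.
Proof.
move=> [lu lw uw] [_ lw' uw'].
have lww' : loc_integrable Omega (fun x => w x + -1 * w' x).
  by apply: loc_integrableD => //; exact: loc_integrableZ.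
have : {ae leb n, forall x, Omega x -> w x + -1 * w' x = 0}.
  apply: fundamental_lemma lww' _ => // phi tphi.
  have [K [cK KO hK]] := test_function_partials tphi.
  have [_ [c0 z0]] := hK [::].
  under eq_Rintegral do rewrite mulrDl mulN1r mulNr.
  rewrite RintegralB//; [|by apply: (loc_integrableM _ cK KO)..].
  apply/eqP; rewrite subr_eq0; apply/eqP.
  by have := uw _ tphi; rewrite uw'// => /(can_inj (signrMK _)) /= E; rewrite E.
by apply: filterS => x /[apply] /eqP; rewrite mulN1r subr_eq0 => /eqP.
Qed.

Lemma weak_derivative_ae s u v w : loc_integrable Omega v -> ae_eq_on Omega u v ->
  weak_derivative Omega s u w -> weak_derivative Omega s v w.
Proof.
move=> lv uv [lu lw uw]; split=> // phi tphi; rewrite -uw//.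
have [K [cK KO hK]] := test_function_partials tphi.
have [_ [cs zs]] := hK (mseq s).
have /integrableP[/measurable_EFinP m1 _] := loc_integrableM lu cK KO cs zs.
have /integrableP[/measurable_EFinP m2 _] := loc_integrableM lv cK KO cs zs.
by apply: ae_eq_Rintegral => //; apply: filterS uv => x /[apply] ->.
Qed.

Lemma wDP s u w : weak_derivative Omega s u w ->
  weak_derivative Omega s u (wD Omega s u).
Proof. by move=> uw; rewrite /wD; apply: xgetPex; exists w. Qed.

Lemma wDE s u w : weak_derivative Omega s u w -> ae_eq_on Omega (wD Omega s u) w.
Proof. by move=> uw; exact: weak_derivative_unique (wDP uw) uw. Qed.

Lemma weak_derivative0 u : loc_integrable Omega u ->
  weak_derivative Omega (fun=> 0%N) u u.
Proof.
move=> lu; split=> // phi tphi.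
have -> : mseq (fun=> 0%N) = [::] :> seq 'I_n.
  by rewrite /mseq; elim: (enum _).
by rewrite /mdeg big1// expr0 mul1r.
Qed.

Lemma mseq_munit (i : 'I_n) : mseq (munit i) = [:: i].
Proof.
rewrite /mseq /munit; have := enum_uniq 'I_n; have := mem_enum 'I_n i.
elim: (enum _) => [//|j r IH] /=; rewrite !inE => /orP[/eqP ->|ir] /andP[jr ur].
  rewrite eqxx/= (_ : flatten _ = [::])//.
  elim: r jr {IH ur} => [//|k r IH] /=; rewrite inE negb_or => /andP[jk jr].
  by rewrite eq_sym (negPf jk)/= IH.
have ji : j != i by apply: contraNneq jr => ->.
by rewrite (negPf ji)/= IH.
Qed.

Lemma mdeg_munit (i : 'I_n) : mdeg (munit i) = 1%N.
Proof.
by rewrite /mdeg /munit (bigD1 i)//= eqxx big1// => j /negPf ->.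
Qed.

Lemma continuous_loc_integrable u : (forall x, Omega x -> {for x, continuous u}) ->
  loc_integrable Omega u.
Proof.
move=> cu; split; first exact: measurable_fun_open_continuous.
move=> K cK KO; have mK := measurable_compact_row cK.
have cuK : {within K, continuous u}.
  by apply: continuous_in_subspaceT => x; rewrite inE => /KO; exact: cu.
have [M uM] := continuous_bounded_compact cK cuK.
apply: measurable_bounded_integrable => //; first exact: leb_compact.
  apply: measurable_funS KO _ => //; exact: measurable_fun_open_continuous.
exists M; split; first exact: num_real.
by move=> N MN x Kx; apply: (le_trans (uM x Kx)); exact: ltW.
Qed.

(** Integration by parts: the product of [g] and a test function, extended by zero outside [Omega],
    has a continuous partial derivative on the whole space, and the integral of that derivative
    vanishes. *)
Lemma Cm_weak_derivative g i : Cm 1 Omega g ->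
  weak_derivative Omega (munit i) g (partials [:: i] g).
Proof.
move=> Cg; have [cg /(_ isT i) dg] := Cg [::] isT.
rewrite -[partials [::] g]/g in cg dg; have [cdg _] := Cg [:: i] isT.
have lg : loc_integrable Omega g by exact: continuous_loc_integrable.
have ldg : loc_integrable Omega (partials [:: i] g) by exact: continuous_loc_integrable.
split=> // phi tphi; have [K [cK KO hK]] := test_function_partials tphi.
have [dphi [cphi phi0]] := hK [::].
rewrite -[partials [::] phi]/phi in dphi cphi phi0; have [_ [cdphi dphi0]] := hK [:: i].
rewrite mseq_munit mdeg_munit expr1 mulN1r.
pose e := @basis_vec R n i.
pose dG x := g x * 'D_e phi x + phi x * 'D_e g x.
(* No regularity of [g] is known outside [Omega], whence the extension by zero. It creates no
   singularity, since [phi] vanishes in a neighbourhood of each point off [Omega]. *)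
pose G := (fun x => g x * phi x) \_ Omega.
have closedK : closed K by apply: compact_closed => //; exact: norm_hausdorff.
have GE x : Omega x -> \near x, g x * phi x = G x.
  move=> Ox; have : nbhs x Omega by exact: open_nbhs_nbhs.
  by apply: filterS => y Oy; rewrite /G patchE mem_set.
have G0 x : ~ K x -> G x = 0.
  by move=> Kx; rewrite /G patchE phi0// mulr0; case: ifP.
have nK x : ~ Omega x -> \near x, ~ K x.
  move=> Ox; apply: open_nbhs_nbhs; split; first exact: closed_openC.
  by move=> /KO.
have G0n x : ~ Omega x -> \near x, 0 = G x.
  by move=> /nK; apply: filterS => y /G0 ->.
have dGE x : Omega x -> is_derive x e G (dG x).
  move=> Ox; apply: near_eq_is_derive (GE x Ox) _.
  apply: is_derive_eq (is_deriveM (DeriveDef (dg x Ox) erefl)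
    (DeriveDef (dphi x i) erefl)) _.
  by rewrite /dG /GRing.scale.
have dG0 x : ~ Omega x -> is_derive x e G 0.
  move=> Ox; apply: near_eq_is_derive (G0n x Ox) _; exact: is_derive_cst.
have DG x : 'D_e G x = (dG \_ Omega) x.
  rewrite patchE; case: ifPn; rewrite ?inE ?notin_setE => Ox.
    by have [_ ->] := dGE x Ox.
  by have [_ ->] := dG0 x Ox.
have cdG x : Omega x -> {for x, continuous dG}.
  move=> Ox; apply: continuousD; apply: continuousM.
  - exact: cg.
  - exact: cdphi.
  - exact: cphi.
  - exact: cdg.
have [M M0 KM] := bounded_sub_box (compact_bounded cK).
have : (\int[leb n]_x ('D_e G x)%:E = 0)%E.
  apply: (integral_partial_eq0 M0).
  - move=> x; have [Ox|Ox] := pselect (Omega x).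
      by apply: near_eq_continuous (GE x Ox) _; exact: continuousM (cg x Ox) (cphi x).
    by apply: near_eq_continuous (G0n x Ox) _; exact: cst_continuous.
  - move=> x; have [Ox|Ox] := pselect (Omega x).
      by have [] := dGE x Ox.
    by have [] := dG0 x Ox.
  - rewrite (_ : (fun x => _) = dG \_ Omega); last by apply/funext => x; exact: DG.
    move=> x; have [Ox|Ox] := pselect (Omega x).
      have E : \near x, dG x = (dG \_ Omega) x.
        have : nbhs x Omega by exact: open_nbhs_nbhs.
        by apply: filterS => y Oy; rewrite patchE mem_set.
      exact: near_eq_continuous E (cdG x Ox).
    have E : \near x, 0 = (dG \_ Omega) x.
      have := nK x Ox; apply: filterS => y yK; rewrite patchE; case: ifP => // _.
      have := dphi0 _ yK; rewrite /= -/e /dG => ->.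
      by rewrite phi0// mulr0 mul0r addr0.
    by apply: near_eq_continuous E _; exact: cst_continuous.
  - by move=> x xM; apply: G0 => /KM/obox_sub_cbox.
rewrite (_ : (fun x => ('D_e G x)%:E) = (EFin \o dG) \_ Omega); last first.
  apply/funext => x; rewrite DG !patchE; by case: ifP.
rewrite -integral_mkcond => I0.
have : \int[leb n]_(x in Omega) dG x = 0 by rewrite /Rintegral I0.
rewrite RintegralD//.
- move/eqP; rewrite addr_eq0 => /eqP -> ; congr (- _).
  by apply: eq_Rintegral => x _; rewrite mulrC.
- exact: (loc_integrableM lg cK KO cdphi dphi0).
- have := loc_integrableM ldg cK KO cphi phi0.
  by apply: eq_integrable => // x _ /=; rewrite mulrC.
Qed.

End weak_derivatives.

(** * Sobolev spaces: inner product and completeness *)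

Section sobolev_space.
Context {R : realType} {n : nat}.
Variable Omega : set 'rV[R]_n.
Hypothesis oO : open Omega.
Implicit Types (u v w g : 'rV[R]_n -> R) (s : 'I_n -> nat) (m : nat).

Let mO : measurable Omega. Proof. exact: measurable_open_row. Qed.

Local Notation sq := (sqint (leb n) Omega).
Local Notation nrm := (sqnorm (leb n) Omega).
Local Notation ip := (sqip (leb n) Omega).

Lemma sobolev_wD m u s : sobolev Omega m u -> (mdeg s <= m)%N ->
  weak_derivative Omega s u (wD Omega s u).
Proof. by move=> su sm; have [w uw _] := su s sm; exact: wDP uw. Qed.

Lemma sobolev_sqint m u s : sobolev Omega m u -> (mdeg s <= m)%N ->
  sq (wD Omega s u).
Proof.
move=> su sm; have [w uw Lw] := su s sm.
have [_ [mwD _] _] := wDP uw.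
apply: (sqint_le mO mwD Lw).
by apply: filterS (wDE oO uw) => x /[apply] ->.
Qed.

Lemma sobolev_loc_integrable m u : sobolev Omega m u -> loc_integrable Omega u.
Proof.
move=> su; have [|w [] //] := su (fun=> 0%N).
by rewrite /mdeg big1.
Qed.

Lemma sobolev_le m m' u : (m <= m')%N -> sobolev Omega m' u -> sobolev Omega m u.
Proof. by move=> mm' su s sm; exact/su/(leq_trans sm). Qed.

Lemma sobolevD m u v : sobolev Omega m u -> sobolev Omega m v ->
  sobolev Omega m (u \+ v).
Proof.
move=> su sv s sm; have [w uw Lw] := su s sm; have [w' vw' Lw'] := sv s sm.
by exists (w \+ w'); [exact: weak_derivativeD|exact: sqintD].
Qed.

Lemma sobolevZ m c u : sobolev Omega m u -> sobolev Omega m (fun x => c * u x).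
Proof.
move=> su s sm; have [w uw Lw] := su s sm.
by exists (fun x => c * w x); [exact: weak_derivativeZ|exact: sqintZ].
Qed.

Lemma sobolevB m u v : sobolev Omega m u -> sobolev Omega m v ->
  sobolev Omega m (u \- v).
Proof.
move=> su sv s sm; have [w uw Lw] := su s sm; have [w' vw' Lw'] := sv s sm.
by exists (w \- w'); [exact: weak_derivativeB|exact: sqintB].
Qed.

Lemma wD_D m u v s : sobolev Omega m u -> sobolev Omega m v -> (mdeg s <= m)%N ->
  ae_eq_on Omega (wD Omega s (u \+ v)) (wD Omega s u \+ wD Omega s v).
Proof.
by move=> su sv sm; apply: wDE => //; apply: weak_derivativeD => //;
  [exact: sobolev_wD su sm|exact: sobolev_wD sv sm].
Qed.

Lemma wD_B m u v s : sobolev Omega m u -> sobolev Omega m v -> (mdeg s <= m)%N ->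
  ae_eq_on Omega (wD Omega s (u \- v)) (wD Omega s u \- wD Omega s v).
Proof.
by move=> su sv sm; apply: wDE => //; apply: weak_derivativeB => //;
  [exact: sobolev_wD su sm|exact: sobolev_wD sv sm].
Qed.

Lemma wD_Z m c u s : sobolev Omega m u -> (mdeg s <= m)%N ->
  ae_eq_on Omega (wD Omega s (fun x => c * u x)) (fun x => c * wD Omega s u x).
Proof.
by move=> su sm; apply: wDE => //; exact: weak_derivativeZ (sobolev_wD su sm).
Qed.

Lemma wD_0 m u : sobolev Omega m u -> ae_eq_on Omega (wD Omega (fun=> 0%N) u) u.
Proof.
by move=> su; apply: wDE => //; exact/weak_derivative0/sobolev_loc_integrable/su.
Qed.

Lemma HprodE m u v : Hprod Omega m u v =
  \sum_(s : midx n m | (mdeg (mval s) <= m)%N) ip (wD Omega (mval s) u) (wD Omega (mval s) v).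
Proof. by []. Qed.

Lemma HprodC m u v : Hprod Omega m u v = Hprod Omega m v u.
Proof. by apply: eq_bigr => s _; exact: sqipC. Qed.

Lemma HprodDl m u v w : sobolev Omega m u -> sobolev Omega m v -> sobolev Omega m w ->
  Hprod Omega m (u \+ v) w = Hprod Omega m u w + Hprod Omega m v w.
Proof.
move=> su sv sw; rewrite !HprodE -big_split/=; apply: eq_bigr => s sm.
have sqw z := @sobolev_sqint m z (mval s).
have suv := sobolevD su sv.
rewrite -sqipDl//; try exact: sqw.
by apply: eq_sqip => //; [exact: sqw|apply: sqintD => //; exact: sqw|exact: sqw|
  exact: sqw|exact: wD_D su sv sm|exact: aeW].
Qed.

Lemma HprodZl m c u w : sobolev Omega m u -> sobolev Omega m w ->
  Hprod Omega m (fun x => c * u x) w = c * Hprod Omega m u w.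
Proof.
move=> su sw; rewrite !HprodE mulr_sumr; apply: eq_bigr => s sm.
have sqw z := @sobolev_sqint m z (mval s).
have scu := sobolevZ c su.
rewrite -sqipZl//; try exact: sqw.
by apply: eq_sqip => //; [exact: sqw|apply: sqintZ => //; exact: sqw|exact: sqw|
  exact: sqw|exact: wD_Z su sm|exact: aeW].
Qed.

Lemma Hprod_ge0 m u : 0 <= Hprod Omega m u u.
Proof. by rewrite HprodE sumr_ge0// => s _; exact: sqip_ge0. Qed.

Lemma Hnorm_ge0 m u : 0 <= Hnorm Omega m u. Proof. exact: sqrtr_ge0. Qed.

Lemma Hnorm_sqr m u : Hnorm Omega m u ^+ 2 = Hprod Omega m u u.
Proof. by rewrite sqr_sqrtr// Hprod_ge0. Qed.

Lemma mdeg_ge s i : (s i <= mdeg s)%N.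
Proof. by rewrite /mdeg (bigD1 i)//= leq_addr. Qed.

Lemma mval_surj m s : (mdeg s <= m)%N -> exists t : midx n m, mval t = s.
Proof.
move=> sm; exists [ffun i => inord (s i)]; apply/funext => i.
by rewrite /mval ffunE inordK// ltnS (leq_trans (mdeg_ge s i)).
Qed.

Lemma sqnorm_wD_le m u s : sobolev Omega m u -> (mdeg s <= m)%N ->
  nrm (wD Omega s u) <= Hnorm Omega m u.
Proof.
move=> su sm; have [t ts] := mval_surj sm; rewrite -ts in sm *.
rewrite ler_wsqrtr// HprodE (bigD1 t)//= -[leLHS]addr0 lerD2l.
by rewrite sumr_ge0// => ? _; exact: sqip_ge0.
Qed.

(* The L^2 limit of the derivatives is the derivative of the limit. *)
Lemma weak_derivative_lim s (u w : nat -> 'rV[R]_n -> R) (u' w' : 'rV[R]_n -> R) :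
  (leb n Omega < +oo)%E ->
  (forall j, sq (u j)) -> (forall j, sq (w j)) -> sq u' -> sq w' ->
  (forall j, weak_derivative Omega s (u j) (w j)) ->
  (forall j, nrm (u j \- u') <= 2 * 2^-1 ^+ j) ->
  (forall j, nrm (w j \- w') <= 2 * 2^-1 ^+ j) ->
  weak_derivative Omega s u' w'.
Proof.
move=> Ofin su sw su' sw' uw cu cw.
have lsq f : sq f -> loc_integrable Omega f.
  move=> sf; split; first by case: sf.
  move=> K cK KO; have mK := measurable_compact_row cK.
  by have := sqint_integrable mO Ofin sf; exact: integrableS.
split; [exact: lsq..|] => phi tphi.
have [K [cK KO hK]] := test_function_partials tphi.
have sphi l : sq (partials l phi).
  have [_ [cl zl]] := hK l.
  have [M lM] := continuous_bounded_compact cK (continuous_subspaceT cl).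
  apply: (sqint_le mO _ (sqint_cst mO M Ofin)).
    by apply: measurable_fun_open_continuous => // x _; exact: cl.
  apply: aeW => x _; have [Kx|Kx] := pselect (K x).
    by apply: (le_trans (lM x Kx)); exact: ler_norm.
  by rewrite zl// normr0.
(* By Cauchy-Schwarz, pairings with a fixed square-integrable function converge at the rate of the
   L^2 convergence; the test function and its derivative are such functions. *)
have key (f : nat -> 'rV[R]_n -> R) f' psi : (forall j, sq (f j)) -> sq f' -> sq psi ->
    (forall j, nrm (f j \- f') <= 2 * 2^-1 ^+ j) ->
    forall j, `|ip (f j) psi - ip f' psi| <= 2^-1 ^+ j * (2 * nrm psi).
  move=> sf sf' sp cf j.
  have -> : ip (f j) psi - ip f' psi = ip (f j \- f') psi.
    rewrite -[in LHS](subrK (ip f' psi) (ip (f j) psi)).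
    have -> : ip (f j) psi = ip (f j \- f') psi + ip f' psi.
      rewrite -sqipDl//; last exact: sqintB.
      by congr ip; apply/funext => x /=; rewrite subrK.
    by ring.
  apply: le_trans (sqip_le mO (sqintB mO (sf j) sf') sp) _.
  by rewrite mulrA [_ * 2]mulrC ler_wpM2r// sqnorm_ge0.
apply/eqP; rewrite -subr_eq0 -normr_le0.
have sp0 := sphi [::]; have sps := sphi (mseq s).
apply: (@le0_half_expn _ _ (2 * nrm (partials (mseq s) phi) + 2 * nrm phi)) => j.
have [_ _ /(_ _ tphi) E] := uw j.
have h1 := key _ _ _ su su' sps cu j.
have h2 := key _ _ _ sw sw' sp0 cw j.
have -> : \int[leb n]_(x in Omega) (u' x * partials (mseq s) phi x) -
    (-1) ^+ mdeg s * \int[leb n]_(x in Omega) (w' x * phi x) =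
  - (ip (u j) (partials (mseq s) phi) - ip u' (partials (mseq s) phi)) +
    (-1) ^+ mdeg s * (ip (w j) phi - ip w' phi).
  by rewrite /sqip E; ring.
rewrite [leRHS]mulrDr; apply: le_trans (ler_normD _ _) _; rewrite normrN.
apply: lerD => //; rewrite normrM normrX normrN1 expr1n mul1r; exact: h2.
Qed.

(** Every derivative of order at most [m] converges in L^2; the limit for the zero multi-index is
    the candidate, and [weak_derivative_lim] identifies the other limits as its weak derivatives. *)
Lemma sobolev_complete m (u : nat -> 'rV[R]_n -> R) : (leb n Omega < +oo)%E ->
  (forall j, sobolev Omega m (u j)) ->
  (forall j, Hnorm Omega m (u j.+1 \- u j) <= 2^-1 ^+ j) ->
  exists2 w, sobolev Omega m w & exists C, forall j, Hnorm Omega m (u j \- w) <= C * 2^-1 ^+ j.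
Proof.
move=> Ofin su fast.
(* The order condition sits under the existential so that [choice] produces the limits for all
   multi-indices at once. *)
have ex s : exists w, (mdeg s <= m)%N ->
    sq w /\ forall j, nrm (wD Omega s (u j) \- w) <= 2 * 2^-1 ^+ j.
  case: (boolP (mdeg s <= m)%N) => [sm|_]; last by exists (cst 0).
  have sqs j : sq (wD Omega s (u j)) by exact: sobolev_sqint sm.
  have [|w sw wP] := sqint_complete mO Ofin sqs; last by exists w.
  move=> j; apply: le_trans (fast j).
  have suj := sobolevB (su j.+1) (su j).
  apply: le_trans (sqnorm_wD_le suj sm).
  apply: le_sqnorm => //; [exact: sqintB|exact: sobolev_sqint sm|].
  by apply: filterS (wD_B (su j.+1) (su j) sm) => x /[apply] ->.
have [w wP] := choice ex.
have z0 : (mdeg ((fun=> 0%N) : 'I_n -> nat) <= m)%N by rewrite /mdeg big1.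
pose w0 := w (fun=> 0%N).
have [sw0 cw0] := wP _ z0; rewrite -/w0 in sw0 cw0.
have squ j : sq (u j).
  have [mu _] := sobolev_loc_integrable (su j).
  apply: (sqint_le mO mu (sobolev_sqint (su j) z0)).
  by apply: filterS (wD_0 (su j)) => x /[apply] ->.
have cu0 j : nrm (u j \- w0) <= 2 * 2^-1 ^+ j.
  apply: le_trans (cw0 j); apply: le_sqnorm => //.
  - exact: sqintB.
  - by apply: sqintB => //; exact: sobolev_sqint z0.
  - by apply: filterS (wD_0 (su j)) => x /[apply] /= ->.
have wd s : (mdeg s <= m)%N -> weak_derivative Omega s w0 (w s).
  move=> sm; have [sws cws] := wP s sm.
  apply: (weak_derivative_lim Ofin squ (fun j => sobolev_sqint (su j) sm) sw0 sws _ cu0 cws).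
  by move=> j; exact: sobolev_wD sm.
have sow : sobolev Omega m w0.
  by move=> s sm; exists (w s); [exact: wd|have [] := wP s sm].
exists w0 => //.
(* Each derivative contributes at most [(2 * 2^-1 ^+ j) ^+ 2] to the squared norm, hence one summand
   4 for each multi-index. *)
pose c : R := \sum_(s : midx n m | (mdeg (mval s) <= m)%N) 4.
have c0 : 0 <= c by exact: sumr_ge0.
exists (Num.sqrt c) => j; rewrite -(@ler_pXn2r _ 2)// ?nnegrE ?sqrtr_ge0//.
rewrite Hnorm_sqr HprodE exprMn sqr_sqrtr// mulr_suml; apply: ler_sum => s sm.
have sj := sobolevB (su j) sow.
rewrite -sqr_sqnorm (_ : 4 = 2 ^+ 2); last by rewrite expr2; ring.
rewrite -exprMn lerXn2r ?nnegrE ?sqnorm_ge0 ?mulr_ge0 ?exprn_ge0//.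
have [sws cws] := wP (mval s) sm; apply: le_trans (cws j).
apply: le_sqnorm => //; [exact: sobolev_sqint sm|by apply: sqintB => //; exact: sobolev_sqint sm|].
apply: filterS2 (wD_B (su j) sow sm) (wDE oO (wd _ sm)) => x h1 h2 Ox.
by rewrite h1//= h2.
Qed.

End sobolev_space.

(** * Functions of class C^1 up to the boundary, their traces, and the subspace of vanishing
    traces *)

Section limits_on_closure.
Context {R : realType} {n : nat}.
Implicit Types (U S : set 'rV[R]_n) (f g : 'rV[R]_n -> R).

Lemma compact_closure_bounded S : bounded_set S -> compact (closure S).
Proof.
move=> /bounded_sub_box[M _ SM].
apply: (subclosed_compact _ (@compact_cbox R n (fun=> - M) (fun=> M))).
  exact: closed_closure.
rewrite (iffLR (closure_id _) (@closed_cbox R n (fun=> - M) (fun=> M))).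
by apply: closureS; apply: subset_trans SM _; exact: obox_sub_cbox.
Qed.

(** Near each point of [closure S] the limit along [U] bounds [f] on [U], and compactness of the
    closure makes the bound uniform. Limits are used instead of values because a partial derivative
    has no controlled value on the boundary. *)
Lemma bounded_of_cvg_within U S f : S `<=` U -> bounded_set S ->
  (forall x, closure U x -> cvg (f @ within U (nbhs x))) ->
  exists M, forall x, S x -> `|f x| <= M.
Proof.
move=> SU bS cf; have cS := compact_closure_bounded bS.
pose P (M : R) y := S y -> `|f y| <= M.
have : \forall M \near +oo, closure S `<=` P M.
  apply: (iffLR (compact_near_coveringP _) cS) => x Sx.
  have /cvg_ex[l /= fl] := cf x (closureS SU Sx).
  have fl1 : \forall y \near x, U y -> `|f y| <= `|l| + 1.
    have := @cvgr_norm_le _ _ _ _ _ _ _ fl (`|l| + 1); apply.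
    by rewrite ltrDl.
  exists ([set y | U y -> `|f y| <= `|l| + 1], [set M | `|l| + 1 <= M]).
    by split => //; exact: nbhs_pinfty_ge.
  by move=> [y M] /= [fy lM] Sy; apply: le_trans lM; exact/fy/SU.
move=> [M [_ MP]]; exists (M + 1) => x Sx.
by apply: (MP (M + 1)); [rewrite ltrDl|exact: subset_closure|].
Qed.

Lemma lim_within_open U f x : open U -> U x -> {for x, continuous f} ->
  lim (f @ within U (nbhs x)) = f x.
Proof.
move=> oU Ux cf; rewrite within_interior; last exact: open_nbhs_nbhs.
exact: cvg_lim cf.
Qed.

Lemma cvg_within_eq U f g (x : 'rV[R]_n) (l : R) : (forall y, U y -> f y = g y) ->
  f @ within U (nbhs x) --> l -> g @ within U (nbhs x) --> l.
Proof.
move=> fg fl A /fl h; suff : \forall y \near x, U y -> A (g y) by [].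
have {}h : \forall y \near x, U y -> A (f y) by exact: h.
by apply: filterS h => y h Uy; rewrite -fg//; exact: h.
Qed.

Lemma cvg_within_closure U f x : {within closure U, continuous f} ->
  closure U x -> f @ within U (nbhs x) --> f x.
Proof.
move=> /subspace_continuousP cf Ux; apply: cvg_trans (cf x Ux).
by apply: cvg_app; apply: within_subset; exact: subset_closure.
Qed.

End limits_on_closure.

Section C1_closure.
Context {R : realType} {n : nat}.
Variable Omega : set 'rV[R]_n.
Hypothesis oO : open Omega.
Hypothesis bO : bounded_set Omega.
Implicit Types (f g u v w : 'rV[R]_n -> R) (i : 'I_n) (c : R).

Let mO : measurable Omega. Proof. exact: measurable_open_row. Qed.
Let Ofin : (leb n Omega < +oo)%E. Proof. exact: leb_bounded. Qed.

Lemma partials_closureE g i x : Cm_closure 1 Omega g -> Omega x ->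
  partials_closure Omega [:: i] g x = partials [:: i] g x.
Proof.
move=> [_ Cg _] Ox; apply: lim_within_open => //.
by have [/(_ x Ox)] := Cg [:: i] isT.
Qed.

Lemma partials_closure_cvg g i x : Cm_closure 1 Omega g -> closure Omega x ->
  partials [:: i] g @ within Omega (nbhs x) --> partials_closure Omega [:: i] g x.
Proof. by move=> [_ _ cg] Ox; exact: cg. Qed.

Lemma partials_closure_bounded g i : Cm_closure 1 Omega g ->
  exists M, forall x, closure Omega x -> `|partials_closure Omega [:: i] g x| <= M.
Proof.
move=> Cg; have [_ _ cg] := Cg.
have [M gM] := bounded_of_cvg_within (@subset_refl _ Omega) bO (cg [:: i] isT).
exists M => x Ox; have PF := within_nbhs_proper Ox.
have h : `|partials [:: i] g y| @[y --> within Omega (nbhs x)] -->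
    `|partials_closure Omega [:: i] g x|.
  by apply: cvg_norm; exact: partials_closure_cvg.
apply: (ler_cvg_to h (cvg_cst M)).
by rewrite near_withinE; apply: nearW => y /gM.
Qed.

(** Boundedness has to be established first: [sup] bounds a set from above only if that set has some
    upper bound. *)
Lemma C1_norm_ge g : Cm_closure 1 Omega g -> forall x, closure Omega x ->
  `|g x| <= C1_norm Omega g /\
  forall i, `|partials_closure Omega [:: i] g x| <= C1_norm Omega g.
Proof.
move=> Cg x Ox; have [cg _ _] := Cg.
have [M gM] := continuous_bounded_compact (compact_closure_bounded bO) cg.
have ub0 : ubound [set `|g x| | x in closure Omega] (sup [set `|g x| | x in closure Omega]).
  by apply: ub_le_sup; exists M => _ [y Oy <-]; exact: gM.
have ubi i : ubound [set `|partials_closure Omega [:: i] g x| | x in closure Omega]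
    (sup [set `|partials_closure Omega [:: i] g x| | x in closure Omega]).
  have [Mi gMi] := partials_closure_bounded i Cg.
  by apply: ub_le_sup; exists Mi => _ [y Oy <-]; exact: gMi.
have h0 : `|g x| <= sup [set `|g x| | x in closure Omega] by apply: ub0; exists x.
have hi i : `|partials_closure Omega [:: i] g x| <=
    sup [set `|partials_closure Omega [:: i] g x| | x in closure Omega].
  by apply: ubi; exists x.
split=> [|i].
  rewrite /C1_norm -[leLHS]addr0 lerD// sumr_ge0// => i _.
  exact: le_trans (hi i).
rewrite /C1_norm (bigD1 i)//= addrCA -[leLHS]addr0 lerD// addr_ge0//.
  exact: le_trans h0.
by apply: sumr_ge0 => j _; exact: le_trans (hi j).
Qed.

Lemma partials1_lin f g c i x : Cm 1 Omega f -> Cm 1 Omega g -> Omega x ->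
  is_derive x (basis_vec i) (fun x => f x + c * g x)
    (partials [:: i] f x + c * partials [:: i] g x).
Proof.
move=> Cf Cg Ox.
have [_ /(_ isT i x Ox) df] := Cf [::] isT.
have [_ /(_ isT i x Ox) dg] := Cg [::] isT.
exact: (is_deriveD (DeriveDef df erefl) (is_deriveZ c (DeriveDef dg erefl))).
Qed.

(** The single combination [f + c * g] serves for sums, multiples and differences. *)
Lemma Cm_closure_lin f g c : Cm_closure 1 Omega f -> Cm_closure 1 Omega g ->
  Cm_closure 1 Omega (fun x => f x + c * g x) /\
  forall i x, closure Omega x ->
    partials_closure Omega [:: i] (fun x => f x + c * g x) x =
    partials_closure Omega [:: i] f x + c * partials_closure Omega [:: i] g x.
Proof.
move=> Cf Cg; have [cf Cmf clf] := Cf; have [cg Cmg clg] := Cg.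
have pE i x : Omega x -> partials [:: i] (fun x => f x + c * g x) x =
    partials [:: i] f x + c * partials [:: i] g x.
  by move=> Ox; have [_] := partials1_lin c i Cmf Cmg Ox.
have pcvg i x : closure Omega x ->
    partials [:: i] (fun x => f x + c * g x) @ within Omega (nbhs x) -->
    partials_closure Omega [:: i] f x + c * partials_closure Omega [:: i] g x.
  move=> Ox; have PF := within_nbhs_proper Ox.
  have h : (fun y => partials [:: i] f y + c * partials [:: i] g y) @ within Omega (nbhs x)
      --> partials_closure Omega [:: i] f x + c * partials_closure Omega [:: i] g x.
    apply: cvgD; first exact: partials_closure_cvg.
    by apply: cvgM; [exact: cvg_cst|exact: partials_closure_cvg].
  by apply: cvg_within_eq h => y /pE ->.
split; last first.
  move=> i x Ox; have PF := within_nbhs_proper Ox.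
  exact: cvg_lim (pcvg i x Ox).
split.
- apply/subspace_continuousP => x Ox.
  move/subspace_continuousP: cf => /(_ x Ox) hf.
  move/subspace_continuousP: cg => /(_ x Ox) hg.
  exact: (cvgD hf (cvgM (cvg_cst c) hg)).
- move=> [|i [|//]] _; split.
  + move=> x Ox; apply: continuousD; first by have [/(_ x Ox)] := Cmf [::] isT.
    apply: continuousM; first exact: cst_continuous.
    by have [/(_ x Ox)] := Cmg [::] isT.
  + by move=> _ i x Ox; have [] := partials1_lin c i Cmf Cmg Ox.
  + move=> x Ox.
    have E : \near x, partials [:: i] f x + c * partials [:: i] g x =
        partials [:: i] (fun x => f x + c * g x) x.
      have : nbhs x Omega by exact: open_nbhs_nbhs.
      by apply: filterS => y /pE ->.
    apply: near_eq_continuous E _.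
    apply: continuousD; first by have [/(_ x Ox)] := Cmf [:: i] isT.
    apply: continuousM; first exact: cst_continuous.
    by have [/(_ x Ox)] := Cmg [:: i] isT.
  + by [].
- move=> [|i [|//]] _ x Ox; last by apply/cvg_ex; eexists; exact: pcvg.
  have PF := within_nbhs_proper Ox.
  apply/cvg_ex; exists (f x + c * g x).
  apply: cvgD; first exact: cvg_within_closure.
  by apply: cvgM; [exact: cvg_cst|exact: cvg_within_closure].
Qed.

(** Almost everywhere equality becomes equality on [Omega] by continuity, then reaches the closure
    as equality of limits: traces do not depend on the C^1 representative. *)
Lemma C1_eq_closure f g : Cm_closure 1 Omega f -> Cm_closure 1 Omega g ->
  {ae leb n, forall x, Omega x -> f x = g x} ->
  forall x, closure Omega x -> f x = g x /\
    forall i, partials_closure Omega [:: i] f x = partials_closure Omega [:: i] g x.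
Proof.
move=> Cf Cg fg x Ox; have [cf Cmf clf] := Cf; have [cg Cmg clg] := Cg.
have E : forall x, Omega x -> f x = g x.
  apply: ae_continuous_eq => //.
    by move=> y Oy; have [/(_ y Oy)] := Cmf [::] isT.
  by move=> y Oy; have [/(_ y Oy)] := Cmg [::] isT.
have PF := within_nbhs_proper Ox.
have lim_eq (f' g' : 'rV[R]_n -> R) (l l' : R) : (forall y, Omega y -> f' y = g' y) ->
    f' @ within Omega (nbhs x) --> l -> g' @ within Omega (nbhs x) --> l' -> l = l'.
  move=> fg' fl gl'; apply: (cvg_unique (@norm_hausdorff _ R) fl).
  by apply: cvg_within_eq gl' => y /fg' ->.
split=> [|i].
  by apply: (lim_eq f g) => //; exact: cvg_within_closure.
apply: (lim_eq (partials [:: i] f) (partials [:: i] g)) => [y Oy||].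
- apply: near_eq_derive; have : nbhs y Omega by exact: open_nbhs_nbhs.
  by apply: filterS => z /E.
- exact: partials_closure_cvg.
- exact: partials_closure_cvg.
Qed.

Section embedding.
Variables (m : nat) (C : R).
Hypothesis C_gt0 : 0 < C.
Hypothesis emb : forall u, sobolev Omega m u -> exists g,
  [/\ Cm_closure 1 Omega g, ae_eq_on Omega u g & C1_norm Omega g <= C * Hnorm Omega m u].

(** The representative [g] and its partial derivatives are bounded by [C1_norm], and integration by
    parts identifies these derivatives almost everywhere with the weak ones of [u]. *)
Lemma embedding_ae u : sobolev Omega m u ->
  {ae leb n, forall x, Omega x -> `|u x| <= C * Hnorm Omega m u /\
    forall i, `|wD Omega (munit i) u x| <= C * Hnorm Omega m u}.
Proof.
move=> su; have [g [Cg ug gC]] := emb su; have [_ Cmg _] := Cg.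
have wg i : {ae leb n, forall x, Omega x ->
    wD Omega (munit i) u x = partials [:: i] g x}.
  apply: wDE => //.
  apply: (weak_derivative_ae oO (sobolev_loc_integrable su) _ (Cm_weak_derivative oO i Cmg)).
  by apply: filterS ug => x /[apply] ->.
have ball := filter_forall _ wg.
apply: filterS2 ug (ball (ae_filter_ringOfSetsType _)) => x {}ug wgx Ox.
have [g1 g2] := C1_norm_ge Cg (subset_closure Ox).
split=> [|i]; first by rewrite ug// (le_trans g1).
by rewrite wgx// -(partials_closureE i Cg Ox) (le_trans (g2 i)).
Qed.

Section subspace.
Variable Gamma : set 'rV[R]_n.
Hypothesis GO : Gamma `<=` closure Omega.

Lemma dot_lin (p q r nu : 'rV[R]_n) c :
  (forall i, p ord0 i = q ord0 i + c * r ord0 i) ->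
  dot p nu = dot q nu + c * dot r nu.
Proof.
move=> pE; rewrite /dot mulr_sumr -big_split; apply: eq_bigr => i _.
by rewrite pE /= mulrDl mulrA.
Qed.

Lemma dot_le (p nu : 'rV[R]_n) : `|dot p nu| <= \sum_i `|p ord0 i| * `|nu ord0 i|.
Proof.
apply: le_trans (ler_norm_sum _ _ _) _.
by apply: ler_sum => i _; rewrite normrM.
Qed.

Lemma grad_closureE f x i :
  grad_closure Omega f x ord0 i = partials_closure Omega [:: i] f x.
Proof. by rewrite mxE. Qed.

Lemma Cm_closure_lin_ex f g c : Cm_closure 1 Omega f -> Cm_closure 1 Omega g ->
  exists h, [/\ Cm_closure 1 Omega h, forall x, h x = f x + c * g x &
    forall x nu, closure Omega x -> dot (grad_closure Omega h x) nu =
      dot (grad_closure Omega f x) nu + c * dot (grad_closure Omega g x) nu].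
Proof.
move=> Cf Cg; have [Ch hp] := Cm_closure_lin c Cf Cg.
exists (fun x => f x + c * g x); split; [exact: Ch|by []|] => x nu Ox.
apply: dot_lin => i; apply: etrans (grad_closureE _ _ _) _.
apply: etrans (hp i x Ox) _.
by congr (_ + _ * _); apply: esym; exact: grad_closureE.
Qed.

Lemma sobolev0_lin u v c : sobolev0 Omega Gamma m u -> sobolev0 Omega Gamma m v ->
  sobolev0 Omega Gamma m (fun x => u x + c * v x).
Proof.
move=> [su [f [Cf uf f0]]] [sv [g [Cg vg g0]]]; split.
  exact: sobolevD su (sobolevZ oO c sv).
have [h [Ch hE hp]] := Cm_closure_lin_ex c Cf Cg.
exists h; split; first exact: Ch.
  by apply: filterS2 uf vg => x uf vg Ox; rewrite hE uf// vg.
move=> x Gx; have [fx fnu] := f0 x Gx; have [gx gnu] := g0 x Gx.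
split=> [|nu hnu]; first by rewrite hE fx gx mulr0 addr0.
apply: etrans (hp x nu (GO Gx)) _.
by apply: etrans (congr2 (fun a b => a + c * b) (fnu nu hnu) (gnu nu hnu)) _; rewrite mulr0 addr0.
Qed.

Lemma sobolev0D u v : sobolev0 Omega Gamma m u -> sobolev0 Omega Gamma m v ->
  sobolev0 Omega Gamma m (u \+ v).
Proof.
move=> su sv; have := sobolev0_lin 1 su sv.
by rewrite (_ : (fun x => _) = u \+ v)//; apply/funext => x; rewrite mul1r.
Qed.

Lemma sobolev0Z c u : sobolev0 Omega Gamma m u ->
  sobolev0 Omega Gamma m (fun x => c * u x).
Proof.
(* Writing [c u] as [u + (c - 1) u] makes it a combination of two members of the space. *)
move=> su; have := sobolev0_lin (c - 1) su su.
by rewrite (_ : (fun x => _) = fun x => c * u x)//; apply/funext => x; ring.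
Qed.

Lemma sobolev0_complete (u : nat -> 'rV[R]_n -> R) :
  (forall j, sobolev0 Omega Gamma m (u j)) ->
  (forall j, Hnorm Omega m (u j.+1 \- u j) <= 2^-1 ^+ j) ->
  exists2 w, sobolev0 Omega Gamma m w &
    exists K, forall j, Hnorm Omega m (u j \- w) <= K * 2^-1 ^+ j.
Proof.
move=> su fast; have su' j : sobolev Omega m (u j) by have [] := su j.
have [w sw [K uw]] := sobolev_complete oO Ofin su' fast.
exists w; last by exists K.
split; first exact: sw.
have [g [Cg wg _]] := emb sw; exists g; split; [exact: Cg|exact: wg|].
(* At a point of Gamma the traces of w coincide, up to sign, with those of
   u_j - w, which the embedding bounds by the Sobolev norm. *)
have key j x : Gamma x -> exists G, [/\ Cm_closure 1 Omega G,
    C1_norm Omega G <= C * (K * 2^-1 ^+ j), g x = - G x &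
    forall nu, unit_normal Gamma x nu ->
      dot (grad_closure Omega g x) nu = - dot (grad_closure Omega G x) nu].
  move=> Gx; have Ox := GO Gx.
  have [G [CG uG Gle]] := emb (sobolevB oO (su' j) sw).
  have [_ [gj [Cgj ugj gj0]]] := su j.
  have [h [Ch hE hp]] := Cm_closure_lin_ex (-1) Cgj Cg.
  have [|E1 E2] := C1_eq_closure CG Ch _ Ox.
    by apply: filterS3 wg ugj uG => y h1 h2 h3 Oy; rewrite hE -h3//= h2// h1// mulN1r.
  have [gjx gjnu] := gj0 x Gx; exists G; split; first exact: CG.
  - by apply: le_trans Gle _; rewrite ler_wpM2l// ltW.
  - by rewrite E1 hE gjx add0r mulN1r opprK.
  - move=> nu hnu.
    have E : dot (grad_closure Omega G x) nu = dot (grad_closure Omega h x) nu.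
      apply: (congr1 (dot ^~ nu)); apply/rowP => i.
      exact: etrans (grad_closureE _ _ _) (etrans (E2 i) (esym (grad_closureE _ _ _))).
    have num (p q r s : R) : p = q -> q = r + -1 * s -> r = 0 -> s = - p.
      by move=> -> -> ->; rewrite add0r mulN1r opprK.
    exact: num E (hp x nu Ox) (gjnu nu hnu).
move=> x Gx; have Ox := GO Gx; split=> [|nu hnu].
  apply/eqP; rewrite -normr_le0; apply: (@le0_half_expn _ _ (C * K)) => j.
  have [G [CG GC -> _]] := key j x Gx; rewrite normrN.
  have [h _] := C1_norm_ge CG Ox; apply: le_trans h _; apply: le_trans GC _.
  by rewrite mulrA mulrC.
apply/eqP; rewrite -normr_le0.
apply: (@le0_half_expn _ _ (C * K * \sum_i `|nu ord0 i|)) => j.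
have [G [CG GC _ /(_ nu hnu) ->]] := key j x Gx; rewrite normrN.
have [_ h] := C1_norm_ge CG Ox.
apply: le_trans (dot_le _ _) _.
rewrite mulrA mulr_sumr; apply: ler_sum => i _; rewrite ler_wpM2r// grad_closureE.
by apply: le_trans (h i) _; apply: le_trans GC _; rewrite mulrA mulrC.
Qed.

End subspace.
End embedding.
End C1_closure.

(** * A mean value theorem along several directions *)

Section mean_value.
Context {R : realType}.

Lemma MVT_direction (V : normedModType R) (f : V -> R) (z e : V) (h : R) :
  (forall s : R, derivable f (z + s *: e) e) ->
  exists2 t : R, 0 <= t <= 1 &
    f (z + h *: e) - f z = h * 'D_e f (z + (t * h) *: e).
Proof.
move=> df; pose g (s : R) := f (z + s *: e).
have dg (s : R) : is_derive s (1 : R) g ('D_e f (z + s *: e)).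
  by apply: is_derive_line; exact: df.
(* This reparametrization allows the one-variable theorem to be used on the interval from 0 to 1
   whatever the sign of [h]. *)
pose k (s : R) := s * h.
have dk (s : R) : is_derive s (1 : R) k h.
  apply: is_derive_eq (is_deriveM (is_derive_id s (1 : R)) (is_derive_cst h s (1 : R))) _.
  by rewrite scaler0 add0r [h *: 1]mulr1.
have dgk (s : R) : is_derive s (1 : R) (g \o k) ('D_e f (z + (s * h) *: e) * h).
  exact: (@is_derive1_comp _ g k s _ _ (dg (s * h)) (dk s)).
have cgk : {within `[0, 1], continuous (g \o k)}.
  by apply: derivable_within_continuous => s _; have [] := dgk s.
have [t] := MVT ltr01 (fun s _ => dgk s) cgk.
rewrite in_itv/= => /andP[t0 t1] E; exists t; first by rewrite !ltW.
move: E; rewrite /g /k /= mul1r mul0r scale0r addr0 subr0 mulr1 => ->.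
by rewrite mulrC.
Qed.

(** Coordinates are moved one at a time, so that only derivatives along the [e i] enter. The
    coordinates of the intermediate points never exceed those of [k] in absolute value, which keeps
    these points in a controlled region. *)
Lemma mean_value_directions (V : normedModType R) (I : finType) (f : V -> R)
    (e : I -> V) (z : V) (k : I -> R) :
  (forall (s : I -> R) i, derivable f (z + \sum_j s j *: e j) (e i)) ->
  exists2 d : I -> R,
    (forall i, exists2 s : I -> R, (forall j, `|s j| <= `|k j|) &
       d i = 'D_(e i) f (z + \sum_j s j *: e j)) &
    f (z + \sum_j k j *: e j) - f z = \sum_i k i * d i.
Proof.
move=> df.
suff h (r : seq I) : uniq r -> exists2 d : I -> R,
    (forall i, i \in r -> exists2 s : I -> R, (forall j, `|s j| <= `|k j|) &
       d i = 'D_(e i) f (z + \sum_j s j *: e j)) &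
    f (z + \sum_(j <- r) k j *: e j) - f z = \sum_(i <- r) k i * d i.
  have [d dP dE] := h _ (index_enum_uniq I).
  by exists d => // i; apply: dP; rewrite mem_index_enum.
elim: r => [_|i r IH /= /andP[ir ur]].
  by exists (fun=> 0) => //; rewrite !big_nil addr0 subrr.
have [d dP dE] := IH ur.
(* Coordinates already moved carry [k j], the current one carries [a], and the others are still
   zero. *)
pose s0 (a : R) j := if j == i then a else if j \in r then k j else 0.
have s0E a : \sum_j s0 a j *: e j = \sum_(j <- r) k j *: e j + a *: e i.
  rewrite (bigD1 i)//= /s0 eqxx addrC; congr (_ + _).
  rewrite big_uniq//= [RHS]big_mkcond [LHS]big_mkcond; apply: eq_bigr => j _.
  case: eqP => [->|_]; first by rewrite (negPf ir).
  by case: ifP => // _; rewrite scale0r.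
have [t t01 tE] : exists2 t : R, 0 <= t <= 1 &
    f (z + \sum_(j <- r) k j *: e j + k i *: e i) - f (z + \sum_(j <- r) k j *: e j) =
    k i * 'D_(e i) f (z + \sum_(j <- r) k j *: e j + (t * k i) *: e i).
  by apply: MVT_direction => a; rewrite -addrA -s0E; exact: df.
exists (fun j => if j == i then 'D_(e i) f (z + \sum_j s0 (t * k i) j *: e j) else d j).
  move=> j; rewrite inE; case: eqP => [->|_ /= jr]; last exact: dP.
  move=> _; exists (s0 (t * k i)) => // j'; rewrite /s0; case: eqP => [->|_].
    rewrite normrM ler_piMl// ger0_norm; by case/andP: t01.
  by case: ifP => // _; rewrite normr0.
rewrite !big_cons eqxx s0E [k i *: e i + _]addrC !addrA -tE.
rewrite (eq_big_seq (fun j => k j * d j)); last first.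
  by move=> j jr; case: eqP jr ir => // -> ->.
by rewrite -dE; ring.
Qed.

Lemma row_mx_shift n p (x : 'rV[R]_n) (y : 'rV[R]_p) (s : 'I_p -> R) :
  row_mx x y + \sum_j s j *: basis_vec (rshift n j) = row_mx x (y + \row_j s j).
Proof.
apply/rowP => i; rewrite mxE summxE.
case: (split_ordP i) => j ->.
  rewrite !row_mxEl big1 ?addr0// => l _.
  by rewrite !mxE eq_lrshift andbF mulr0.
rewrite !row_mxEr !mxE; congr (_ + _).
rewrite (bigD1 j)//= !mxE !eqxx mulr1 big1 ?addr0// => l lj.
have jl : (j == l) = false by rewrite eq_sym (negPf lj).
by rewrite !mxE eq_rshift jl andbF mulr0.
Qed.

Lemma measurable_fun_row_on d (T : measurableType d) n (D : set T) (f : T -> 'rV[R]_n) :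
  (forall i, measurable_fun D (fun t => f t ord0 i)) -> measurable_fun D f.
Proof.
move=> mf mD; apply: (measurability _ (@measurable_oboxesE R n)) => //.
move=> _ [_ [a [b ->]] <-].
have -> : D `&` f @^-1` obox a b = D `&` \bigcap_(i in [set: 'I_n])
    (D `&` (fun t => f t ord0 i) @^-1` `]a i, b i[%classic).
  apply/seteqP; split => [t [Dt ab]|t [Dt ab]]; split => // i.
    by move=> _; split => //=; rewrite in_itv/=; exact: ab.
  by have [_] := ab i Logic.I; rewrite /= in_itv.
apply: measurableI => //; apply: fin_bigcap_measurable => // i _.
exact: mf.
Qed.

End mean_value.

(** * The nonlinearity [A1] on bounded sets of jets *)

Section lower_order_term.
Context {R : realType} {n : nat}.
Variables (Omega : set 'rV[R]_n) (A1 : 'rV[R]_n -> 'rV[R]_(n + 1) -> R).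
Hypothesis oO : open Omega.
Hypothesis bO : bounded_set Omega.
Hypothesis A1_C3 : lower_order_Cm Omega A1 3.
Implicit Types (x : 'rV[R]_n) (y k : 'rV[R]_(n + 1)).

Let U := [set z : 'rV[R]_(n + (n + 1)) | Omega (lsubmx z)].
Let f (z : 'rV[R]_(n + (n + 1))) := A1 (lsubmx z) (rsubmx z).

Definition yder (l : seq 'I_(n + 1)) x y : R :=
  partials [seq rshift n j | j <- l] f (row_mx x y).

Lemma yder0 x y : yder [::] x y = A1 x y.
Proof. by rewrite /yder/= /f row_mxKl row_mxKr. Qed.

Let oU : open U.
Proof.
have cl : continuous (fun z : 'rV[R]_(n + (n + 1)) => lsubmx z : 'rV[R]_n).
  move=> z; apply: (@rV_cvg R _ (nbhs z) (nbhs_filter z)) => i; rewrite mxE.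
  by under eq_fun do rewrite mxE; exact: coord_continuous.
by apply: open_comp oO => z _; exact: cl.
Qed.

(** The points of [Omega] together with second arguments bounded by [M] form a bounded set, and the
    partial derivatives have limits up to the closure, so [bounded_of_cvg_within] applies. *)
Lemma yder_bounded_seq (M : R) l : (size l <= 3)%N ->
  exists K, forall x y, Omega x -> (forall j, `|y ord0 j| <= M) ->
    `|yder l x y| <= K.
Proof.
move=> sl; have [_ _ /(_ [seq rshift n j | j <- l])] := A1_C3.
rewrite size_map => /(_ sl) cf.
pose S := [set z : 'rV[R]_(n + (n + 1)) |
  Omega (lsubmx z) /\ forall j, `|rsubmx z ord0 j| <= M].
have bS : bounded_set S.
  have [N N0 ON] := bounded_sub_box bO.
  pose N' := Num.max N `|M|.
  have [B [Br BP]] := compact_bounded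
    (@compact_cbox R (n + (n + 1)) (fun=> - N') (fun=> N')).
  exists B; split=> // B' BB' z [Oz zM]; apply: (BP B' BB') => i; rewrite -ler_norml; case: (split_ordP i) => j ->.
    rewrite le_max; apply/orP; left; have := ON _ Oz j; rewrite mxE -ltr_norml.
    exact: ltW.
  rewrite le_max; apply/orP; right; have := zM j; rewrite mxE => /le_trans; apply.
  exact: ler_norm.
have SU : S `<=` U by move=> z [].
have [K fK] := bounded_of_cvg_within SU bS cf.
exists K => x y Ox yM; apply: fK; split; first by rewrite row_mxKl.
by rewrite row_mxKr.
Qed.

Lemma yder_bounded (M : R) : exists2 K, 0 <= K &
  forall l x y, (size l <= 2)%N -> Omega x -> (forall j, `|y ord0 j| <= M) ->
    `|yder l x y| <= K.
Proof.
have /choice[K0 K0P] (l : seq 'I_(n + 1)) : exists K, (size l <= 3)%N ->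
    forall x y, Omega x -> (forall j, `|y ord0 j| <= M) -> `|yder l x y| <= K.
  case: (boolP (size l <= 3)%N) => [sl|_]; last by exists 0.
  by have [K KP] := yder_bounded_seq M sl; exists K.
pose K1 l := `|K0 l|.
(* The sum runs over all lists of length at most 2, so it dominates the bound attached to each of
   them. *)
pose K := K1 [::] + \sum_i K1 [:: i] + \sum_i \sum_j K1 [:: i; j].
have K10 l : 0 <= K1 l by exact: normr_ge0.
have K1s : 0 <= \sum_i K1 [:: i] by exact: sumr_ge0.
have K1ss i : 0 <= \sum_j K1 [:: i; j] by exact: sumr_ge0.
have K2s : 0 <= \sum_i \sum_j K1 [:: i; j] by exact: sumr_ge0.
exists K; first by rewrite !addr_ge0.
move=> l x y sl Ox yM; have sl3 : (size l <= 3)%N by exact: leq_trans sl _.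
apply: le_trans (K0P l sl3 x y Ox yM) _; apply: le_trans (ler_norm _) _.
rewrite -/(K1 l); case: l sl {sl3} => [|i [|j [|//]]] _.
- by rewrite /K -addrA lerDl addr_ge0.
- have h1 : K1 [:: i] <= \sum_i K1 [:: i] by rewrite (bigD1 i)//= lerDl sumr_ge0.
  by rewrite /K; have := K10 [::]; lra.
- have h1 : K1 [:: i; j] <= \sum_j K1 [:: i; j] by rewrite (bigD1 j)//= lerDl sumr_ge0.
  have h2 : \sum_j K1 [:: i; j] <= \sum_i \sum_j K1 [:: i; j].
    by rewrite [leRHS](bigD1 i)//= lerDl sumr_ge0.
  by rewrite /K; have := K10 [::]; lra.
Qed.

Lemma yder_mean_value l x y k : (size l <= 2)%N -> Omega x ->
  exists2 d : 'I_(n + 1) -> R,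
    (forall i, exists2 s : 'rV[R]_(n + 1), (forall j, `|s ord0 j| <= `|k ord0 j|) &
       d i = yder (i :: l) x (y + s)) &
    yder l x (y + k) - yder l x y = \sum_i k ord0 i * d i.
Proof.
move=> sl Ox; have [_ Cf _] := A1_C3.
pose g := partials [seq rshift n j | j <- l] f.
have dg (s : 'I_(n + 1) -> R) i :
    derivable g (row_mx x y + \sum_j s j *: basis_vec (rshift n j)) (basis_vec (rshift n i)).
  rewrite row_mx_shift; have sl' : (size [seq rshift n j | j <- l] < 3)%N.
    by rewrite size_map ltnS.
  have [_ /(_ sl')] := Cf [seq rshift n j | j <- l] (ltnW sl').
  by apply; rewrite /= row_mxKl.
have [d dP dE] := mean_value_directions (fun j => k ord0 j) dg.
exists d => [i|].
  have [s sk ->] := dP i; exists (\row_j s j) => [j|]; first by rewrite mxE.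
  by rewrite row_mx_shift.
move: dE; rewrite row_mx_shift (_ : \row_j _ = k)//.
by apply/rowP => j; rewrite mxE.
Qed.

Lemma measurable_yder l (Y : 'rV[R]_n -> 'rV[R]_(n + 1)) : (size l <= 3)%N ->
  (forall j, measurable_fun Omega (fun x => Y x ord0 j)) ->
  measurable_fun Omega (fun x => yder l x (Y x)).
Proof.
move=> sl mY; have [_ Cf _] := A1_C3.
have [|cl _] := Cf [seq rshift n j | j <- l]; first by rewrite size_map.
have mU : measurable U := measurable_open_row oU.
apply: (measurable_comp mU _ (measurable_fun_open_continuous oU cl)).
  by move=> _ [x Ox <-]; rewrite /U/= row_mxKl.
apply: measurable_fun_row_on => i; case: (split_ordP i) => j ->.
  under eq_fun do rewrite row_mxEl.
  by apply: measurable_funTS; exact: measurable_coord.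
by under eq_fun do rewrite row_mxEr; exact: mY.
Qed.

(** The last bound uses the mean value theorem twice: the increment is a sum of [k_i] times first
    derivatives at intermediate points, and these differ from the derivatives at [y] by a Lipschitz
    estimate that comes from the second derivatives. *)
Lemma A1_estimates (M : R) : exists2 K, 0 <= K & forall x y k, Omega x ->
  (forall j, `|y ord0 j| <= M) -> (forall j, `|k ord0 j| <= M) ->
  [/\ `|A1 x y| <= K,
      forall j, `|yder [:: j] x y| <= K,
      `|A1 x (y + k) - A1 x y| <= K * \sum_j `|k ord0 j|,
      forall i, `|yder [:: i] x (y + k) - yder [:: i] x y| <= K * \sum_j `|k ord0 j| &
      `|A1 x (y + k) - A1 x y - \sum_j yder [:: j] x y * k ord0 j| <=
        K * (\sum_j `|k ord0 j|) ^+ 2].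
Proof.
(* Intermediate points [y + s] with [|s_j| <= |k_j|] have coordinates up to [M + M]. *)
have [K K0 KP] := yder_bounded (M + M).
exists K => // x y k Ox yM kM.
have M0 (j : 'I_(n + 1)) : 0 <= M := le_trans (normr_ge0 _) (yM j).
have yMM j : `|y ord0 j| <= M + M by apply: le_trans (yM j) _; rewrite lerDl; exact: M0 j.
have ysMM (s : 'rV[R]_(n + 1)) : (forall j, `|s ord0 j| <= `|k ord0 j|) ->
    forall j, `|(y + s) ord0 j| <= M + M.
  move=> sk j; rewrite mxE; apply: le_trans (ler_normD _ _) _.
  by rewrite lerD// (le_trans (sk j)).
have lip l (s : 'rV[R]_(n + 1)) : (size l <= 1)%N ->
    (forall j, `|s ord0 j| <= `|k ord0 j|) ->
    `|yder l x (y + s) - yder l x y| <= K * \sum_j `|k ord0 j|.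
  move=> sl sk; have [d dP ->] := yder_mean_value y s (leq_trans sl (leqnSn 1)) Ox.
  rewrite mulr_sumr; apply: le_trans (ler_norm_sum _ _ _) _.
  apply: ler_sum => i _; rewrite normrM mulrC; have [s' s's ->] := dP i.
  apply: ler_pM => //; apply: KP => //.
  by apply: ysMM => j; exact: le_trans (s's j) (sk j).
split.
- by rewrite -yder0; exact: KP.
- by move=> j; exact: KP.
- by rewrite -!yder0; exact: lip.
- by move=> i; exact: lip.
have [d dP dE] := @yder_mean_value [::] x y k isT Ox.
rewrite -!yder0 dE -sumrB expr2 mulrA mulr_sumr.
apply: le_trans (ler_norm_sum _ _ _) _; apply: ler_sum => i _.
rewrite (mulrC (yder _ _ _)) -mulrBr normrM mulrC ler_wpM2r//.
by have [s sk ->] := dP i; exact: lip.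
Qed.

End lower_order_term.

(** * The weighted operator as a map from H^k to L^2 *)

Section operator.
Context {R : realType} {n : nat}.
Variables (Omega : set 'rV[R]_n) (m : nat) (C : R).
Hypothesis oO : open Omega.
Hypothesis bO : bounded_set Omega.
Hypothesis m_ge2 : (2 <= m)%N.
Hypothesis C_gt0 : 0 < C.
Hypothesis emb : forall u, sobolev Omega m u -> exists g,
  [/\ Cm_closure 1 Omega g, ae_eq_on Omega u g & C1_norm Omega g <= C * Hnorm Omega m u].
Variables (a : midx n 2 -> 'rV[R]_n -> R) (A1 : 'rV[R]_n -> 'rV[R]_(n + 1) -> R).
Hypothesis a_C1 : forall s : midx n 2, mdeg (mval s) = 2%N -> Cm_closure 1 Omega (a s).
Hypothesis A1_C3 : lower_order_Cm Omega A1 3.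
Variables (phi : 'rV[R]_n -> R) (Mphi : R).
Hypothesis Mphi_ge0 : 0 <= Mphi.
Hypothesis mphi : measurable_fun Omega phi.
Hypothesis phi_le : forall x, Omega x -> `|phi x| <= Mphi.
Implicit Types u v h g : 'rV[R]_n -> R.

Let mO : measurable Omega := measurable_open_row oO.
Let Ofin : (leb n Omega < +oo)%E := leb_bounded mO bO.
Local Notation H := (sobolev Omega m).
Local Notation N := (Hnorm Omega m).
Local Notation sq := (sqint (leb n) Omega).
Local Notation nrm := (sqnorm (leb n) Omega).
Let V : R := Num.sqrt (fine (leb n Omega)).

Let V0 : 0 <= V. Proof. exact: sqrtr_ge0. Qed.

Lemma ae_forall_fin (I : finType) (Q : I -> 'rV[R]_n -> Prop) :
  (forall i, {ae leb n, forall x, Q i x}) -> {ae leb n, forall x, forall i, Q i x}.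
Proof.
by move=> Qi; have := filter_forall _ Qi; apply; exact: ae_filter_ringOfSetsType.
Qed.

Lemma Cm_closure_measurable_bounded g : Cm_closure 1 Omega g ->
  measurable_fun Omega g /\ exists M, forall x, Omega x -> `|g x| <= M.
Proof.
move=> [cg Cg _]; split.
  by apply: measurable_fun_open_continuous => //; have [] := Cg [::] isT.
have [M gM] := continuous_bounded_compact (compact_closure_bounded bO) cg.
by exists M => x Ox; exact/gM/subset_closure.
Qed.

Definition jet u (x : 'rV[R]_n) : 'rV[R]_(n + 1) :=
  row_mx (wgrad Omega u x) (const_mx (u x)).

Let mdeg1 i : (mdeg (@munit n i) <= m)%N.
Proof. by rewrite mdeg_munit ltnW. Qed.

Lemma jet_ae u : H u ->
  {ae leb n, forall x, Omega x -> forall j, `|jet u x ord0 j| <= C * N u}.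
Proof.
move=> Hu; apply: filterS (embedding_ae oO bO emb Hu) => x ux Ox j.
have [u1 u2] := ux Ox.
by case: (split_ordP j) => i ->; rewrite ?row_mxEl ?row_mxEr mxE.
Qed.

Lemma jetD u h : H u -> H h ->
  {ae leb n, forall x, Omega x -> jet (u \+ h) x = jet u x + jet h x}.
Proof.
move=> Hu Hh.
have := ae_forall_fin (fun i => wD_D oO Hu Hh (mdeg1 i)).
apply: filterS => x uh Ox.
apply/rowP => j; case: (split_ordP j) => i ->; rewrite [RHS]mxE.
  by rewrite !row_mxEl !mxE uh.
by rewrite !row_mxEr !mxE.
Qed.

Lemma jetZ c u : H u ->
  {ae leb n, forall x, Omega x -> jet (fun x => c * u x) x = c *: jet u x}.
Proof.
move=> Hu.
have := ae_forall_fin (fun i => wD_Z oO c Hu (mdeg1 i)).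
apply: filterS => x uh Ox.
apply/rowP => j; case: (split_ordP j) => i ->; rewrite [RHS]mxE.
  by rewrite !row_mxEl !mxE uh.
by rewrite !row_mxEr !mxE.
Qed.

Lemma measurable_jet u j : H u -> measurable_fun Omega (fun x => jet u x ord0 j).
Proof.
move=> Hu; case: (split_ordP j) => i ->.
  under eq_fun do rewrite row_mxEl mxE.
  by have [] := sobolev_sqint oO Hu (mdeg1 i).
under eq_fun do rewrite row_mxEr mxE.
by have [] := sobolev_loc_integrable Hu.
Qed.

Local Notation pp := (principal_part Omega a).

Lemma principal_partD u h : H u -> H h ->
  {ae leb n, forall x, Omega x -> pp (u \+ h) x = pp u x + pp h x}.
Proof.
move=> Hu Hh.
have wuh (s : midx n 2) : {ae leb n, forall x, mdeg (mval s) = 2%N -> Omega x ->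
    wD Omega (mval s) (u \+ h) x = wD Omega (mval s) u x + wD Omega (mval s) h x}.
  have [s2|s2] := eqVneq (mdeg (mval s)) 2%N; last by apply: aeW => x /eqP; rewrite (negPf s2).
  have sm : (mdeg (mval s) <= m)%N by rewrite s2.
  by apply: filterS (wD_D oO Hu Hh sm) => x.
have := ae_forall_fin wuh.
apply: filterS => x uh Ox.
rewrite /principal_part -big_split/=; apply: eq_bigr => s /eqP s2.
by rewrite uh// mulrDr.
Qed.

Lemma principal_partZ c u : H u ->
  {ae leb n, forall x, Omega x -> pp (fun x => c * u x) x = c * pp u x}.
Proof.
move=> Hu.
have wuh (s : midx n 2) : {ae leb n, forall x, mdeg (mval s) = 2%N -> Omega x ->
    wD Omega (mval s) (fun x => c * u x) x = c * wD Omega (mval s) u x}.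
  have [s2|s2] := eqVneq (mdeg (mval s)) 2%N; last by apply: aeW => x /eqP; rewrite (negPf s2).
  have sm : (mdeg (mval s) <= m)%N by rewrite s2.
  by apply: filterS (wD_Z oO c Hu sm) => x.
have := ae_forall_fin wuh.
apply: filterS => x uh Ox.
rewrite /principal_part mulr_sumr; apply: eq_bigr => s /eqP s2.
by rewrite uh// mulrCA.
Qed.

Lemma sqint_coef_wD s u : H u -> mdeg (mval s) = 2%N ->
  sq (fun x => a s x * wD Omega (mval s) u x).
Proof.
move=> Hu s2; have [ma [M aM]] := Cm_closure_measurable_bounded (a_C1 s2).
apply: (sqintMb mO ma); last by exists M; exact: aeW.
by apply: (sobolev_sqint oO Hu); rewrite s2.
Qed.

Lemma sqint_principal_part u : H u -> sq (pp u).
Proof. by move=> Hu; apply: sqint_sum => // s /eqP; exact: sqint_coef_wD. Qed.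

Lemma sqnorm_principal_part : exists2 K, 0 <= K & forall u, H u -> nrm (pp u) <= K * N u.
Proof.
have /choice[M aM] (s : midx n 2) : exists M, 0 <= M /\ (mdeg (mval s) = 2%N ->
    forall x, Omega x -> `|a s x| <= M).
  have [s2|s2] := eqVneq (mdeg (mval s)) 2%N.
    have [_ [M aM]] := Cm_closure_measurable_bounded (a_C1 s2).
    by exists `|M|; split => // _ x Ox; rewrite (le_trans (aM _ Ox))// ler_norm.
  by exists 0; split => // /eqP; rewrite (negPf s2).
exists (\sum_(s | mdeg (mval s) == 2%N) M s) => [|u Hu].
  by apply: sumr_ge0 => s _; have [] := aM s.
apply: le_trans (sqnorm_sum mO _ _) _ => [s /eqP|]; first exact: sqint_coef_wD.
rewrite mulr_suml; apply: ler_sum => s /eqP s2; have [M0 aMs] := aM s.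
have sm : (mdeg (mval s) <= m)%N by rewrite s2.
have sw := sobolev_sqint oO Hu sm.
apply: (@le_trans _ _ (nrm (fun x => M s * wD Omega (mval s) u x))).
  apply: le_sqnorm => //; [exact: sqint_coef_wD|exact: sqintZ|].
  by apply: aeW => x Ox; rewrite !normrM ler_wpM2r// (ger0_norm M0) aMs.
rewrite sqnormZ// ger0_norm// ler_wpM2l//; exact: sqnorm_wD_le.
Qed.

Definition lower_order_diff u h x : R :=
  \sum_j yder A1 [:: j] x (jet u x) * jet h x ord0 j.

Definition weighted_op u x : R := phi x * quasilinear_op Omega a A1 u x.

Definition weighted_diff u h x : R := phi x * (pp h x + lower_order_diff u h x).

Local Notation P := weighted_op.
Local Notation L := weighted_diff.

Lemma quasilinear_opE u x : quasilinear_op Omega a A1 u x = pp u x + A1 x (jet u x).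
Proof. by []. Qed.

Lemma measurable_weighted_op u : H u -> measurable_fun Omega (P u).
Proof.
move=> Hu; apply: measurable_funM => //; apply: measurable_funD.
  by have [] := sqint_principal_part Hu.
have := measurable_yder oO A1_C3 (l := [::]) isT (fun j => measurable_jet j Hu).
by under eq_fun do rewrite yder0.
Qed.

Lemma measurable_weighted_diff u h : H u -> H h -> measurable_fun Omega (L u h).
Proof.
move=> Hu Hh; apply: measurable_funM => //; apply: measurable_funD.
  by have [] := sqint_principal_part Hh.
apply: measurable_sum => j; apply: measurable_funM; last exact: measurable_jet.
exact: (measurable_yder oO A1_C3 (l := [:: j]) isT) (fun j => measurable_jet j Hu).
Qed.

(** All estimates of the operator have this shape: [g] is the contribution of the principal part, or
    zero, and [c] bounds that of the lower-order term. A constant costs the factor [V], its L^2 norm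
    being taken over a set of finite measure. *)
Lemma sqint_weighted (f g : 'rV[R]_n -> R) c : measurable_fun Omega f -> sq g -> 0 <= c ->
  {ae leb n, forall x, Omega x -> `|f x| <= `|phi x| * (`|g x| + c)} ->
  sq f /\ nrm f <= Mphi * (nrm g + c * V).
Proof.
move=> mf sg c0 fg; have [mg _] := sg.
have sgn : sq (fun x => `|g x|).
  apply: (sqint_le mO _ sg); first exact: measurableT_comp.
  by apply: aeW => x _; rewrite normr_id.
have sgc : sq ((fun x => `|g x|) \+ cst c) by apply: sqintD => //; exact: sqint_cst.
have fM : {ae leb n, forall x, Omega x -> `|f x| <= `|Mphi * (`|g x| + c)|}.
  apply: filterS fg => x fg Ox; apply: le_trans (fg Ox) _.
  rewrite normrM (ger0_norm (addr_ge0 _ c0))// ler_wpM2r ?addr_ge0//.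
  by rewrite (le_trans (phi_le Ox))// ler_norm.
have sf : sq f by apply: (sqint_le mO mf (sqintZ mO Mphi sgc)).
split=> //.
apply: le_trans (le_sqnorm mO sf (sqintZ mO Mphi sgc) fM) _.
rewrite sqnormZ// ger0_norm// ler_wpM2l//.
apply: le_trans (sqnormD mO sgn (sqint_cst mO c Ofin)) _.
rewrite sqnorm_cst// (ger0_norm c0) lerD2r.
by apply: le_sqnorm => //; apply: aeW => y _; rewrite normr_id.
Qed.


Lemma lower_order_diffD u h h' : H h -> H h' ->
  {ae leb n, forall x, Omega x ->
    lower_order_diff u (h \+ h') x = lower_order_diff u h x + lower_order_diff u h' x}.
Proof.
move=> Hh Hh'; apply: filterS (jetD Hh Hh') => x hh Ox.
rewrite /lower_order_diff hh// -big_split/=; apply: eq_bigr => j _.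
by rewrite mxE mulrDr.
Qed.

Lemma weighted_diffD u h h' : H h -> H h' ->
  {ae leb n, forall x, Omega x -> L u (h \+ h') x = L u h x + L u h' x}.
Proof.
move=> Hh Hh'; apply: filterS2 (lower_order_diffD u Hh Hh') (principal_partD Hh Hh').
move=> x h1 h2 Ox; rewrite /weighted_diff h1// h2//; ring.
Qed.

Lemma weighted_diffZ u c h : H h ->
  {ae leb n, forall x, Omega x -> L u (fun x => c * h x) x = c * L u h x}.
Proof.
move=> Hh; apply: filterS2 (jetZ c Hh) (principal_partZ c Hh) => x h1 h2 Ox.
rewrite /weighted_diff h2// /lower_order_diff h1//.
under eq_bigr do rewrite mxE mulrCA.
by rewrite -mulr_sumr; ring.
Qed.

Lemma sum_jet_le h : H h ->
  {ae leb n, forall x, Omega x -> \sum_j `|jet h x ord0 j| <= (n + 1)%:R * C * N h}.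
Proof.
move=> Hh; apply: filterS (jet_ae Hh) => x hx Ox.
apply: le_trans (ler_sum _ (fun j _ => hx Ox j)) _.
by rewrite sumr_const card_ord -mulrA mulr_natl.
Qed.

Lemma operator_estimates (M : R) : 0 <= M -> exists2 K, 0 <= K &
  forall u h, H u -> H h -> N u <= M -> N h <= M ->
  [/\ sq (P u) /\ nrm (P u) <= K,
      nrm (P (u \+ h) \- P u) <= K * N h,
      nrm (fun x => P (u \+ h) x - P u x - L u h x) <= K * N h ^+ 2 &
      forall g, H g -> [/\ sq (L u g), nrm (L u g) <= K * N g &
        nrm (L (u \+ h) g \- L u g) <= K * N h * N g]].
Proof.
move=> M0; have [Ka Ka0 ppK] := sqnorm_principal_part.
have [K1 K10 A1K] := A1_estimates bO A1_C3 (C * M).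
(* [S * N v] bounds the sum of the [n + 1] entries of the jet of [v], each of which is at most
   [C * N v]. *)
pose S : R := (n + 1)%:R * C.
have S0 : 0 <= S by rewrite mulr_ge0 ?ltW.
have sum_jet v : H v -> {ae leb n, forall x, Omega x -> \sum_j `|jet v x ord0 j| <= S * N v}.
  exact: sum_jet_le.
clearbody S.
(* [B1] bounds [P u] on the ball, [B2] the terms of first order in a single function, and [B3] those
   of second order, from which the linear principal part cancels. [B] is a common bound. *)
pose B1 := Mphi * (Ka * M + K1 * V).
pose B2 := Mphi * (Ka + K1 * S * V).
pose B3 := Mphi * (K1 * S ^+ 2 * V).
have B10 : 0 <= B1 by rewrite !(mulr_ge0, addr_ge0).
have B20 : 0 <= B2 by apply: mulr_ge0 => //; apply: addr_ge0 => //; do 2?apply: mulr_ge0 => //.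
have B30 : 0 <= B3 by do 3?apply: mulr_ge0 => //; exact: sqr_ge0.
pose B := B1 + B2 + B3.
have n1 p q : q <= M -> p <= Ka * q -> Mphi * (p + K1 * V) <= B.
  move=> qM pq; have : Mphi * (p + K1 * V) <= B1.
    by apply: ler_wpM2l => //; rewrite lerD2r (le_trans pq)// ler_wpM2l.
  by rewrite /B; lra.
have n2 p q : 0 <= q -> p <= Ka * q -> Mphi * (p + K1 * (S * q) * V) <= B * q.
  move=> q0 pq; have : Mphi * (p + K1 * (S * q) * V) <= B2 * q.
    by rewrite /B2 -(mulrA Mphi); apply: ler_wpM2l => //; lra.
  have : 0 <= (B1 + B3) * q by rewrite mulr_ge0// addr_ge0.
  by rewrite /B; lra.
have n4 p q : 0 <= p -> 0 <= q -> Mphi * (0 + K1 * (S * p) * (S * q) * V) <= B * p * q.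
  move=> p0 q0; have -> : Mphi * (0 + K1 * (S * p) * (S * q) * V) = B3 * (p * q).
    by rewrite /B3; ring.
  have : 0 <= (B1 + B2) * (p * q) by rewrite !mulr_ge0// addr_ge0.
  by rewrite /B; lra.
have n3 q : 0 <= q -> Mphi * (0 + K1 * (S * q) ^+ 2 * V) <= B * q ^+ 2.
  by move=> q0; rewrite !expr2 !mulrA in n4 *; have := n4 q q q0 q0; rewrite -!mulrA.
have K1S q : 0 <= q -> 0 <= K1 * (S * q) by move=> q0; apply: mulr_ge0 => //; exact: mulr_ge0.
have K1S2 q : 0 <= q -> 0 <= K1 * (S * q) ^+ 2 by move=> q0; rewrite mulr_ge0// sqr_ge0.
have B0 : 0 <= B by rewrite !addr_ge0.
clearbody B; clear B1 B2 B3 B10 B20 B30.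
exists B => // u h Hu Hh uM hM.
have Huh := sobolevD oO Hu Hh.
have Nh0 := Hnorm_ge0 Omega m h.
have CM v : N v <= M -> C * N v <= C * M by move=> vM; rewrite ler_pM2l.
have A1e : {ae leb n, forall x, Omega x ->
  let y := jet u x in let k := jet h x in
  [/\ `|A1 x y| <= K1,
      forall j, `|yder A1 [:: j] x y| <= K1,
      `|A1 x (y + k) - A1 x y| <= K1 * (S * N h),
      forall i, `|yder A1 [:: i] x (y + k) - yder A1 [:: i] x y| <= K1 * (S * N h) &
      `|A1 x (y + k) - A1 x y - lower_order_diff u h x| <= K1 * (S * N h) ^+ 2]}.
  apply: filterS3 (jet_ae Hu) (jet_ae Hh) (sum_jet _ Hh) => x ux hx sx Ox y k.
  have yM j : `|y ord0 j| <= C * M := le_trans (ux Ox j) (CM _ uM).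
  have kM j : `|k ord0 j| <= C * M := le_trans (hx Ox j) (CM _ hM).
  have sx0 : 0 <= \sum_j `|k ord0 j| by exact: sumr_ge0.
  have {}sx : \sum_j `|k ord0 j| <= S * N h := sx Ox.
  have sx2 : (\sum_j `|k ord0 j|) ^+ 2 <= (S * N h) ^+ 2.
    by rewrite lerXn2r// nnegrE (le_trans sx0).
  have [e1 e2 e3 e4 e5] := A1K x y k Ox yM kM; split => //.
  - by apply: le_trans e3 _; rewrite ler_wpM2l.
  - by move=> i; apply: le_trans (e4 i) _; rewrite ler_wpM2l.
  - by apply: le_trans e5 _; rewrite ler_wpM2l.
have mPu := measurable_weighted_op Hu; have mPuh := measurable_weighted_op Huh.
have mL g : H g -> measurable_fun Omega (L u g) := fun Hg => measurable_weighted_diff Hu Hg.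
have mLuh g : H g -> measurable_fun Omega (L (u \+ h) g) :=
  fun Hg => measurable_weighted_diff Huh Hg.
have s0 : sq (fun=> 0) by exact: sqint0.
have n0 : nrm (fun=> 0) = 0 by rewrite sqnorm_cst// normr0 mul0r.
have Luhg g : H g -> {ae leb n, forall x, Omega x ->
    `|lower_order_diff (u \+ h) g x - lower_order_diff u g x| <= K1 * (S * N h) * (S * N g)}.
  move=> Hg; apply: filterS3 A1e (jetD Hu Hh) (sum_jet _ Hg) => x e uhx sg Ox.
  have [_ _ _ e4 _] := e Ox; rewrite /lower_order_diff uhx// -sumrB.
  apply: (@le_trans _ _ (K1 * (S * N h) * \sum_j `|jet g x ord0 j|)); last first.
    by apply: ler_wpM2l (sg Ox); exact: (K1S _ Nh0).
  rewrite mulr_sumr; apply: le_trans (ler_norm_sum _ _ _) _.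
  by apply: ler_sum => j _; rewrite -mulrBl normrM ler_wpM2r.
split.
- have [|sP nP] := sqint_weighted mPu (sqint_principal_part Hu) K10.
    apply: filterS A1e => x e Ox; have [e1 _ _ _ _] := e Ox.
    rewrite normrM ler_wpM2l//; apply: le_trans (ler_normD _ _) _.
    by rewrite lerD2l.
  by split; [exact: sP|exact: le_trans nP (n1 _ _ uM (ppK _ Hu))].
- have [||||_ nP] := @sqint_weighted (P (u \+ h) \- P u) (pp h) (K1 * (S * N h)).
  + exact: measurable_funB.
  + exact: sqint_principal_part.
  + exact: (K1S _ Nh0).
  + apply: filterS3 A1e (jetD Hu Hh) (principal_partD Hu Hh) => x e j1 j2 Ox /=.
    rewrite /weighted_op !quasilinear_opE j1// j2// -mulrBr normrM ler_wpM2l//.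
    have [_ _ e3 _ _] := e Ox.
    rewrite (_ : _ - _ = pp h x + (A1 x (jet u x + jet h x) - A1 x (jet u x))); last by ring.
    by apply: le_trans (ler_normD _ _) _; rewrite lerD2l.
  exact: le_trans nP (n2 _ _ Nh0 (ppK _ Hh)).
- have [|||_ nP] := @sqint_weighted (fun x => P (u \+ h) x - P u x - L u h x)
      (fun=> 0) (K1 * (S * N h) ^+ 2) _ s0.
  + apply: measurable_funB; first exact: measurable_funB.
    exact: mL.
  + exact: (K1S2 _ Nh0).
  + apply: filterS3 A1e (jetD Hu Hh) (principal_partD Hu Hh) => x e j1 j2 Ox /=.
    rewrite /weighted_op /weighted_diff !quasilinear_opE j1// j2//.
    have [_ _ _ _ e5] := e Ox.
    rewrite -!mulrBr normrM ler_wpM2l// normr0 add0r.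
    rewrite (_ : _ - _ = A1 x (jet u x + jet h x) - A1 x (jet u x) - lower_order_diff u h x)//.
    by ring.
  by rewrite n0 in nP; exact: le_trans nP (n3 _ Nh0).
move=> g Hg; have Ng0 := Hnorm_ge0 Omega m g.
have [||sL nL] := @sqint_weighted (L u g) (pp g) (K1 * (S * N g)) (mL _ Hg)
    (sqint_principal_part Hg).
- exact: (K1S _ Ng0).
- apply: filterS2 A1e (sum_jet _ Hg) => x e sg Ox.
  have [_ e2 _ _ _] := e Ox; rewrite /weighted_diff normrM ler_wpM2l//.
  apply: le_trans (ler_normD _ _) _; rewrite lerD2l.
  apply: (@le_trans _ _ (K1 * \sum_j `|jet g x ord0 j|)); last first.
    by rewrite ler_wpM2l//; exact: sg.
  rewrite mulr_sumr; apply: le_trans (ler_norm_sum _ _ _) _.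
  by apply: ler_sum => j _; rewrite normrM ler_wpM2r.
have [|||_ nLL] := @sqint_weighted (L (u \+ h) g \- L u g) (fun=> 0)
    (K1 * (S * N h) * (S * N g)) _ s0.
- by apply: measurable_funB; [exact: mLuh|exact: mL].
- by apply: mulr_ge0; [exact: (K1S _ Nh0)|exact: (mulr_ge0 S0 Ng0)].
- apply: filterS (Luhg _ Hg) => x e Ox /=.
  rewrite /weighted_diff -mulrBr normrM ler_wpM2l// normr0 add0r.
  rewrite (_ : _ - _ = lower_order_diff (u \+ h) g x - lower_order_diff u g x); last by ring.
  exact: e.
rewrite n0 in nLL.
by split; [exact: sL|exact: le_trans nL (n2 _ _ Ng0 (ppK _ Hg))|exact: le_trans nLL (n4 _ _ Nh0 Ng0)].
Qed.

End operator.

(** * Linearity of the differential inside the L^2 product, and the theorem itself *)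

Section weighted_operator_inner_product.
Context {R : realType} {n : nat}.
Variables (Omega : set 'rV[R]_n) (m : nat) (C : R).
Hypothesis oO : open Omega.
Hypothesis bO : bounded_set Omega.
Hypothesis m_ge2 : (2 <= m)%N.
Hypothesis C_gt0 : 0 < C.
Hypothesis emb : forall u, sobolev Omega m u -> exists g,
  [/\ Cm_closure 1 Omega g, ae_eq_on Omega u g & C1_norm Omega g <= C * Hnorm Omega m u].
Variables (a : midx n 2 -> 'rV[R]_n -> R) (A1 : 'rV[R]_n -> 'rV[R]_(n + 1) -> R).
Hypothesis a_C1 : forall s : midx n 2, mdeg (mval s) = 2%N -> Cm_closure 1 Omega (a s).
Hypothesis A1_C3 : lower_order_Cm Omega A1 3.
Variables (phi : 'rV[R]_n -> R) (Mphi : R).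
Hypothesis Mphi_ge0 : 0 <= Mphi.
Hypothesis mphi : measurable_fun Omega phi.
Hypothesis phi_le : forall x, Omega x -> `|phi x| <= Mphi.

Let mO : measurable Omega := measurable_open_row oO.
Local Notation L := (weighted_diff Omega a A1 phi).

Lemma sqint_weighted_diff u h : sobolev Omega m u -> sobolev Omega m h ->
  sqint (leb n) Omega (L u h).
Proof.
move=> su sh; have [K _ KP] := operator_estimates oO bO m_ge2 C_gt0 emb a_C1 A1_C3
  Mphi_ge0 mphi phi_le (Hnorm_ge0 Omega m u).
by have [_ _ _ /(_ _ sh)[]] := KP _ _ su su (lexx _) (lexx _).
Qed.

Lemma sqip_weighted_diffD u h h' w : sobolev Omega m u -> sobolev Omega m h ->
  sobolev Omega m h' -> sqint (leb n) Omega w ->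
  sqip (leb n) Omega w (L u (h \+ h')) =
  sqip (leb n) Omega w (L u h) + sqip (leb n) Omega w (L u h').
Proof.
move=> su sh sh' sw; have slh := sqint_weighted_diff su sh.
have slh' := sqint_weighted_diff su sh'.
rewrite ![sqip _ _ w _]sqipC -sqipDl//.
apply: (eq_sqip mO (sqint_weighted_diff su (sobolevD oO sh sh')) (sqintD mO slh slh') sw sw).
  exact: weighted_diffD oO m_ge2 a A1 phi u h h' sh sh'.
exact: aeW.
Qed.

Lemma sqip_weighted_diffZ u c h w : sobolev Omega m u -> sobolev Omega m h ->
  sqint (leb n) Omega w ->
  sqip (leb n) Omega w (L u (fun x => c * h x)) = c * sqip (leb n) Omega w (L u h).
Proof.
move=> su sh sw; have slh := sqint_weighted_diff su sh.
rewrite ![sqip _ _ w _]sqipC -sqipZl//.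
apply: (eq_sqip mO (sqint_weighted_diff su (sobolevZ oO c sh)) (sqintZ mO c slh) sw sw).
  exact: weighted_diffZ oO m_ge2 a A1 phi u c h sh.
exact: aeW.
Qed.

End weighted_operator_inner_product.

Lemma carleman_weight_measurable_bounded (R : realType) n (Omega : set 'rV[R]_n) psi lam :
  open Omega -> bounded_set Omega -> Cm_closure 1 Omega psi ->
  measurable_fun Omega (carleman_weight psi lam) /\
  exists2 M, 0 <= M & forall x, Omega x -> `|carleman_weight psi lam x| <= M.
Proof.
move=> oO bO Cpsi; have [mpsi [M psiM]] := Cm_closure_measurable_bounded oO bO Cpsi.
split.
  by apply: measurableT_comp; [exact: measurable_expR|exact: measurable_funM].
exists (expR (`|lam| * M)) => [|x Ox]; first exact: expR_ge0.
rewrite ger0_norm ?expR_ge0// ler_expR (le_trans (ler_norm _))// normrM.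
by rewrite ler_wpM2l// psiM.
Qed.

Theorem theorem3p1 (R : realType) (n k : nat)
  (n_gt0 : (0 < n)%N) (kE : k = (n./2 + 2)%N)
  (Omega Gamma : set 'rV[R]_n)
  (Omega_open : open Omega) (Omega_conn : connected Omega)
  (Omega_bounded : bounded_set Omega)
  (Omega_emb : C1_embedding Omega k)
  (Gamma_bd : Gamma `<=` frontier Omega)
  (Gamma_smooth : smooth_hypersurface Gamma)
  (a : midx n 2 -> 'rV[R]_n -> R) (A1 : 'rV[R]_n -> 'rV[R]_(n + 1) -> R)
  (a_C1 : forall s : midx n 2, mdeg (mval s) = 2%N ->
     Cm_closure 1 Omega (a s))
  (A1_C3 : lower_order_Cm Omega A1 3)
  (Gamma_nonchar : ~ exists S : set 'rV[R]_n,
     Gamma `<=` S /\ characteristic_hypersurface Omega a S)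
  (psi : 'rV[R]_n -> R)
  (psi_smooth : forall m, Cm_closure m Omega psi)
  (psi_grad : forall x, closure Omega x -> grad_closure Omega psi x != 0)
  (alpha eps : R) (alpha_gt0 : 0 < alpha) (eps_gt0 : 0 < eps)
  (Omega_alpha_neq0 : superlevel Omega psi alpha !=set0)
  (Omega_alpha2eps_neq0 : superlevel Omega psi (alpha + 2 * eps) !=set0)
  (Gamma_alpha_neq0 : Gamma `&` closure (superlevel Omega psi alpha) !=set0)
  (frontier_Omega_alpha : frontier (superlevel Omega psi alpha) =
     level Omega psi alpha `|` (Gamma `&` closure (superlevel Omega psi alpha)))
  (r lam beta : R) (r_gt0 : 0 < r) (lam_gt1 : 1 < lam)
  (beta_gt0 : 0 < beta) (beta_lt1 : beta < 1)
  (F : 'rV[R]_n -> R) (F_sobolev : sobolev Omega k.+1 F) :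
  let J := J_functional Omega a A1 k psi alpha eps lam beta F in
  (forall v, sobolev0 Omega Gamma k v -> Hnorm Omega k v < 2 * r ->
     exists DJ, frechet_derivative Omega Gamma k J v DJ) /\
  (exists2 L : R, 0 < L &
     forall v1 v2 DJ1 DJ2,
       sobolev0 Omega Gamma k v1 -> Hnorm Omega k v1 <= r ->
       sobolev0 Omega Gamma k v2 -> Hnorm Omega k v2 <= r ->
       frechet_derivative Omega Gamma k J v1 DJ1 ->
       frechet_derivative Omega Gamma k J v2 DJ2 ->
       Hnorm Omega k (DJ1 \- DJ2) <= L * Hnorm Omega k (v1 \- v2)).
Proof.
move=> J; have [C C0 emb] := Omega_emb.
have k2 : (2 <= k)%N by rewrite kE addn2.
have mO := measurable_open_row Omega_open.
have GO : Gamma `<=` closure Omega by move=> x /Gamma_bd[].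
have [mphi [Mphi Mphi0 phiM]] :=
  carleman_weight_measurable_bounded lam Omega_open Omega_bounded (psi_smooth 1).
pose phi := carleman_weight psi lam.
pose P := weighted_op Omega a A1 phi.
pose L := weighted_diff Omega a A1 phi.
pose c := expR (- 2 * lam * (alpha + eps)).
have FH : sobolev Omega k F by apply: sobolev_le F_sobolev.
(* Moving the weight inside the square turns the weighted integral into the L^2 product of
   [P (v + F)] with itself. *)
have JE : J = tikhonov (Hprod Omega k) (sqip (leb n) Omega) P F c beta.
  apply/funext => v; rewrite /J /J_functional /tikhonov.
  congr (_ * _ + _); apply: eq_Rintegral => x _.
  by rewrite /P /weighted_op -expr2 exprMn mulrC.
have est := operator_estimates Omega_open Omega_bounded k2 C0 emb a_C1 A1_C3 Mphi0 mphi phiM.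
have LD := sqip_weighted_diffD Omega_open Omega_bounded k2 C0 emb a_C1 A1_C3 Mphi0 mphi phiM.
have LZ := sqip_weighted_diffZ Omega_open Omega_bounded k2 C0 emb a_C1 A1_C3 Mphi0 mphi phiM.
have c0 : 0 <= c := expR_ge0 _.
(* The abstract results are applied with all of H^k as [K], where [F] lives, and with the subspace
   of vanishing traces as [H], where the derivative is represented. *)
have HK : sobolev0 Omega Gamma k `<=` sobolev Omega k by move=> u [].
split.
  move=> v Hv _; rewrite JE.
  exact: (tikhonov_frechet_exists (@sobolevD _ _ _ Omega_open k) (@sobolevZ _ _ _ Omega_open k)
    (HprodC Omega k) (@HprodDl _ _ _ Omega_open k) (@HprodZl _ _ _ Omega_open k)
    (fun u _ => Hprod_ge0 Omega k u)
    (sqintD mO) (sqintZ mO) (sqipC (leb n) Omega) (sqipDl mO) (sqipZl mO)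
    (fun f _ => sqip_ge0 (leb n) Omega f) HK
    (@sobolev0D _ _ _ Omega_open k _ GO) (@sobolev0Z _ _ _ Omega_open k _ GO)
    (@sobolev0_complete _ _ _ Omega_open Omega_bounded k _ C0 emb _ GO)
    est LD LZ FH c0 beta_gt0 Hv).
rewrite JE.
exact: (tikhonov_frechet_lipschitz (@sobolevD _ _ _ Omega_open k) (@sobolevZ _ _ _ Omega_open k)
  (HprodC Omega k) (@HprodDl _ _ _ Omega_open k) (@HprodZl _ _ _ Omega_open k)
  (fun u _ => Hprod_ge0 Omega k u)
  (sqintD mO) (sqintZ mO) (sqipC (leb n) Omega) (sqipDl mO) (sqipZl mO)
  (fun f _ => sqip_ge0 (leb n) Omega f) HK
  (@sobolev0D _ _ _ Omega_open k _ GO) (@sobolev0Z _ _ _ Omega_open k _ GO)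
  est LZ FH c0 beta_gt0 (ltW r_gt0)).
Qed.
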